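(* For any $\lambda,\gamma>0$ and any $q\in\overline{P(d,s_0,s_1)}$ the functional $K_{\lambda,\gamma}$ has a Fréchet derivative $K_{\lambda,\gamma}'(q)\in H_0^4(\Omega)$ at $q$. Let $\lambda_0=\lambda_0(\alpha,\Omega)\ge 1$ be the number in the Carleman estimate recalled in the context, and let $\mu\in(0,2\alpha a)$. Then there exist a sufficiently large number $\lambda_1=\lambda_1(\alpha,d,\Omega)\ge\lambda_0$ and a number $B=B(\alpha,d,\Omega)>0$, both depending only on the listed parameters, such that for all $\lambda\ge\lambda_1$ and all $\gamma\in[2e^{-\lambda\alpha\widetilde T},1)$ the functional $K_{\lambda,\gamma}$ is strictly convex on $\overline{P(d,s_0,s_1)}$; more precisely, for all $q_1,q_2\in\overline{P(d,s_0,s_1)}$, $$K_{\lambda,\gamma}(q_2)-K_{\lambda,\gamma}(q_1)-K_{\lambda,\gamma}'(q_1)(q_2-q_1)\ \ge\ Be^{-2\lambda(2\alpha a-\mu)}\|q_2-q_1\|^2_{H^1(R_{a,\alpha,\mu})}$$ $$+\,Be^{-2\lambda(2\alpha a-\mu)}\|q_2(x,0)-q_1(x,0)\|^2_{H^1(0,2\alpha a-\mu)}+\frac{\gamma}{2}\|q_2-q_1\|^2_{H^4(\Omega)}.$$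
   Context: All functions are real valued. Fix $\overline c>1$ and $a\ge\sqrt{\overline c}$, set $\widetilde T=2a$ and $\Omega=(0,a)\times(0,\widetilde T)\subset\mathbb R^2$, with points $(x,t)$. Fix $\alpha\in(0,1/2)$ and set $\psi_\lambda(x,t)=e^{-2\lambda(x+\alpha t)}$. Define $$M(q)(x,t)=q_{xx}(x,t)-2q_{xt}(x,t)+4q_x(x,0)\,q(x,t),\quad (x,t)\in\Omega .$$ Let $s_0,s_1$ be given functions on $(0,\widetilde T)$ and $d>0$ an arbitrary number. Define $$P(d,s_0,s_1)=\{q\in H^4(\Omega): q(0,t)=s_0(t),\ q_x(0,t)=s_1(t),\ q_x(a,t)=0,\ \|q\|_{H^4(\Omega)}<d\},$$ with closure $\overline{P(d,s_0,s_1)}$ in $H^4(\Omega)$, and $$K_{\lambda,\gamma}(q)=\int_\Omega [M(q)]^2\psi_\lambda\,dx\,dt+\gamma\|q\|^2_{H^4(\Omega)} .$$ Spaces: $H_0^2(\Omega)=\{u\in H^2(\Omega):u(0,t)=u_x(0,t)=0,\ t\in(0,\widetilde T)\}$ and $H_0^4(\Omega)=\{u\in H^4(\Omega):u(0,t)=u_x(0,t)=u_x(a,t)=0,\ t\in(0,\widetilde T)\}$ (with the $H^4(\Omega)$ scalar product). The Fréchet derivative is taken with respect to increments in $H_0^4(\Omega)$; it is a bounded linear functional on $H_0^4(\Omega)$, identified with an element of $H_0^4(\Omega)$ by the Riesz theorem, and $K'_{\lambda,\gamma}(q)(h)$ denotes its action on $h\in H^4_0(\Omega)$. For $\mu\in(0,2\alpha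 a)$, $R_{a,\alpha,\mu}=\{(x,t): x,t>0,\ x+\alpha t<2\alpha a-\mu\}\subset\Omega$. Carleman estimate (known): there exist $C=C(\alpha,\Omega)>0$ and $\lambda_0=\lambda_0(\alpha,\Omega)\ge1$ such that for all $w\in H_0^2(\Omega)$ and all $\lambda\ge\lambda_0$ $$\int_\Omega (w_{xx}-2w_{xt})^2\psi_\lambda\,dxdt\ge C\int_\Omega[\lambda(w_x^2+w_t^2)+\lambda^3w^2]\psi_\lambda\,dxdt+C\int_0^a[\lambda w_x^2+\lambda^3w^2](x,0)e^{-2\lambda x}dx$$ $$-\,Ce^{-2\lambda\alpha\widetilde T}\int_0^a[\lambda w_x^2+\lambda^3w^2](x,\widetilde T)\,dx .$$ *)

(* Defs.v *)
From HB Require Import structures.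
From mathcomp Require Export all_boot all_order all_algebra.
From mathcomp Require Export all_classical all_reals all_analysis.
Export Order.TTheory GRing.Theory Num.Theory.
Export numFieldNormedType.Exports.

Set Implicit Arguments.
Unset Strict Implicit.
Unset Printing Implicit Defensive.

Local Open Scope classical_set_scope.
Local Open Scope ring_scope.

(* An element of L^2 or of a Sobolev space on U is represented by a total
   function that is Borel measurable on U; its values outside U are irrelevant.
   A point of the plane is p = (x, t), with x = p.1 and t = p.2. *)

Definition leb1 (R : realType) :
  {measure set (measurableTypeR R) -> \bar R} := @lebesgue_measure R.
Definition leb2 (R : realType) :
    {measure set (measurableTypeR R * measurableTypeR R)%type -> \bar R} :=
  (@lebesgue_measure R \x @lebesgue_measure R)%E.

Definition L2 d (T : measurableType d) (R : realType)
    (mu : {measure set T -> \bar R}) (D : set T) (f : T -> R) : Prop :=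
  measurable_fun D f /\ (\int[mu]_(y in D) ((f y ^+ 2)%:E) < +oo)%E.

Section smooth_functions.
Variable R : realType.

Definition pderx (f : R * R -> R) : R * R -> R :=
  fun p => derive1 (fun x => f (x, p.2)) p.1.
Definition pdert (f : R * R -> R) : R * R -> R :=
  fun p => derive1 (fun t => f (p.1, t)) p.2.

(* s lists the successive differentiations: true for x, false for t. *)
Definition pders (s : seq bool) (f : R * R -> R) : R * R -> R :=
  foldr (fun b g => if b then pderx g else pdert g) f s.

Definition smooth2 (f : R * R -> R) : Prop :=
  forall s : seq bool,
    [/\ continuous (pders s f),
        forall p, derivable (fun x => pders s f (x, p.2)) p.1 1 &
        forall p, derivable (fun t => pders s f (p.1, t)) p.2 1].

Definition test2 (U : set (R * R)) (phi : R * R -> R) : Prop :=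
  [/\ smooth2 phi, compact (closure [set p | phi p != 0]) &
      closure [set p | phi p != 0] `<=` U].

Definition smooth1 (f : R -> R) : Prop :=
  forall (n : nat) (x : R), derivable (derive1n n f) x 1.

Definition test1 (I : set R) (phi : R -> R) : Prop :=
  [/\ smooth1 phi, compact (closure [set x | phi x != 0]) &
      closure [set x | phi x != 0] `<=` I].

End smooth_functions.

Section sobolev_spaces.
Variable R : realType.
Implicit Types (U : set (R * R)) (u v : R * R -> R).

Definition is_wder U (i j : nat) u v : Prop :=
  L2 (leb2 R) U v /\
  forall phi, test2 U phi ->
    \int[leb2 R]_(p in U) (u p * iter i (@pderx R) (iter j (@pdert R) phi) p)
    = (-1) ^+ (i + j) * \int[leb2 R]_(p in U) (v p * phi p).

(* The weak derivative d_x^i d_t^j u in L^2(U): unique up to a null set if it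
   exists, 0 otherwise. *)
Definition wder U (i j : nat) u : R * R -> R :=
  xget (fun=> 0) [set v | is_wder U i j u v].

Definition sobolev U (k : nat) u : Prop :=
  L2 (leb2 R) U u /\
  forall i j, (i + j <= k)%N -> exists v, is_wder U i j u v.

Definition hinner U (k : nat) u v : R :=
  \sum_(i < k.+1) \sum_(j < k.+1 | (i + j <= k)%N)
    \int[leb2 R]_(p in U) (wder U i j u p * wder U i j v p).

Definition hnorm U (k : nat) u : R := Num.sqrt (hinner U k u u).

Definition is_wder1 (I : set R) (f g : R -> R) : Prop :=
  L2 (leb1 R) I g /\
  forall phi, test1 I phi ->
    \int[leb1 R]_(x in I) (f x * derive1 phi x)
    = - \int[leb1 R]_(x in I) (g x * phi x).

Definition wder1 (I : set R) (f : R -> R) : R -> R :=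
  xget (fun=> 0) [set g | is_wder1 I f g].

Definition h1norm1 (I : set R) (f : R -> R) : R :=
  Num.sqrt (\int[leb1 R]_(x in I) (f x ^+ 2)
            + \int[leb1 R]_(x in I) (wder1 I f x ^+ 2)).

End sobolev_spaces.

Section rectangle.
Variables (R : realType) (a : R).
Implicit Types (u w q : R * R -> R).

Definition Omega : set (R * R) :=
  [set p | (0 < p.1 < a) /\ (0 < p.2 < 2 * a)].

Definition Ix : set R := `]0, a[.
Definition It : set R := `]0, 2 * a[.

(* The traces of u in H^1(Omega) on the sides x = 0 and x = a (resp. t = 0 and
   t = 2a), characterized by Green's formula. *)
Definition is_xtraces u (g : (R -> R) * (R -> R)) : Prop :=
  [/\ L2 (leb1 R) It g.1, L2 (leb1 R) It g.2 &
   forall phi : R * R -> R, smooth2 phi ->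
    \int[leb2 R]_(p in Omega) (u p * pderx phi p + wder Omega 1 0 u p * phi p)
    = \int[leb1 R]_(t in It) (g.2 t * phi (a, t) - g.1 t * phi (0, t))].

Definition is_ttraces u (g : (R -> R) * (R -> R)) : Prop :=
  [/\ L2 (leb1 R) Ix g.1, L2 (leb1 R) Ix g.2 &
   forall phi : R * R -> R, smooth2 phi ->
    \int[leb2 R]_(p in Omega) (u p * pdert phi p + wder Omega 0 1 u p * phi p)
    = \int[leb1 R]_(x in Ix) (g.2 x * phi (x, 2 * a) - g.1 x * phi (x, 0))].

Definition xtraces u : (R -> R) * (R -> R) :=
  xget (fun=> 0, fun=> 0) [set g | is_xtraces u g].
Definition ttraces u : (R -> R) * (R -> R) :=
  xget (fun=> 0, fun=> 0) [set g | is_ttraces u g].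

Definition tr_x0 u : R -> R := (xtraces u).1.
Definition tr_xa u : R -> R := (xtraces u).2.
Definition tr_t0 u : R -> R := (ttraces u).1.
Definition tr_tT u : R -> R := (ttraces u).2.

Definition Dx u : R * R -> R := wder Omega 1 0 u.
Definition Dt u : R * R -> R := wder Omega 0 1 u.
Definition Dxx u : R * R -> R := wder Omega 2 0 u.
Definition Dxt u : R * R -> R := wder Omega 1 1 u.

Definition psi (alpha lambda : R) : R * R -> R :=
  fun p => expR (- 2 * lambda * (p.1 + alpha * p.2)).

Definition M q : R * R -> R :=
  fun p => Dxx q p - 2 * Dxt q p + 4 * tr_t0 (Dx q) p.1 * q p.

Definition K (alpha lambda gamma : R) q : R :=
  \int[leb2 R]_(p in Omega) (M q p ^+ 2 * psi alpha lambda p)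
  + gamma * hnorm Omega 4 q ^+ 2.

Definition H4 q : Prop := sobolev Omega 4 q.

Definition H02 w : Prop :=
  [/\ sobolev Omega 2 w, ae_eq (leb1 R) It (tr_x0 w) (fun=> 0) &
      ae_eq (leb1 R) It (tr_x0 (Dx w)) (fun=> 0)].

Definition H04 w : Prop :=
  [/\ H4 w, ae_eq (leb1 R) It (tr_x0 w) (fun=> 0),
      ae_eq (leb1 R) It (tr_x0 (Dx w)) (fun=> 0) &
      ae_eq (leb1 R) It (tr_xa (Dx w)) (fun=> 0)].

Definition P (d : R) (s0 s1 : R -> R) q : Prop :=
  [/\ H4 q, ae_eq (leb1 R) It (tr_x0 q) s0,
      ae_eq (leb1 R) It (tr_x0 (Dx q)) s1,
      ae_eq (leb1 R) It (tr_xa (Dx q)) (fun=> 0) &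
      hnorm Omega 4 q < d].

Definition closureP (d : R) (s0 s1 : R -> R) q : Prop :=
  H4 q /\
  forall eps : R, 0 < eps ->
    exists2 p, P d s0 s1 p & hnorm Omega 4 (q \- p) < eps.

(* ell is the Frechet derivative of J at q with respect to increments in
   H_0^4(Omega); only the values of ell on H_0^4(Omega) matter. *)
Definition frechet_derivative (J : (R * R -> R) -> R) q
    (ell : (R * R -> R) -> R) : Prop :=
  [/\ forall (c : R) u w, H04 u -> H04 w ->
        ell (fun p => c * u p + w p) = c * ell u + ell w,
      exists b : R, forall h, H04 h -> `|ell h| <= b * hnorm Omega 4 h &
      forall eps : R, 0 < eps -> exists2 delta : R, 0 < delta &
        forall h, H04 h -> hnorm Omega 4 h < delta ->
          `|J (q \+ h) - J q - ell h| <= eps * hnorm Omega 4 h].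

Definition carleman_estimate (alpha C lambda0 : R) : Prop :=
  forall w (lambda : R), H02 w -> lambda0 <= lambda ->
    \int[leb2 R]_(p in Omega)
        ((Dxx w p - 2 * Dxt w p) ^+ 2 * psi alpha lambda p)
    >= C * \int[leb2 R]_(p in Omega)
             ((lambda * (Dx w p ^+ 2 + Dt w p ^+ 2)
               + lambda ^+ 3 * w p ^+ 2) * psi alpha lambda p)
     + C * \int[leb1 R]_(x in Ix)
             ((lambda * tr_t0 (Dx w) x ^+ 2 + lambda ^+ 3 * tr_t0 w x ^+ 2)
              * expR (- 2 * lambda * x))
     - C * expR (- 2 * lambda * alpha * (2 * a))
         * \int[leb1 R]_(x in Ix)
             (lambda * tr_tT (Dx w) x ^+ 2 + lambda ^+ 3 * tr_tT w x ^+ 2).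

Definition Rset (alpha mu : R) : set (R * R) :=
  [set p | [/\ 0 < p.1, 0 < p.2 &
               p.1 + alpha * p.2 < 2 * alpha * a - mu]].

End rectangle.

(* Main.v *)
Require Import Defs.
From mathcomp Require Import measurable_realfun ring lra zify.

(** The operator [M] is quadratic, so [K (q + h) - K q] is the sum of a part that is
    linear in [h], called [dK], and of a remainder [remK] of second order
    ([K_expand]). Both statements follow from bounds for these two terms.

    All bounds rest on one fact about a single direction. If [v] is the weak
    derivative of [u] in [x], then [u(x,t) = c(t) + int_0^x v(s,t) ds] almost
    everywhere ([xrep]). It gives Green's formula, hence the traces, their bounds,
    and a bound of the integral of [u(x,t)^2] in [t] alone that is uniform in [x]
    ([xtrace], [slice_bound]); used in the direction [t] as well, it shows that the
    trace [q_x(x,0)] is a bounded function ([trace_sup_bound]). The nonlinear term is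
    a product of such a trace and of a function with bounded slices, so integrating
    it in [t] first bounds it by norms in H^4 ([gm_sq]).

    Derivative. [dK] is a bounded linear functional on the space of increments. That
    space is complete, because weak derivatives and traces pass to the limit
    ([H04_complete]), so Riesz's theorem represents [dK] by an element of it
    ([dK_riesz]). A linear functional that approximates the increments of [K] to
    first order coincides with [dK] on increments ([frechet_uniq]).

    Convexity. For an increment [h] between two points of the closed set, the main
    term of the remainder is the weighted integral of [(h_xx - 2 h_xt + r)^2], where
    [r] is made of products of a trace and a function; half of the square of the
    principal part minus the square of [r] bounds it below. The Carleman estimate
    for [h] produces the weighted integrals of [h_x^2 + h_t^2], of [h^2] and of the
    squared traces of [h_x] and [h] on [t = 0], with positive powers of [lambda].
    The same integrals without these powers dominate [r^2] and the term with
    [M(q1)]: the factor that is not a slice is either [h] itself, next to a bounded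
    trace of [q1], or the trace of [h_x], for which the weight is replaced by the
    larger [exp(-2 lambda x)] before integrating in [t]. They are absorbed when
    [lambda] is large. The terms of the Carleman estimate on [t = 2a] carry
    [lambda^3 exp(-4 lambda alpha a)] and are absorbed by the regularization, since
    [gamma >= 2 exp(-2 lambda alpha a)]. This is [remK_lower]. Finally the weight is
    at least [exp(-2 lambda (2 alpha a - mu))] on the triangle and on its base ([hnorm_Rset],
    [h1norm1_trace]). Strict convexity follows by expanding at the intermediate point
    ([strictly_convex]).

    Comparisons of norms and integrals are first stated for arbitrary real numbers,
    as the local facts [ar], and then instantiated. *)

Local Open Scope classical_set_scope.
Local Open Scope ring_scope.
Set Implicit Arguments.
Unset Strict Implicit.
Unset Printing Implicit Defensive.

(** * Square-integrable functions and real-valued integrals *)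

Section square_integrable.
Context {d : measure_display} {T : measurableType d} {R : realType}.
Variables (mu : {measure set T -> \bar R}) (D : set T).
Hypothesis mD : measurable D.
Implicit Types f g h : T -> R.

(** Integrability of real-valued functions: the side condition of every use of the
    linearity of the real-valued integral. *)
Definition intble f := mu.-integrable D (EFin \o f).

Lemma intbleP f : intble f -> measurable_fun D f.
Proof. by move=> /integrableP[/measurable_EFinP]. Qed.

Lemma intble_le f g : measurable_fun D f -> intble g ->
  (forall x, D x -> `|f x| <= g x) -> intble f.
Proof.
move=> mf ig fg; apply: le_integrable ig => //; first exact/measurable_EFinP.
by move=> x Dx /=; rewrite lee_fin (le_trans (fg x Dx)) ?ler_norm.
Qed.

Lemma intbleD f g : intble f -> intble g -> intble (fun x => f x + g x).
Proof. by move=> hf hg; exact: integrableD hf hg. Qed.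

Lemma intbleB f g : intble f -> intble g -> intble (fun x => f x - g x).
Proof. by move=> hf hg; exact: integrableB hf hg. Qed.

Lemma intbleZ c f : intble f -> intble (fun x => c * f x).
Proof. by move=> hf; exact: (integrableZl mD c hf). Qed.

Lemma intble0 : intble (fun=> 0).
Proof. exact: integrable0. Qed.

Lemma intble_norm f : intble f -> intble (fun x => `|f x|).
Proof. exact: integrable_norm. Qed.

Lemma eq_intble f g : (forall x, D x -> f x = g x) -> intble f -> intble g.
Proof.
move=> fg; apply: eq_integrable => // x; rewrite inE => Dx /=.
by rewrite fg.
Qed.

Lemma Rintegral_ae_eq f g : measurable_fun D f -> measurable_fun D g ->
  ae_eq mu D f g -> \int[mu]_(x in D) f x = \int[mu]_(x in D) g x.
Proof.
move=> mf mg fg; rewrite /Rintegral; congr fine.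
apply: ae_eq_integral => //; [exact/measurable_EFinP..|].
by apply: filterS fg => x /= fg Dx; rewrite fg.
Qed.

Lemma intble_ae_eq f g : measurable_fun D g ->
  ae_eq mu D f g -> intble f -> intble g.
Proof.
move=> mg fg hf; apply/integrableP; split; first exact/measurable_EFinP.
have /integrableP[mf] := hf; congr (_ < _)%E.
apply: ae_eq_integral => //.
- exact: measurableT_comp.
- by apply: measurableT_comp => //; exact/measurable_EFinP.
- by apply: filterS fg => x /= fg Dx; rewrite fg.
Qed.

(** Replacing [f] by [min f g], which agrees with it almost everywhere, makes the
    comparison hold at every point. *)
Lemma le_Rintegral_ae f g : intble f -> intble g ->
  (\forall x \ae mu, D x -> f x <= g x) ->
  \int[mu]_(x in D) f x <= \int[mu]_(x in D) g x.
Proof.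
move=> hf hg fg.
have mm : measurable_fun D (fun x => Num.min (f x) (g x)).
  by apply: measurable_minr; exact: intbleP.
have E : ae_eq mu D f (fun x => Num.min (f x) (g x)).
  by apply: filterS fg => x fg Dx; rewrite min_l // fg.
rewrite (Rintegral_ae_eq (intbleP hf) mm E).
apply: le_Rintegral => //; first exact: intble_ae_eq E hf.
by move=> x Dx; rewrite ge_min lexx orbT.
Qed.

Lemma Rintegral_eq0_ae f : intble f -> (forall x, D x -> 0 <= f x) ->
  \int[mu]_(x in D) f x <= 0 -> ae_eq mu D f (fun=> 0).
Proof.
move=> hf f0 If.
have h : (\int[mu]_(x in D) `|(EFin \o f) x|)%E = 0%E.
  rewrite -[RHS]/(0%:E) -[in RHS](_ : \int[mu]_(x in D) f x = 0); last first.
    by apply/eqP; rewrite eq_le If Rintegral_ge0.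
  rewrite /Rintegral fineK; last exact: integrable_fin_num.
  by apply: eq_integral => x; rewrite inE => Dx /=; rewrite ger0_norm ?f0.
have /integrableP[mf _] := hf.
have := (ae_eq_integral_abs mu mD mf).1 h.
by apply: filterS => x + Dx => /(_ Dx) /= -[].
Qed.

Lemma L2_meas f : L2 mu D f -> measurable_fun D f.
Proof. by case. Qed.

Lemma L2P f : L2 mu D f <-> measurable_fun D f /\ intble (fun x => f x ^+ 2).
Proof.
have E : (\int[mu]_(x in D) `|((f x ^+ 2)%:E)| = \int[mu]_(x in D) (f x ^+ 2)%:E)%E.
  by apply: eq_integral => x _ /=; rewrite ger0_norm // sqr_ge0.
split=> -[mf h]; split=> //; last by case/integrableP: h => _; rewrite E.
apply/integrableP; split; last by rewrite E.
by apply/measurable_EFinP; exact: measurable_funX.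
Qed.

Lemma L2_sq f : L2 mu D f -> intble (fun x => f x ^+ 2).
Proof. by move=> /L2P[]. Qed.

Lemma L2M f g : L2 mu D f -> L2 mu D g -> intble (fun x => f x * g x).
Proof.
move=> Lf Lg; apply: (@intble_le _ (fun x => f x ^+ 2 + g x ^+ 2)).
- by apply: measurable_funM; apply: L2_meas.
- by apply: intbleD; apply: L2_sq.
- move=> x _; rewrite normrM.
  have := sqr_ge0 (`|f x| - `|g x|); rewrite sqrrB !real_normK ?num_real//.
  have := sqr_ge0 (f x); have := sqr_ge0 (g x).
  have := mulr_ge0 (normr_ge0 (f x)) (normr_ge0 (g x)); lra.
Qed.

Lemma L2_le f g : measurable_fun D f -> intble g ->
  (forall x, D x -> f x ^+ 2 <= g x) -> L2 mu D f.
Proof.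
move=> mf ig fg; apply/L2P; split=> //; apply: intble_le ig _.
  exact: measurable_funX.
by move=> x Dx; rewrite ger0_norm ?sqr_ge0// fg.
Qed.

Lemma eq_L2 f g : (forall x, D x -> f x = g x) -> L2 mu D f -> L2 mu D g.
Proof.
move=> fg [mf h]; apply/L2P; split.
  by apply: eq_measurable_fun mf => x; rewrite inE => Dx; rewrite fg.
apply: eq_intble (L2_sq (conj mf h)) => x Dx.
by rewrite fg.
Qed.

Lemma L2D f g : L2 mu D f -> L2 mu D g -> L2 mu D (fun x => f x + g x).
Proof.
move=> Lf Lg; apply: (@L2_le _ (fun x => 2 * f x ^+ 2 + 2 * g x ^+ 2)).
- by apply: measurable_funD; apply: L2_meas.
- by apply: intbleD; apply: intbleZ; apply: L2_sq.
- by move=> x _; have := sqr_ge0 (f x - g x); nra.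
Qed.

Lemma L2Z c f : L2 mu D f -> L2 mu D (fun x => c * f x).
Proof.
move=> Lf; apply: (@L2_le _ (fun x => c ^+ 2 * f x ^+ 2)).
- by apply: measurable_funM => //; exact: L2_meas.
- by apply: intbleZ; exact: L2_sq.
- by move=> x _; rewrite exprMn.
Qed.

Lemma L2B f g : L2 mu D f -> L2 mu D g -> L2 mu D (fun x => f x - g x).
Proof.
move=> Lf Lg; have := L2D Lf (L2Z (-1) Lg).
by apply: eq_L2 => x _; rewrite mulN1r.
Qed.

Lemma L20 : L2 mu D (fun=> 0).
Proof. by apply: (L2_le _ intble0) => // x _; rewrite expr0n. Qed.

Lemma L2Mb f g (M : R) : measurable_fun D g -> (forall x, D x -> `|g x| <= M) ->
  L2 mu D f -> L2 mu D (fun x => f x * g x).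
Proof.
move=> mg gM Lf; apply: (@L2_le _ (fun x => M ^+ 2 * f x ^+ 2)).
- by apply: measurable_funM => //; exact: L2_meas.
- by apply: intbleZ; exact: L2_sq.
- move=> x Dx; rewrite exprMn mulrC ler_wpM2r ?sqr_ge0//.
  by rewrite -[leLHS]real_normK ?num_real// lerXn2r ?nnegrE// ?gM// (le_trans _ (gM _ Dx)).
Qed.

Lemma intbleMb f g (M : R) : measurable_fun D g ->
  (forall x, D x -> `|g x| <= M) -> intble f -> intble (fun x => f x * g x).
Proof.
move=> mg gM hf; apply: (@intble_le _ (fun x => M * `|f x|)).
- by apply: measurable_funM => //; exact: intbleP.
- by apply: intbleZ; exact: intble_norm.
- by move=> x Dx; rewrite normrM mulrC ler_wpM2r// gM.
Qed.

(** Evaluate the polynomial at its minimum [t = - B / C]. It takes negative values if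
    [C < 0], or if [C = 0] and [B] is not zero. *)
Lemma discriminant_le (A B C : R) :
  (forall t, 0 <= A + 2 * t * B + t ^+ 2 * C) -> B ^+ 2 <= A * C.
Proof.
move=> h; have A0 : 0 <= A by have := h 0; rewrite expr0n /= mulr0 !mul0r !addr0.
have [C0|C0|C0] := ltgtP C 0.
- exfalso; have [B0|B0] := leP B 0.
    have := h ((A + 1) / - C + 1); set t := _ + 1.
    have t1 : 1 <= t by rewrite ler_wpDl// divr_ge0; lra.
    have : t * C <= - (A + 1) + C.
      by rewrite /t mulrDl mul1r lerD2r invrN mulrN mulNr divfK// lt_eqF.
    nra.
  have := h (- ((A + 1) / - C + 1)); set t := _ + 1.
  have t1 : 1 <= t by rewrite ler_wpDl// divr_ge0; lra.
  have : t * C <= - (A + 1) + C.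
    by rewrite /t mulrDl mul1r lerD2r invrN mulrN mulNr divfK// lt_eqF.
  nra.
- have := h (- (B / C)); rewrite sqrrN.
  have -> : A + 2 * - (B / C) * B + (B / C) ^+ 2 * C = A - B ^+ 2 / C.
    by field; rewrite gt_eqF.
  by rewrite subr_ge0 ler_pdivrMr.
- have [->|B0] := eqVneq B 0; first by rewrite expr0n C0 mulr0.
  have := h (- (A + 1) / (2 * B)); rewrite C0 mulr0 addr0.
  have -> : 2 * (- (A + 1) / (2 * B)) * B = - (A + 1) by field.
  lra.
Qed.

(** The integral of [(f + t g)^2] is a nonnegative quadratic polynomial in [t]. *)
Lemma Rcauchy_schwarz f g : L2 mu D f -> L2 mu D g ->
  (\int[mu]_(x in D) (f x * g x)) ^+ 2 <=
  (\int[mu]_(x in D) (f x ^+ 2)) * (\int[mu]_(x in D) (g x ^+ 2)).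
Proof.
move=> Lf Lg; apply: discriminant_le => t.
have -> : \int[mu]_(x in D) f x ^+ 2 + 2 * t * \int[mu]_(x in D) (f x * g x)
   + t ^+ 2 * \int[mu]_(x in D) g x ^+ 2 =
   \int[mu]_(x in D) ((f x + t * g x) ^+ 2).
  rewrite -RintegralZl//; last exact: L2M.
  rewrite -RintegralZl//; last exact: L2_sq.
  rewrite -RintegralD//; [|exact: L2_sq|by apply: intbleZ; exact: L2M].
  rewrite -RintegralD//.
  - by apply: eq_Rintegral => x _; ring.
  - by apply: intbleD; [exact: L2_sq|by apply: intbleZ; exact: L2M].
  - by apply: intbleZ; exact: L2_sq.
by apply: Rintegral_ge0 => x _; exact: sqr_ge0.
Qed.

Lemma Rintegral_sqD_le f g : L2 mu D f -> L2 mu D g ->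
  \int[mu]_(x in D) ((f x + g x) ^+ 2) <=
  2 * \int[mu]_(x in D) (f x ^+ 2) + 2 * \int[mu]_(x in D) (g x ^+ 2).
Proof.
move=> Lf Lg; rewrite -!RintegralZl//; [|exact: L2_sq..].
rewrite -RintegralD//; [|by apply: intbleZ; exact: L2_sq..].
apply: le_Rintegral => //.
- by apply: L2_sq; exact: L2D.
- by apply: intbleD; apply: intbleZ; exact: L2_sq.
- by move=> x _; have := sqr_ge0 (f x - g x); nra.
Qed.

Lemma intble_le_ae f g : measurable_fun D f -> intble g ->
  {ae mu, forall x, D x -> `|f x| <= g x} -> intble f.
Proof.
move=> mf ig fg.
have mm : measurable_fun D (fun x => Num.max (`|f x|) (g x)).
  apply: measurable_maxr; last exact: intbleP.
  exact: measurableT_comp.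
apply: (intble_le mf (g := fun x => Num.max (`|f x|) (g x))); last first.
  by move=> x _; rewrite le_max lexx.
apply: intble_ae_eq ig => //; apply: filterS fg => x fg Dx.
by rewrite max_r// fg.
Qed.

Lemma L2_le_ae f g : measurable_fun D f -> intble g ->
  {ae mu, forall x, D x -> f x ^+ 2 <= g x} -> L2 mu D f.
Proof.
move=> mf ig fg; apply/L2P; split=> //; apply: intble_le_ae ig _.
  exact: measurable_funX.
by apply: filterS fg => x + Dx => /(_ Dx); rewrite ger0_norm ?sqr_ge0.
Qed.

Lemma intble_mkcond f : intble f <-> mu.-integrable setT (EFin \o (f \_ D)).
Proof. by rewrite /intble -restrict_EFin; exact: integrable_mkcond. Qed.

End square_integrable.
Arguments intble_mkcond {d T R mu D} mD {f}.

(** * Fubini's theorem on a rectangle *)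

Section fubini_rectangles.
Context {d1 d2 : measure_display} {T1 : measurableType d1}
  {T2 : measurableType d2} {R : realType}.
Variables (m1 : {sigma_finite_measure set T1 -> \bar R})
  (m2 : {sigma_finite_measure set T2 -> \bar R}).
Implicit Types (f : T1 * T2 -> R).

(** The iterated integral is the difference of two measurable Tonelli integrals. *)
Lemma measurable_Rintegral_snd f : measurable_fun setT f ->
  measurable_fun setT (fun x => \int[m2]_y f (x, y)).
Proof.
move=> mf; rewrite /Rintegral; apply: (measurableT_comp (fine_measurable measurableT)).
have mF : measurable_fun setT (EFin \o f) by exact/measurable_EFinP.
have -> : (fun x => \int[m2]_y (f (x, y))%:E)%E =
    (fubini_F m2 (EFin \o f)^\+ \- fubini_F m2 (EFin \o f)^\-)%E.
  apply/funext => x; rewrite -[LHS]/(fubini_F m2 (EFin \o f) x).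
  rewrite [LHS]integralE.
  under eq_integral do rewrite funepos_comp/=.
  by under [X in (_ - X)%E = _]eq_integral do rewrite funeneg_comp/=.
apply: emeasurable_funB.
- apply: measurable_fun_fubini_tonelli_F => //; exact: measurable_funepos.
- apply: measurable_fun_fubini_tonelli_F => //; exact: measurable_funeneg.
Qed.

Variables (X : set T1) (Y : set T2).
Hypotheses (mX : measurable X) (mY : measurable Y).
Let m12 : {measure set (T1 * T2) -> \bar R} := (m1 \x m2)%E.

Lemma restrict_setX f x y : (f \_ (X `*` Y)) (x, y) = if x \in X then ((fun y => f (x, y)) \_ Y) y else 0.
Proof.
rewrite !patchE; have -> : ((x, y) \in X `*` Y) = (x \in X) && (y \in Y).
  by apply/idP/andP; rewrite ?inE => -[].
by case: (x \in X).
Qed.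

Lemma intble_sections1 f : intble m12 (X `*` Y) f ->
  {ae m1, forall x, X x -> intble m2 Y (fun y => f (x, y))}.
Proof.
move=> /(intble_mkcond (measurableX mX mY)) h.
apply: filterS (ae_integrable1 h) => x /= hx Xx.
apply/(intble_mkcond mY); apply: eq_integrable hx => // y _ /=.
by rewrite restrict_setX mem_set.
Qed.

Let fub_F f x : X x -> fubini_F m2 (EFin \o (f \_ (X `*` Y))) x =
  (\int[m2]_(y in Y) (f (x, y))%:E)%E.
Proof.
move=> Xx; rewrite /fubini_F [RHS]integral_mkcond; apply: eq_integral => y _ /=.
by rewrite restrict_setX mem_set// !patchE; case: ifP.
Qed.

Lemma intble_Rintegral1 f : intble m12 (X `*` Y) f ->
  intble m1 X (fun x => \int[m2]_(y in Y) f (x, y)).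
Proof.
move=> hf; have /(intble_mkcond (measurableX mX mY)) h := hf.
have /integrable_fubini_F h2 := h.
have mh : measurable_fun setT (fun x => \int[m2]_y (f \_ (X `*` Y)) (x, y)).
  by apply: measurable_Rintegral_snd; exact: (intbleP h).
have h3 : intble m1 setT (fun x => \int[m2]_y (f \_ (X `*` Y)) (x, y)).
  apply/integrableP; split; first exact/measurable_EFinP.
  have /integrableP[mF] := h2; congr (_ < _)%E.
  apply: ae_eq_integral => //; try exact: measurableT_comp.
    by apply: measurableT_comp => //; exact/measurable_EFinP.
  apply: filterS (ae_integrable1 h) => x hx _; rewrite /comp; congr (`| _ |)%E.
  by rewrite /Rintegral fineK //; exact: integrable_fin_num.
apply: eq_intble (integrableS measurableT mX (@subsetT _ _) h3) => // x Xx.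
rewrite [in RHS]Rintegral_mkcond; apply: eq_Rintegral => y _.
by rewrite restrict_setX mem_set.
Qed.

(** Extension by zero reduces an integral on the rectangle to one on the whole
    product space. *)
Lemma Rfubini1 f : intble m12 (X `*` Y) f ->
  \int[m12]_(z in X `*` Y) f z = \int[m1]_(x in X) \int[m2]_(y in Y) f (x, y).
Proof.
move=> hf; have /(intble_mkcond (measurableX mX mY)) h := hf.
rewrite Rintegral_mkcond /Rintegral -(integral12_prod_meas1 h).
rewrite [in RHS]integral_mkcond; congr fine.
apply: ae_eq_integral => //.
- by have /integrable_fubini_F/integrableP[] := h.
- apply/(measurable_restrictT _ mX)/measurable_EFinP; exact: intbleP (intble_Rintegral1 hf).
apply: filterS (intble_sections1 hf) => x hx _; rewrite patchE.
case: ifPn => [/set_mem Xx|/negP xX].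
  by rewrite fub_F // fineK//; apply: integrable_fin_num => //; exact: hx.
rewrite /fubini_F integral0_eq // => y _ /=.
by rewrite restrict_setX; case: ifP.
Qed.

Lemma intble_tensor (f : T1 -> R) (g : T2 -> R) : intble m1 X f ->
  intble m2 Y g -> intble m12 (X `*` Y) (fun z => f z.1 * g z.2).
Proof.
move=> hf hg; have mXY := measurableX mX mY.
apply/(intble_mkcond mXY).
have E : (fun z : T1 * T2 => f z.1 * g z.2) \_ (X `*` Y) =
    (fun z => (f \_ X) z.1 * (g \_ Y) z.2).
  apply/funext => -[x y]; rewrite restrict_setX !patchE /=.
  by case: ifP; case: ifP; rewrite ?mulr0 ?mul0r.
have mf : measurable_fun setT (f \_ X).
  by apply/(measurable_restrictT _ mX); exact: intbleP hf.
have mg : measurable_fun setT (g \_ Y).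
  by apply/(measurable_restrictT _ mY); exact: intbleP hg.
have mh : measurable_fun setT (fun z : T1 * T2 => (f \_ X) z.1 * (g \_ Y) z.2).
  by apply: measurable_funM; [exact: measurableT_comp|exact: measurableT_comp].
have /(intble_mkcond mX)/integrableP[_ hf'] := hf.
have /(intble_mkcond mY)/integrableP[_ hg'] := hg.
rewrite E; apply/integrable12ltyP => /=; first exact/measurable_EFinP.
under eq_integral => x _ do under eq_integral => y _ do rewrite normrM EFinM.
under eq_integral => x _.
  rewrite ge0_integralZl//; last first.
    by apply/measurable_EFinP; exact: measurableT_comp.
  over.
rewrite ge0_integralZr//=.
- rewrite lte_mul_pinfty ?integral_ge0// ?ge0_fin_numE ?integral_ge0//.
- by apply/measurable_EFinP; exact: measurableT_comp.
- by apply: integral_ge0.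
Qed.

Lemma ae_sections1 (P : T1 * T2 -> Prop) : {ae m12, forall z, P z} ->
  {ae m1, forall x, {ae m2, forall y, P (x, y)}}.
Proof.
move=> [N [mN N0 PN]].
have mF : measurable_fun setT (m2 \o xsection N) by exact: measurable_fun_xsection.
have : (\int[m1]_(x in setT) `|(m2 \o xsection N) x|)%E = 0%E.
  rewrite -[RHS]N0 /m12 /= /product_measure1; apply: eq_integral => x _.
  by rewrite gee0_abs.
move=> /(ae_eq_integral_abs m1 measurableT mF).1; apply: filterS => x /(_ I) /= h.
exists (xsection N x); split => //; first exact: measurable_xsection.
by move=> y Py; rewrite /xsection /= inE; exact: PN.
Qed.

Lemma ae_fst (P : T1 -> Prop) : {ae m1, forall x, P x} ->
  {ae m12, forall z, P z.1}.
Proof.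
move=> [N [mN N0 PN]]; exists (N `*` setT); split.
- exact: measurableX.
- rewrite /m12 /= product_measure1E//; transitivity (0 * m2 setT)%E.
    by congr (_ * _)%E; exact: N0.
  exact: mul0e.
- by move=> [x y] /= Px; split => //; exact: PN.
Qed.

End fubini_rectangles.
Arguments intble_sections1 {d1 d2 T1 T2 R m1 m2 X Y} mX mY {f}.
Arguments intble_Rintegral1 {d1 d2 T1 T2 R m1 m2 X Y} mX mY {f}.
Arguments Rfubini1 {d1 d2 T1 T2 R m1 m2 X Y} mX mY {f}.
Arguments intble_tensor {d1 d2 T1 T2 R m1 m2 X Y} mX mY {f g}.
Arguments ae_sections1 {d1 d2 T1 T2 R m1 m2 P}.
Arguments ae_fst {d1 d2 T1 T2 R m1} m2 {P}.

Section fubini_swap.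
Context {d1 d2 : measure_display} {T1 : measurableType d1}
  {T2 : measurableType d2} {R : realType}.
Variables (m1 : {sigma_finite_measure set T1 -> \bar R})
  (m2 : {sigma_finite_measure set T2 -> \bar R}).
Let m12 : {measure set (T1 * T2) -> \bar R} := (m1 \x m2)%E.
Let m21 : {measure set (T2 * T1) -> \bar R} := (m2 \x m1)%E.

(** The measure of the swapped product is determined by its values on rectangles,
    so integrals can be moved from one order of the factors to the other. *)
Let pushE A : measurable A -> m21 A = pushforward m12 (@unstable.swap T1 T2) A.
Proof.
apply: product_measure_unique => [|mf B C mB mC]; first exact: measurable_swap.
rewrite /pushforward muleC; have <- := product_measure1E m1 m2 mC mB.
by congr (m12 _); apply/seteqP; split=> -[x y] [].
Qed.

Lemma ae_swap (P : T1 * T2 -> Prop) : {ae m12, forall z, P z} ->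
  {ae m21, forall z, P (z.2, z.1)}.
Proof.
move=> [N [mN N0 PN]]; exists ((@unstable.swap T2 T1) @^-1` N); split.
- by rewrite -[X in measurable X]setTI; exact: measurable_swap.
- rewrite pushE; last by rewrite -[X in measurable X]setTI; exact: measurable_swap.
  by rewrite -[RHS]N0 /pushforward; congr (m12 _); apply/seteqP; split=> -[].
- by move=> [x y] /= h; exact: PN.
Qed.

Variables (X : set T1) (Y : set T2).
Hypotheses (mX : measurable X) (mY : measurable Y).

Let restrict_swap (f : T1 * T2 -> R) : (fun z => f (z.2, z.1)) \_ (Y `*` X) =
  (f \_ (X `*` Y)) \o (@unstable.swap T2 T1).
Proof.
apply/funext => -[y x]; rewrite /comp /unstable.swap /= !restrict_setX !patchE /=.
by case: ifP; case: ifP.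
Qed.

Lemma measurable_fun_swap (f : T1 * T2 -> R) : measurable_fun (X `*` Y) f ->
  measurable_fun (Y `*` X) (fun z => f (z.2, z.1)).
Proof.
move=> /(measurable_restrictT _ (measurableX mX mY)) mf.
apply/(measurable_restrictT _ (measurableX mY mX)); rewrite restrict_swap.
exact: measurableT_comp mf (@measurable_swap _ _ _ _).
Qed.

Let ge0_integral_swap (f : T1 * T2 -> \bar R) : measurable_fun setT f ->
  (forall z, 0 <= f z)%E ->
  (\int[m21]_z f (z.2, z.1) = \int[m12]_z f z)%E.
Proof.
move=> mf f0; have ms := @measurable_swap _ _ T1 T2.
have h : forall z, (0 <= f (z.2, z.1))%E by move=> z; exact: f0.
have mf' : measurable_fun setT (fun z : T2 * T1 => f (z.2, z.1)).
  exact: measurableT_comp mf (@measurable_swap _ _ T2 T1).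
transitivity (\int[m12]_(z in (@unstable.swap T1 T2) @^-1` setT) f z)%E; last first.
  by congr (integral _ _ _); apply/seteqP; split.
have := ge0_integral_pushforward ms m12 measurableT mf' (fun y _ => h y).
move=> E; rewrite (_ : (fun z => f z) = (fun z => f (z.2, z.1)) \o (@unstable.swap T1 T2)); last first.
  by apply/funext => -[].
rewrite -E; apply: eq_measure_integral => A mA _; exact: pushE.
Qed.

Lemma intble_swap (f : T1 * T2 -> R) : intble m12 (X `*` Y) f ->
  intble m21 (Y `*` X) (fun z => f (z.2, z.1)).
Proof.
move=> hf; have mf := measurable_fun_swap (intbleP hf).
apply/(intble_mkcond (measurableX mY mX)); rewrite restrict_swap.
have /(intble_mkcond (measurableX mX mY))/integrableP[mf' hf'] := hf.
apply/integrableP; split; last first.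
  rewrite -ge0_integral_swap // in hf'.
  exact: measurableT_comp.
apply/measurable_EFinP; rewrite -restrict_swap.
by apply/(measurable_restrictT _ (measurableX mY mX)).
Qed.

Lemma Rintegral_swap (f : T1 * T2 -> R) : measurable_fun (X `*` Y) f ->
  \int[m21]_(z in Y `*` X) f (z.2, z.1) = \int[m12]_(z in X `*` Y) f z.
Proof.
move=> mf; rewrite [LHS]Rintegral_mkcond [RHS]Rintegral_mkcond restrict_swap.
have mf' : measurable_fun setT (EFin \o (f \_ (X `*` Y))).
  by apply/measurable_EFinP/(measurable_restrictT _ (measurableX mX mY)).
rewrite /Rintegral [X in fine X]integralE [X in _ = fine X]integralE.
rewrite -!ge0_integral_swap //; last 2 first.
- exact: measurable_funeneg.
- exact: measurable_funepos.
by congr (fine (_ - _)%E); apply: eq_integral => -[y x] _;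
  rewrite !(funeposE, funenegE).
Qed.

End fubini_swap.
Arguments intble_swap {d1 d2 T1 T2 R m1 m2 X Y} mX mY {f}.
Arguments Rintegral_swap {d1 d2 T1 T2 R m1 m2 X Y} mX mY {f}.
Arguments ae_swap {d1 d2 T1 T2 R m1 m2 P}.

Section fubini_second.
Context {d1 d2 : measure_display} {T1 : measurableType d1}
  {T2 : measurableType d2} {R : realType}.
Variables (m1 : {sigma_finite_measure set T1 -> \bar R})
  (m2 : {sigma_finite_measure set T2 -> \bar R}).
Variables (X : set T1) (Y : set T2).
Hypotheses (mX : measurable X) (mY : measurable Y).
Let m12 : {measure set (T1 * T2) -> \bar R} := (m1 \x m2)%E.
Implicit Types (f : T1 * T2 -> R).

Lemma intble_sections2 f : intble m12 (X `*` Y) f ->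
  {ae m2, forall y, Y y -> intble m1 X (fun x => f (x, y))}.
Proof. by move=> /(intble_swap mX mY)/(intble_sections1 mY mX). Qed.

Lemma intble_Rintegral2 f : intble m12 (X `*` Y) f ->
  intble m2 Y (fun y => \int[m1]_(x in X) f (x, y)).
Proof. by move=> /(intble_swap mX mY)/(intble_Rintegral1 mY mX). Qed.

Lemma Rfubini2 f : intble m12 (X `*` Y) f ->
  \int[m12]_(z in X `*` Y) f z = \int[m2]_(y in Y) \int[m1]_(x in X) f (x, y).
Proof.
move=> hf; rewrite -(Rintegral_swap mX mY (intbleP hf)).
by rewrite (Rfubini1 mY mX (intble_swap mX mY hf)).
Qed.

Lemma ae_sections2 (P : T1 * T2 -> Prop) : {ae m12, forall z, P z} ->
  {ae m2, forall y, {ae m1, forall x, P (x, y)}}.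
Proof. by move=> /ae_swap/ae_sections1. Qed.

Lemma ae_snd (P : T2 -> Prop) : {ae m2, forall y, P y} ->
  {ae m12, forall z, P z.2}.
Proof. by move=> /(ae_fst m1)/ae_swap. Qed.

End fubini_second.
Arguments intble_sections2 {d1 d2 T1 T2 R m1 m2 X Y} mX mY {f}.
Arguments intble_Rintegral2 {d1 d2 T1 T2 R m1 m2 X Y} mX mY {f}.
Arguments Rfubini2 {d1 d2 T1 T2 R m1 m2 X Y} mX mY {f}.
Arguments ae_sections2 {d1 d2 T1 T2 R m1 m2 P}.
Arguments ae_snd {d1 d2 T1 T2 R} m1 {m2 P}.

(** * Smooth bump functions *)

Section smooth_one_variable.
Variable R : realType.
Implicit Types f g : R -> R.

(** Differentiating first, rather than last as [smooth1] does, makes sums, products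
    and affine substitutions provable by induction on the order. *)
Fixpoint smoothn (n : nat) f : Prop :=
  if n is m.+1 then (forall x, derivable f x 1) /\ smoothn m (derive1 f)
  else True.

Lemma smooth1P f : smooth1 f <-> forall n, smoothn n f.
Proof.
split=> [sf n|sf n x].
  elim: n f sf => // n IH f sf; split; first exact: (sf 0).
  by apply: IH => m x; rewrite -derive1Sn; exact: sf.
elim: n f sf => [|n IH] f sf; first exact: (sf 1%N).1.
by rewrite derive1Sn; apply: IH => m; exact: (sf m.+1).2.
Qed.

Lemma smoothn_le m n f : (m <= n)%N -> smoothn n f -> smoothn m f.
Proof.
elim: n m f => [|n IH] [|m] f //= mn [df sf]; split=> //.
exact: IH sf.
Qed.

Lemma derive1_fun (f g : R -> R) : (forall x : R, is_derive x 1 f (g x)) ->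
  derive1 f = g.
Proof. by move=> h; apply/funext => x; have hx := h x; rewrite derive1E; exact: derive_val. Qed.

Lemma is_derive_smooth f (x : R) : derivable f x 1 -> is_derive x 1 f (derive1 f x).
Proof. by move=> df; rewrite derive1E; exact/derivableP. Qed.

Lemma smoothnS n f (g : R -> R) : (forall x : R, is_derive x 1 f (g x)) ->
  smoothn n g -> smoothn n.+1 f.
Proof.
move=> fg sg; split; first by move=> x; case: (fg x).
by rewrite (derive1_fun fg).
Qed.

Lemma smoothn_cst n (c : R) : smoothn n (fun=> c).
Proof.
by elim: n c => // n IH c; apply: (@smoothnS _ _ (fun=> 0)).
Qed.

Lemma smoothnD n f g : smoothn n f -> smoothn n g -> smoothn n (fun x => f x + g x).
Proof.
elim: n f g => // n IH f g [df sf] [dg sg].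
apply: (@smoothnS _ _ (fun x => derive1 f x + derive1 g x)); last exact: IH.
by move=> x; apply: is_deriveD; exact: is_derive_smooth.
Qed.

Lemma smoothnM n f g : smoothn n f -> smoothn n g -> smoothn n (fun x => f x * g x).
Proof.
elim: n f g => // n IH f g sf sg; have [df sf'] := sf; have [dg sg'] := sg.
apply: (@smoothnS _ _ (fun x => f x * derive1 g x + g x * derive1 f x)).
  by move=> x; apply: is_deriveM; exact: is_derive_smooth.
by apply: smoothnD; apply: IH => //; exact: smoothn_le (leqnSn _) _.
Qed.

Lemma smoothnZ n (c : R) f : smoothn n f -> smoothn n (fun x => c * f x).
Proof. by apply: smoothnM; exact: smoothn_cst. Qed.

Lemma is_derive_affine (b c x : R) : is_derive x 1 (fun x : R => b * x + c) b.
Proof. by apply: is_derive_eq; rewrite addr0 /GRing.scale /= mulr1. Qed.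

Lemma smoothn_affine n f (b c : R) : smoothn n f -> smoothn n (fun x => f (b * x + c)).
Proof.
elim: n f => // n IH f [df sf].
apply: (@smoothnS _ _ (fun x => b * derive1 f (b * x + c))).
  move=> x; have h1 := is_derive_affine b c x.
  have h2 := is_derive_smooth (df (b * x + c)).
  by rewrite mulrC; have := @is_derive1_comp _ f (fun x : R => b * x + c) x _ _ h2 h1; exact.
by apply: smoothnZ; exact: IH.
Qed.

Lemma smoothn_id n (b c : R) : smoothn n (fun x => b * x + c).
Proof.
case: n => // n; apply: (@smoothnS _ _ (fun=> b)); last exact: smoothn_cst.
exact: is_derive_affine.
Qed.

(** [x^-k exp(-e/x)], extended by zero to [x <= 0]: the derivatives of the flat
    function [exp(-e/x)] are linear combinations of these. *)
Definition flat (e : R) (k : nat) (x : R) : R :=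
  if 0 < x then x^-1 ^+ k * expR (- (e * x^-1)) else 0.

Lemma expR_ge_powdiv (z : R) n : 0 <= z -> (z / n.+1%:R) ^+ n.+1 <= expR z.
Proof.
move=> z0; have -> : expR z = expR (z / n.+1%:R) ^+ n.+1.
  by rewrite -expRM_natr divfK.
rewrite lerXn2r ?nnegrE ?divr_ge0 ?expR_ge0//.
by apply: le_trans (expR_ge1Dx _); rewrite lerDr.
Qed.

(** The exponential beats every power: [exp(e/x) >= (e/((k+2)x))^(k+2)]. *)
Lemma flat_le_sq (e : R) k : 0 < e -> exists2 C : R, 0 < C & forall x, `|flat e k x| <= C * x ^+ 2.
Proof.
move=> e0; exists ((k.+2%:R / e) ^+ k.+2); first by rewrite exprn_gt0// divr_gt0.
move=> x; rewrite /flat; case: ifPn => x0; last first.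
  by rewrite normr0 mulr_ge0 ?sqr_ge0// exprn_ge0// divr_ge0// ltW.
have h := @expR_ge_powdiv (e * x^-1) k.+1 (mulr_ge0 (ltW e0) (ltW (_ : 0 < x^-1))).
rewrite ger0_norm; last by rewrite mulr_ge0 ?expR_ge0// exprn_ge0// invr_ge0 ltW.
rewrite expRN ler_pdivrMr ?expR_gt0//.
apply: le_trans (ler_wpM2l _ (h _)); rewrite ?invr_gt0//; last first.
  by rewrite mulr_ge0 ?sqr_ge0// exprn_ge0// divr_ge0// ltW.
rewrite mulrAC -exprMn.
have -> : k.+2%:R / e * (e / x / k.+2%:R) = x^-1.
  by field; rewrite !gt_eqF// ltr0n.
by rewrite -[k.+2]addn2 exprD -mulrA -exprMn mulVf ?gt_eqF// expr1n mulr1.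
Qed.

Lemma flat_neg (e : R) k x : x <= 0 -> flat e k x = 0.
Proof. by rewrite /flat ltNge => ->. Qed.

Lemma flat_pos (e : R) k x : 0 < x -> flat e k x = x^-1 ^+ k * expR (- (e * x^-1)).
Proof. by rewrite /flat => ->. Qed.

(** Away from the origin this is calculus; at the origin the difference quotient
    is bounded by a multiple of [x]. *)
Lemma is_derive_flat (e : R) k (x : R) : 0 < e ->
  is_derive x 1 (flat e k) (- k%:R * flat e k.+1 x + e * flat e k.+2 x).
Proof.
move=> e0; have [x0|x0|<-] := ltgtP 0 x.
- rewrite !flat_pos//.
  apply: (@near_eq_is_derive R R R (fun x : R => x^-1 ^+ k * expR (- (e * x^-1)))).
  + near=> y; rewrite flat_pos//; near: y; exact: lt_nbhsr.
  have x1 : x != 0 by rewrite gt_eqF.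
  have h1 : is_derive x 1 (fun x : R => x^-1) (- x ^- 2).
    have di : derivable (@id R) x 1 by exact: derivable_id.
    apply: DeriveDef; first exact: (derivableV (f := @id R)).
    by rewrite (deriveV (f := @id R) x1 di) derive_id /GRing.scale /= mulr1.
  have h2 : is_derive x 1 (fun x : R => x^-1 ^+ k) (k%:R * x^-1 ^+ k.-1 * - x ^- 2).
    rewrite (_ : (fun x : R => x^-1 ^+ k) = (fun x : R => x^-1) ^+ k); last first.
      by apply/funext => y; rewrite exprfctE.
    exact: is_deriveX h1.
  have h3 : is_derive x 1 (fun x : R => - (e * x^-1)) (e * x ^- 2).
    by apply: is_derive_eq; rewrite /GRing.scale /=; ring.
  have h4 : is_derive x 1 (fun x : R => expR (- (e * x^-1))) (expR (- (e * x^-1)) * (e * x ^- 2)).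
    exact: (@is_derive1_comp _ expR (fun x : R => - (e * x^-1)) _ _ _ (is_derive_expR _) h3).
  apply: is_derive_eq; rewrite /GRing.scale /=.
  rewrite -!exprVn; move: (x^-1) (expR _) => y E.
  case: k {h2} => [|k] /=; rewrite ?mulr0n ?oppr0 ?exprS; first by ring.
  by rewrite -natr1; ring.
- rewrite !flat_neg ?(ltW x0)// !mulr0 addr0.
  apply: (@near_eq_is_derive R R R (fun=> 0)).
  + near=> y; rewrite flat_neg//; apply: ltW; near: y; exact: lt_nbhsl.
- rewrite !flat_neg// !mulr0 addr0.
  have [C C0 hC] := flat_le_sq k e0.
  have cv : h^-1 *: (flat e k (h *: 1 + 0) - flat e k 0) @[h --> 0^'] --> (0 : R).
    apply/cvgr0Pnorm_lt => eps eps0; near=> h.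
    have h0 : h != 0 by near: h; exact: nbhs_dnbhs_neq.
    rewrite addr0 [h *: 1]mulr1 [flat e k 0]flat_neg// subr0 normrZ normfV.
    rewrite ltr_pdivrMl ?normr_gt0//; apply: le_lt_trans (hC h) _.
    rewrite -[h ^+ 2]ger0_norm ?sqr_ge0// normrX expr2 mulrCA ltr_pM2l ?normr_gt0//.
    rewrite mulrC -ltr_pdivlMr//; near: h; apply: dnbhs0_lt.
    exact: divr_gt0.
  have dv : derivable (flat e k) 0 1 by apply/cvg_ex; exists 0.
  by apply: DeriveDef => //; exact: cvg_lim.
Unshelve. all: by end_near.
Qed.

Lemma smoothn_flat (e : R) k n : 0 < e -> smoothn n (flat e k).
Proof.
move=> e0; elim: n k => // n IH k; apply: smoothnS => [x|]; first exact: is_derive_flat.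
by apply: smoothnD; apply: smoothnZ.
Qed.

(** Smooth, positive on [p < x < q], zero elsewhere, and increasing to the
    indicator of the interval as [e] decreases to zero. *)
Definition bump (e p q : R) (x : R) : R := flat e 0 (x - p) * flat e 0 (q - x).

Lemma flat0E (e x : R) : flat e 0 x = if 0 < x then expR (- (e * x^-1)) else 0.
Proof. by rewrite /flat mul1r. Qed.

Lemma flat0_ge0 (e x : R) : 0 <= flat e 0 x.
Proof. by rewrite flat0E; case: ifP => // _; exact: expR_ge0. Qed.

Lemma flat0_le1 (e x : R) : 0 < e -> flat e 0 x <= 1.
Proof.
move=> e0; rewrite flat0E; case: ifP => // x0.
by rewrite -expR0 ler_expR oppr_le0 divr_ge0 ?(ltW e0) ?(ltW x0).
Qed.

Lemma bump_ge0 e p q x : 0 <= bump e p q x.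
Proof. by rewrite mulr_ge0 ?flat0_ge0. Qed.

Lemma bump_le1 e p q x : 0 < e -> bump e p q x <= 1.
Proof. by move=> e0; rewrite -[1]mulr1 ler_pM ?flat0_ge0 ?flat0_le1. Qed.

Lemma smooth1_bump e p q : 0 < e -> smooth1 (bump e p q).
Proof.
move=> e0; apply/smooth1P => n; apply: smoothnM.
  rewrite (_ : (fun x => flat e 0 (x - p)) = (fun x => flat e 0 (1 * x + - p))).
    by apply: smoothn_affine; exact: smoothn_flat.
  by apply/funext => x; rewrite mul1r.
rewrite (_ : (fun x => flat e 0 (q - x)) = (fun x => flat e 0 (- 1 * x + q))).
  by apply: smoothn_affine; exact: smoothn_flat.
by apply/funext => x; rewrite mulN1r addrC.
Qed.

Lemma bump_out e p q x : ~~ (p < x < q) -> bump e p q x = 0.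
Proof.
rewrite /bump !flat0E !subr_gt0.
by case: (p < x); case: (x < q); rewrite //= ?mulr0 ?mul0r.
Qed.

Lemma bump_cvg p q x : (fun n => bump n.+1%:R^-1 p q x) @ \oo --> (\1_(`]p, q[%classic) x : R).
Proof.
rewrite indicE; have [/set_mem|/negP xpq] := boolP (x \in `]p, q[%classic); last first.
  rewrite (_ : (fun n => _) = fun=> 0); first exact: cvg_cst.
  by apply/funext => n; apply: bump_out; apply/negP => h; apply: xpq; rewrite inE.
rewrite /= in_itv /= => /andP[px xq].
have h y : 0 < y -> (fun n => flat n.+1%:R^-1 0 y) @ \oo --> (1 : R).
  move=> y0; under eq_fun do rewrite flat0E y0.
  have h2 : (fun n => n.+1%:R^-1 * y^-1) @ \oo --> (0 * y^-1 : R).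
    by apply: cvgM; [exact: cvg_harmonic|exact: cvg_cst].
  have h3 : (fun n => expR (- (n.+1%:R^-1 * y^-1))) @ \oo --> expR (- (0 * y^-1)).
    by apply: continuous_cvg; [exact: continuous_expR|exact: cvgN].
  by rewrite mul0r oppr0 expR0 in h3.
have h4 : bump n.+1%:R^-1 p q x @[n --> \oo] --> (1 * 1 : R).
  by apply: cvgM; apply: h; rewrite subr_gt0.
by rewrite mulr1 in h4.
Qed.

Lemma test1_closedI (I : set R) (f : R -> R) (p q : R) : smooth1 f ->
  `[p, q] `<=` I -> (forall x, ~~ (p <= x <= q) -> f x = 0) -> test1 I f.
Proof.
move=> sf pqI f0; have h : closure [set x | f x != 0] `<=` `[p, q]%classic.
  have -> : `[p, q]%classic = closure `[p, q]%classic.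
    by apply/closure_id; exact: interval_closed.
  apply: closureS => x /= fx; rewrite in_itv /=.
  by apply: contraNT fx => /f0 ->.
split => //; last exact: subset_trans h pqI.
apply: subclosed_compact h; first exact: closed_closure.
exact: segment_compact.
Qed.

Lemma test1_bump (I : set R) e p q : 0 < e -> `[p, q] `<=` I -> test1 I (bump e p q).
Proof.
move=> e0 /test1_closedI; apply; first exact: smooth1_bump.
move=> x h; apply: bump_out; apply: contra h => /andP[px xq].
by rewrite !ltW.
Qed.

End smooth_one_variable.

(** * The fundamental lemma of the calculus of variations *)

Section fundamental_lemma.
Variable R : realType.
Local Notation mR := (measurableTypeR R).

Lemma ae_forall_count {d} {T : measurableType d} (mu : {measure set T -> \bar R})
    (I : countType) (P : I -> T -> Prop) :
  (forall i, {ae mu, forall x, P i x}) -> {ae mu, forall x, forall i, P i x}.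
Proof.
move=> h; pose Q n x := if unpickle n is Some i then P i x else True.
have : {ae mu, forall x, forall n, Q n x}.
  apply: ae_foralln => n; rewrite /Q; case: (unpickle n) => [i|]; first exact: h.
  exact: aeW.
by apply: filterS => x hx i; have := hx (pickle i); rewrite /Q pickleK.
Qed.

Lemma rat_between (x y : R) : x < y -> exists q : rat, x < ratr q < y.
Proof.
move=> xy; have [||z [/= h [q _ qz]]] := @dense_rat R `]x, y[%classic.
- by exists ((x + y) / 2); rewrite /= in_itv/= !midf_lt.
- exact: interval_open.
by exists q; move: h; rewrite -qz in_itv.
Qed.

(** Dominated convergence turns a test against all bumps into a test against the
    indicator of an interval. *)
Lemma bump_cvg_integral (D : set R) (U : R -> R) (p q : R) : measurable (D : set mR) ->
  intble (leb1 R) D U ->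
  (forall n : nat, \int[leb1 R]_(x in D) (U x * bump n.+1%:R^-1 p q x) = 0) ->
  \int[leb1 R]_(x in D) (U x * \1_(`]p, q[%classic) x) = 0.
Proof.
move=> mD iU h.
have mb n : measurable_fun (D : set mR) (bump n.+1%:R^-1 p q).
  apply: measurable_funTS; apply: continuous_measurable_fun => x.
  apply: differentiable_continuous; apply/derivable1_diffP.
  have e0 : 0 < n.+1%:R^-1 :> R by rewrite invr_gt0.
  exact: (@smooth1_bump R _ p q e0 0%N x).
have m1 : measurable_fun (D : set mR) (\1_(`]p, q[%classic) : R -> R).
  by apply: measurable_indic.
have [] := @dominated_convergence _ _ R (leb1 R) D mD
   (fun n x => (U x * bump n.+1%:R^-1 p q x)%:E)
   (fun x => (U x * \1_(`]p, q[%classic) x)%:E) (fun x => `|U x|%:E).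
- by move=> n; apply/measurable_EFinP; apply: measurable_funM => //; exact: (intbleP iU).
- by apply/measurable_EFinP; apply: measurable_funM => //; exact: (intbleP iU).
- apply: aeW => x _; apply/fine_cvgP; split; first by exists 0%N.
  have hb : (fun n => U x * bump n.+1%:R^-1 p q x) @ \oo -->
      (U x * \1_(`]p, q[%classic) x : R).
    by apply: cvgM; [exact: cvg_cst|exact: bump_cvg].
  exact: hb.
- exact: (intble_norm iU).
- apply: aeW => x n _ /=; rewrite lee_fin normrM -[leRHS]mulr1 ler_wpM2l//.
  by rewrite ger0_norm ?bump_ge0// bump_le1// invr_gt0.
move=> i1 _; rewrite (_ : (fun n => _) = (fun=> 0%E)); last first.
  apply/funext => n; rewrite -[LHS]fineK.
    by rewrite [X in X%:E](_ : _ = 0) //; exact: h.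
  apply: integrable_fin_num => //; apply: (@intbleMb _ _ _ (leb1 R) D mD U _ 1) => //.
  by move=> x _; rewrite ger0_norm ?bump_ge0// bump_le1// invr_gt0.
by move=> /cvg_lim E; rewrite /Rintegral -E// lim_cst.
Qed.

(** The integral [F] of [U] takes the same value at all rational points, hence is
    constant, and its derivative is [U] almost everywhere by Lebesgue's
    differentiation theorem. *)
Lemma flcv1_itv (c d : R) (U : R -> R) : intble (leb1 R) `]c, d[ U ->
  (forall p q : rat, c < ratr p -> ratr p < ratr q :> R -> ratr q < d ->
     \int[leb1 R]_(x in `]c, d[) (U x * \1_(`]ratr p, ratr q[%classic) x) = 0) ->
  ae_eq (leb1 R) `]c, d[%classic U (fun=> 0).
Proof.
move=> iU h; have mI : measurable (`]c, d[%classic : set mR) by exact: measurable_itv.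
pose V := U \_ `]c, d[; pose F x := \int[leb1 R]_(t in `]-oo, x]) V t.
have iV : intble (leb1 R) setT V by apply/(intble_mkcond mI).
have iVS (A : set mR) : measurable A -> intble (leb1 R) A V.
  by move=> mA; apply: integrableS iV.
have FB (p q : rat) : c < ratr p -> ratr p < ratr q :> R -> ratr q < d ->
    F (ratr q) = F (ratr p).
  move=> cp pq qd; apply/eqP; rewrite -subr_eq0 /F.
  rewrite Rintegral_itvB ?bnd_simp ?ltW//; last exact: (iVS _ (measurable_itv _)).
  rewrite -Rintegral_itv_bndo_bndc; last exact: (iVS _ (measurable_itv _)).
  rewrite -(h p q cp pq qd) [leb1 R]lock Rintegral_mkcond [X in _ == X]Rintegral_mkcond -lock.
  apply/eqP; apply: eq_Rintegral => x _.
  rewrite /V !patchE indicE !mem_setE !in_itv /=.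
  by case: (ltP (ratr p) x) => px; case: (ltP x (ratr q)) => xq;
    rewrite ?mulr0 ?mulr1 ?if_same.
have : {ae leb1 R, forall x, derivable F x 1 /\ derive1 F x = V x} :=
  @FTC1Ny R V (fun y => iVS _ (measurable_itv _)) (integrable_locally mI iU).
apply: (@filterS _ (almost_everywhere (leb1 R)) (ae_filter_ringOfSetsType (leb1 R))) => x [dF Fx]; rewrite /= in_itv/= => /andP[cx xd].
have -> : U x = V x by rewrite /V patchE mem_set//= in_itv/= cx xd.
rewrite -Fx.
have cF : {for x, continuous F}.
  by apply: differentiable_continuous; apply/derivable1_diffP.
have [p0 /andP[cp0 p0x]] := rat_between cx.
have Fcst (q : rat) : ratr p0 < ratr q :> R -> ratr q < d -> F (ratr q) = F (ratr p0).
  by move=> *; exact: FB.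
have Fx0 : F x = F (ratr p0).
  apply/eqP/negPn/negP => neq.
  have e0 : 0 < `|F x - F (ratr p0)| by rewrite normr_gt0 subr_eq0.
  have /cvgrPdist_lt/(_ _ e0) := cF.
  move=> /nbhs_ballP[r /= r0 hr].
  have [q /andP[xq qr]] : exists q : rat, x < ratr q < Num.min (x + r) d.
    by apply: rat_between; rewrite lt_min xd ltrDl r0.
  move: qr; rewrite lt_min => /andP[qr qd].
  have hq : ball x r (ratr q : R).
    by rewrite /ball /= distrC ger0_norm ?subr_ge0 ?ltW// ltrBlDl.
  by have := hr _ hq; rewrite /= Fcst ?(lt_trans p0x)// ltxx.
apply/eqP/negPn/negP => neq.
have e0 : 0 < `|derive1 F x| by rewrite normr_gt0.
have : h^-1 *: (F (h *: 1 + x) - F x) @[h --> 0^'] --> derive1 F x.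
  by rewrite derive1E; exact: dF.
move=> /cvgrPdist_lt/(_ _ e0)/nbhs_ballP[r /= r0 hr].
have [q /andP[xq qr]] : exists q : rat, x < ratr q < Num.min (x + r) d.
  by apply: rat_between; rewrite lt_min xd ltrDl r0.
move: qr; rewrite lt_min => /andP[qr qd].
have hq : ball (0 : R) r (ratr q - x).
  by rewrite /ball /= sub0r normrN ger0_norm ?subr_ge0 ?ltW// ltrBlDl.
have qx : ratr q - x != 0 by rewrite gt_eqF// subr_gt0.
have := hr _ hq qx; rewrite /= [_ *: 1]mulr1 subrK Fcst ?(lt_trans p0x)//.
by rewrite Fx0 subrr scaler0 subr0 ltxx.
Qed.

Lemma flcv1 (c d : R) (U : R -> R) : intble (leb1 R) `]c, d[ U ->
  (forall (p q : rat) (n : nat), c < ratr p -> ratr p < ratr q :> R -> ratr q < d ->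
     \int[leb1 R]_(x in `]c, d[) (U x * bump n.+1%:R^-1 (ratr p) (ratr q) x) = 0) ->
  ae_eq (leb1 R) `]c, d[%classic U (fun=> 0).
Proof.
move=> iU h; apply: flcv1_itv => // p q cp pq qd.
by apply: (bump_cvg_integral (measurable_itv _) iU) => n; exact: h.
Qed.

Lemma measurable_bump (D : set mR) e p q : 0 < e -> measurable_fun D (bump e p q : mR -> R).
Proof.
move=> e0; apply: measurable_funTS; apply: continuous_measurable_fun => x.
apply: differentiable_continuous; apply/derivable1_diffP.
exact: (@smooth1_bump R _ p q e0 0%N x).
Qed.

(** Countably many test functions: this is what allows the null sets met in the
    two-dimensional lemma to be united. *)
Definition bmp (n : nat) (p q : rat) : R -> R := bump n.+1%:R^-1 (ratr p) (ratr q).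

Lemma bmp_eps (n : nat) : 0 < n.+1%:R^-1 :> R.
Proof. by rewrite invr_gt0. Qed.

Lemma bmp_norm_le1 n p q x : `|bmp n p q x| <= 1.
Proof. by rewrite ger0_norm ?bump_ge0// bump_le1// bmp_eps. Qed.

Lemma measurable_bmp (D : set mR) n p q : measurable_fun D (bmp n p q : mR -> R).
Proof. by apply: measurable_bump; exact: bmp_eps. Qed.

(** The one-dimensional lemma in [x], for each of the countably many bumps in [y],
    then in [y] for almost every [x]. *)
Lemma flcv2 (c1 d1 c2 d2 : R) (W : R * R -> R) :
  intble (leb2 R) (`]c1, d1[ `*` `]c2, d2[) W ->
  (forall (p q r s : rat) (m n : nat), c1 < ratr p -> ratr p < ratr q :> R -> ratr q < d1 ->
     c2 < ratr r -> ratr r < ratr s :> R -> ratr s < d2 ->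
     \int[leb2 R]_(z in `]c1, d1[ `*` `]c2, d2[) (W z * (bmp m p q z.1 * bmp n r s z.2)) = 0) ->
  ae_eq (leb2 R) (`]c1, d1[ `*` `]c2, d2[) W (fun=> 0).
Proof.
set X := `]c1, d1[%classic; set Y := `]c2, d2[%classic => iW h.
have mX : measurable (X : set mR) by exact: measurable_itv.
have mY : measurable (Y : set mR) by exact: measurable_itv.
have mXY := measurableX mX mY.
have S1 := intble_sections1 mX mY iW.
have mb2 n r s : measurable_fun (X `*` Y : set (mR * mR)) (fun z => bmp n r s z.2).
  by apply: measurable_funTS; apply: measurableT_comp => //; exact: measurable_bmp.
have mb1 n r s : measurable_fun (X `*` Y : set (mR * mR)) (fun z => bmp n r s z.1).
  by apply: measurable_funTS; apply: measurableT_comp => //; exact: measurable_bmp.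
have A : forall i : rat * rat * nat, {ae leb1 R, forall x, X x ->
    c2 < ratr i.1.1 -> ratr i.1.1 < ratr i.1.2 :> R -> ratr i.1.2 < d2 ->
    \int[leb1 R]_(y in Y) (W (x, y) * bmp i.2 i.1.1 i.1.2 y) = 0}.
  move=> [[r s] n] /=.
  have [h1|] := pselect [/\ c2 < ratr r, ratr r < ratr s :> R & ratr s < d2]; last first.
    by move=> h1; apply: aeW => x _ h2 h3 h4; exfalso; apply: h1.
  have iWb : intble (leb2 R) (X `*` Y) (fun z => W z * bmp n r s z.2).
    by apply: (intbleMb mXY (M := 1)) => // z _; exact: bmp_norm_le1.
  have iU := intble_Rintegral1 mX mY iWb.
  suff : ae_eq (leb1 R) X (fun x => \int[leb1 R]_(y in Y) (W (x, y) * bmp n r s y)) (fun=> 0).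
    by apply: filterS => x hx Xx _ _ _; exact: hx.
  apply: (flcv1 iU) => p q m cp pq qd.
  have [h2 h3 h4] := h1.
  rewrite -[RHS](h p q r s m n cp pq qd h2 h3 h4).
  have iWbb : intble (leb2 R) (X `*` Y) (fun z => W z * (bmp m p q z.1 * bmp n r s z.2)).
    apply: (intbleMb mXY (M := 1)) => //; first exact: measurable_funM.
    by move=> z _; rewrite normrM -[1]mulr1 ler_pM// bmp_norm_le1.
  rewrite (Rfubini1 mX mY iWbb); apply: Rintegral_ae_eq => //.
  - by apply: measurable_funM; [exact: (intbleP iU)|exact: measurable_bmp].
  - exact: (intbleP (intble_Rintegral1 mX mY iWbb)).
  apply: filterS (intble_sections1 mX mY iWb) => x hx Xx; rewrite -RintegralZr//; last exact: hx.
  by apply: eq_Rintegral => y _; rewrite /= -/(bmp m p q x); ring.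
have hP := ae_forall_count A.
have hW : {ae leb1 R, forall x, X x -> ae_eq (leb1 R) Y (fun y => W (x, y)) (fun=> 0)}.
  apply: filterS2 S1 hP => x ix hx Xx; apply: flcv1; first exact: ix.
  by move=> p q n cp pq qd; exact: (hx (p, q, n)).
have iN := intble_norm iW.
suff : ae_eq (leb2 R) (X `*` Y) (fun z => `|W z|) (fun=> 0).
  by apply: filterS => z + XYz => /(_ XYz) /normr0_eq0.
apply: Rintegral_eq0_ae => //.
rewrite (Rfubini1 mX mY iN) (_ : Rintegral _ _ _ = \int[leb1 R]_(x in X) 0).
  by rewrite Rintegral_cst// mul0r.
apply: Rintegral_ae_eq => //; first exact: (intbleP (intble_Rintegral1 mX mY iN)).
apply: filterS2 S1 hW => x ix hx Xx.
rewrite (_ : Rintegral _ _ _ = \int[leb1 R]_(y in Y) 0); first by rewrite Rintegral_cst// mul0r.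
apply: Rintegral_ae_eq => //; first exact: (intbleP (intble_norm (ix Xx))).
by apply: filterS (hx Xx) => y + Yy => /(_ Yy) ->; rewrite normr0.
Qed.

End fundamental_lemma.

(** * Open sets of the plane and antiderivatives *)

Section plane_topology.
Variable R : realType.
Local Notation mR := (measurableTypeR R).

(** Every open set of the plane is the union of the rational boxes it contains: it
    is measurable, and a property of almost every point may be checked box by box. *)
Definition ratbox (i : rat * rat * (rat * rat)) : set (R * R) :=
  `]ratr i.1.1, ratr i.1.2[ `*` `]ratr i.2.1, ratr i.2.2[.

Lemma measurable_ratbox i : measurable (ratbox i : set (mR * mR)).
Proof. by apply: measurableX; exact: measurable_itv. Qed.

Lemma open_ratbox (O : set (R * R)) : open O -> forall z, O z ->
  exists2 i, ratbox i `<=` O & ratbox i z.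
Proof.
move=> oO [x y] Oz; have : nbhs (x, y) O by exact: open_nbhs_nbhs.
move=> [[P Q]] /= [/nbhs_ballP[e /= e0 eP] /nbhs_ballP[f /= f0 fQ]] PQ.
have [p /andP[p1 p2]] : exists q : rat, x - e < ratr q < x.
  by apply: rat_between; rewrite ltrBlDr ltrDl.
have [q /andP[q1 q2]] : exists q : rat, x < ratr q < x + e.
  by apply: rat_between; rewrite ltrDl.
have [r /andP[r1 r2]] : exists q : rat, y - f < ratr q < y.
  by apply: rat_between; rewrite ltrBlDr ltrDl.
have [s /andP[s1 s2]] : exists q : rat, y < ratr q < y + f.
  by apply: rat_between; rewrite ltrDl.
exists ((p, q), (r, s)); last by split; rewrite /= in_itv/= ?p2 ?q1 ?r2.
move=> [x' y'] [/=]; rewrite !in_itv /= => /andP[h1 h2] /andP[h3 h4].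
apply: PQ; split => /=.
  by apply: eP; rewrite /ball /= ltr_distlC; apply/andP; split; lra.
by apply: fQ; rewrite /ball /= ltr_distlC; apply/andP; split; lra.
Qed.

Lemma open_measurable2 (O : set (R * R)) : open O -> measurable (O : set (mR * mR)).
Proof.
move=> oO; pose F n := if unpickle n is Some i
  then if `[< ratbox i `<=` O >] then ratbox i else set0 else set0.
have -> : O = \bigcup_n F n.
  apply/seteqP; split => [z /(open_ratbox oO)[i iO iz]|z [n _]].
    by exists (pickle i); [exact: I|rewrite /F pickleK; case: asboolP].
  by rewrite /F; case: (unpickle n) => [i|//]; case: asboolP => // iO /iO.
apply: bigcup_measurable => n _; rewrite /F; case: (unpickle n) => [i|]; last exact: measurable0.
by case: ifP => _; [exact: measurable_ratbox|exact: measurable0].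
Qed.

Lemma continuous_measurable2 (f : R * R -> R) : continuous f ->
  measurable_fun setT (f : mR * mR -> R).
Proof.
move=> /continuousP cf; apply: (measurability _ (RGenOpens.measurableE R)).
move=> _ [_ [a [b ->] <-]]; rewrite setTI; apply: open_measurable2.
exact/cf/interval_open.
Qed.

End plane_topology.

Section antiderivative.
Variable R : realType.
Local Notation mR := (measurableTypeR R).

Lemma smooth1_continuous (f : R -> R) : smooth1 f -> continuous f.
Proof.
move=> sf x; apply: differentiable_continuous; apply/derivable1_diffP.
exact: (sf 0%N x).
Qed.

(** The primitive vanishes on the right of the support because the integral is
    zero. *)
Lemma test1_antiderivative (c d p q : R) (f : R -> R) : smooth1 f ->
  c < p -> q < d -> (forall x, ~~ (p <= x <= q) -> f x = 0) ->
  \int[leb1 R]_(x in `]c, d[) f x = 0 ->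
  exists F, test1 `]c, d[ F /\ derive1 F = f.
Proof.
move=> sf cp qd f0 If.
have cf := smooth1_continuous sf.
have fE : f = f \_ `[p, q]%classic.
  apply/funext => x; rewrite patchE; case: ifPn => // /negP h.
  by apply: f0; apply/negP => h2; apply: h; rewrite inE /= in_itv.
have mI (i : interval R) : measurable ([set` i] : set mR) by exact: measurable_itv.
have iT : intble (leb1 R) setT f.
  rewrite fE; apply/(intble_mkcond (mI _)).
  apply: continuous_compact_integrable; first exact: segment_compact.
  exact: continuous_subspaceT.
have iS (A : set mR) : measurable A -> intble (leb1 R) A f.
  by move=> mA; apply: integrableS iT.
pose F x := \int[leb1 R]_(t in `]-oo, x]) f t.
have dF (x : R) : is_derive x 1 F (f x).
  have [||||d1 d2] := @continuous_FTC1 R f -oo%O x (x + 1).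
  - by rewrite ltrDl.
  - exact: (iS _ (mI _)).
  - by rewrite ltNyr.
  - exact: cf.
  by rewrite -[f x]d2 derive1E; exact/derivableP.
have F' : derive1 F = f by exact: derive1_fun.
exists F; split; last exact: F'.
apply: (@test1_closedI _ _ _ p q).
- move=> [|n] x; first by case: (dF x).
  by rewrite derive1Sn F'; exact: sf.
- by move=> x /=; rewrite !in_itv/= => /andP[px xq]; rewrite (lt_le_trans cp)//= (le_lt_trans xq).
move=> x; rewrite negb_and -!ltNge => /orP[xp|qx].
  rewrite /F (_ : Rintegral _ _ _ = \int[leb1 R]_(t in `]-oo, x]) 0).
    by rewrite /Rintegral integral0.
  apply: eq_Rintegral => t; rewrite inE /= in_itv /= => tx; apply: f0.
  by rewrite negb_and -!ltNge (le_lt_trans tx).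
rewrite -If /F Rintegral_mkcond [RHS]Rintegral_mkcond.
apply: eq_Rintegral => t _; rewrite !patchE !mem_setE !in_itv /=.
case: (boolP (p <= t <= q)) => [/andP[pt tq]|/f0 ->]; last by rewrite !if_same.
by rewrite (lt_le_trans cp pt) (le_lt_trans tq qd) (le_trans tq (ltW qx)).
Qed.

End antiderivative.

(** * Primitives and integration by parts *)

Section primitive.
Variable R : realType.
Local Notation mR := (measurableTypeR R).

Lemma continuous_bounded_compact (T : topologicalType) (f : T -> R) (A : set T) :
  compact A -> continuous f -> exists M, forall x, A x -> `|f x| <= M.
Proof.
move=> cA cf; have cfA : compact (f @` A).
  by apply: continuous_compact => //; exact: continuous_subspaceT.
have [M [_ hM]] := compact_bounded cfA.
exists (M + 1) => x Ax; apply: (hM (M + 1)); first by rewrite ltrDl.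
by exists x.
Qed.

Definition heav (r : R) : R := if 0 < r then 1 else 0.

Lemma heav_norm_le1 r : `|heav r| <= 1.
Proof. by rewrite /heav; case: ifP; rewrite ?normr1 ?normr0 ?ler01. Qed.

Lemma measurable_heav : measurable_fun setT (heav : mR -> R).
Proof.
have -> : heav = \1_(`]0, +oo[%classic).
  by apply/funext => r; rewrite indicE /heav mem_setE in_itv /= andbT; case: ifP.
by apply: measurable_indic; exact: measurable_itv.
Qed.

(** The primitive of [h] on [0 < s < A] vanishing at the left end point. The
    Heaviside function makes it an integral over a fixed set, to which Fubini's
    theorem applies. *)
Definition prim (A : R) (h : R -> R) (x : R) : R :=
  \int[leb1 R]_(s in `]0, A[) (h s * heav (x - s)).

Let mI (i : interval R) : measurable ([set` i] : set mR).
Proof. exact: measurable_itv. Qed.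

Lemma leb1_itv (a b : R) :
  leb1 R `]a, b[%classic = (if (a < b)%R then (b - a)%R%:E else 0%E).
Proof. by have := @lebesgue_measure_itv R `]a, b[; rewrite /= lte_fin. Qed.

Lemma intble_cst_itv (a b c : R) : intble (leb1 R) `]a, b[ (fun=> c).
Proof.
apply/integrableP; split; first exact: measurable_cst.
rewrite /= (integral_cst (leb1 R) (mI _) `|c|%:E) lte_mul_pinfty ?lee_fin//.
by rewrite leb1_itv; case: ifP => _; rewrite ?ltry.
Qed.

Lemma Rintegral_cst_itv (a b c : R) : a <= b ->
  \int[leb1 R]_(x in `]a, b[) c = c * (b - a).
Proof.
move=> ab; rewrite Rintegral_cst//; congr (_ * _).
rewrite leb1_itv.
by case: ltgtP ab => //= -> _; rewrite subrr.
Qed.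

Lemma L2_cst_itv (a b c : R) : L2 (leb1 R) `]a, b[ (fun=> c).
Proof. by apply: (L2_le (mI _) _ (intble_cst_itv a b (c ^+ 2))). Qed.

Lemma FTC_oo (f F : R -> R) (a b : R) : a < b -> continuous f ->
  (forall x : R, is_derive x 1 F (f x)) ->
  \int[leb1 R]_(x in `]a, b[) f x = F b - F a.
Proof.
move=> ab cf dF.
have cF : continuous F.
  move=> x; apply: differentiable_continuous; apply/derivable1_diffP.
  by case: (dF x).
have icc : intble (leb1 R) `[a, b] f.
  apply: continuous_compact_integrable; first exact: segment_compact.
  exact: continuous_subspaceT.
have h : (\int[leb1 R]_(x in `[a, b]) (f x)%:E = (F b)%:E - (F a)%:E)%E.
  apply: continuous_FTC2 => //.
  - exact: continuous_subspaceT.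
  - split.
    + by move=> x _; case: (dF x).
    + exact/cvg_at_right_filter/cF.
    + exact/cvg_at_left_filter/cF.
  - by move=> x _; rewrite (derive1_fun dF).
rewrite /leb1 Rintegral_itv_bndo_bndc; last first.
  apply: integrableS icc => //; try exact: mI.
  exact: subset_itv_oo_cc.
rewrite Rintegral_itv_obnd_cbnd; last first.
  apply: integrableS icc => //; try exact: mI.
  exact: subset_itv_oc_cc.
by rewrite /Rintegral h.
Qed.

Section one_dimension.
Variables (A : R) (h phi phi' : R -> R).
Hypotheses (ih : intble (leb1 R) `]0, A[ h)
  (dphi : forall x : R, is_derive x 1 phi (phi' x)) (cphi' : continuous phi').

Let X : set mR := `]0, A[%classic.

(** Exchange the two integrations. *)
Lemma prim_ibp1 :
  \int[leb1 R]_(x in X) (prim A h x * phi' x) =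
  \int[leb1 R]_(s in X) (h s * (phi A - phi s)).
Proof.
have mX : measurable X by exact: mI.
have mXX := measurableX mX mX.
have [M hM] := continuous_bounded_compact (@segment_compact R 0 A) cphi'.
have XI x : X x -> `[0, A]%classic x.
  by rewrite /X /= !in_itv/= => /andP[x0 xA]; rewrite !ltW.
have mphi' : measurable_fun setT (phi' : mR -> R) by exact: continuous_measurable_fun.
have ik0 : intble (leb2 R) (X `*` X) (fun z => 1 * h z.2).
  exact: (intble_tensor mX mX (intble_cst_itv 0 A 1) ih).
have mhea : measurable_fun (X `*` X : set (mR * mR)) (fun z => heav (z.1 - z.2) * phi' z.1).
  apply: measurable_funTS; apply: measurable_funM; last exact: measurableT_comp.
  apply: (measurableT_comp measurable_heav).
  by apply: measurable_funB; [exact: measurable_fst|exact: measurable_snd].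
have ik : intble (leb2 R) (X `*` X) (fun z => 1 * h z.2 * (heav (z.1 - z.2) * phi' z.1)).
  apply: (intbleMb mXX (M := M)) => // -[x s] [/= Xx Xs].
  by rewrite normrM -[M]mul1r ler_pM ?heav_norm_le1 ?hM//; exact: XI.
transitivity (\int[leb2 R]_(z in X `*` X) (1 * h z.2 * (heav (z.1 - z.2) * phi' z.1))).
  rewrite (Rfubini1 mX mX ik); apply: eq_Rintegral => x; rewrite inE => Xx.
  rewrite /prim -RintegralZr//.
    by apply: eq_Rintegral => s _ /=; ring.
  apply: (intbleMb (mI _) (M := 1) _ _ ih); last by move=> *; exact: heav_norm_le1.
  apply: measurable_funTS; apply: (measurableT_comp measurable_heav).
  by apply: measurable_funB => //; exact: measurable_id.
rewrite (Rfubini2 mX mX ik); apply: eq_Rintegral => s; rewrite inE => Xs.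
have ip : intble (leb1 R) X (fun x => heav (x - s) * phi' x).
  apply: (intble_le (mI _) (g := fun=> M)); last 1 first.
  - move=> x Xx; rewrite normrM -[M]mul1r ler_pM ?heav_norm_le1 ?hM//.
    exact: XI.
  - apply: measurable_funTS; apply: measurable_funM => //.
    apply: (measurableT_comp measurable_heav).
    by apply: measurable_funB => //; exact: measurable_id.
  - exact: intble_cst_itv.
transitivity (h s * \int[leb1 R]_(x in X) (heav (x - s) * phi' x)).
  by rewrite -RintegralZl//; apply: eq_Rintegral => x _ /=; ring.
congr (_ * _); have /andP[s0 sA] : 0 < s < A by move: Xs; rewrite /X /= in_itv.
rewrite -(FTC_oo sA cphi' dphi) Rintegral_mkcond [RHS]Rintegral_mkcond.
apply: eq_Rintegral => x _; rewrite !patchE /X !mem_setE !in_itv /= /heav subr_gt0.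
case: (ltP s x) => sx /=; last by rewrite mul0r if_same.
by rewrite (lt_trans s0 sx) mul1r.
Qed.

End one_dimension.

End primitive.

(** * Primitives on a rectangle *)

Section rectangle_primitive.
Variable R : realType.
Local Notation mR := (measurableTypeR R).
Variables (A B : R).
Hypotheses (A0 : 0 < A) (B0 : 0 < B).
Let X : set mR := `]0, A[%classic.
Let Y : set mR := `]0, B[%classic.
Let mX : measurable X. Proof. exact: measurable_itv. Qed.
Let mY : measurable Y. Proof. exact: measurable_itv. Qed.
Let mXY : measurable (X `*` Y). Proof. exact: measurableX. Qed.

(** What integration by parts in the first variable uses of a smooth function on the
    closed rectangle. The first variable may be either [x] or [t]: exchanging the
    coordinates gives the results for the other direction. *)
Definition xsmooth (phi phix : R * R -> R) : Prop :=
  [/\ forall (y x : R), is_derive x 1 (fun x => phi (x, y)) (phix (x, y)),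
      forall y, continuous (fun x => phix (x, y)),
      measurable_fun setT (phi : mR * mR -> R),
      measurable_fun setT (phix : mR * mR -> R) &
      exists M, forall x y, 0 <= x <= A -> 0 <= y <= B ->
        `|phi (x, y)| <= M /\ `|phix (x, y)| <= M].

Lemma intble_snd (c : R -> R) : intble (leb1 R) Y c ->
  intble (leb2 R) (X `*` Y) (fun z => c z.2).
Proof.
move=> ic; apply: eq_intble (intble_tensor mX mY (intble_cst_itv 0 A 1) ic) => //.
by move=> z _ /=; rewrite mul1r.
Qed.

Lemma L2_snd (c : R -> R) : L2 (leb1 R) Y c -> L2 (leb2 R) (X `*` Y) (fun z => c z.2).
Proof.
move=> Lc; apply/L2P; split; last exact: (intble_snd (L2_sq Lc)).
have h : (snd : mR * mR -> mR) @` (X `*` Y) `<=` Y by move=> _ [[x y] [_ /= Yy] <-].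
apply: (measurable_comp mY h (L2_meas Lc)).
by apply: measurable_funTS; exact: measurable_snd.
Qed.

Lemma L2_sections f : L2 (leb2 R) (X `*` Y) f ->
  {ae leb1 R, forall y, Y y -> L2 (leb1 R) X (fun x => f (x, y))}.
Proof.
move=> Lf; apply: filterS (intble_sections2 mX mY (L2_sq Lf)) => y /= h Yy.
apply/L2P; split; last exact: h.
have m0 : measurable_fun setT (f \_ (X `*` Y) : mR * mR -> R).
  by apply/(measurable_restrictT _ mXY); exact: (L2_meas Lf).
have : measurable_fun X (fun x : mR => (f \_ (X `*` Y)) (x, y : mR)).
  apply: measurable_funTS; apply: (measurableT_comp m0).
  exact: pair2_measurable.
apply: eq_measurable_fun => x; rewrite inE => Xx.
by rewrite restrict_setX mem_set// patchE mem_set.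
Qed.

Variable v : R * R -> R.
Hypothesis Lv : L2 (leb2 R) (X `*` Y) v.

Definition prim2 (z : R * R) : R := prim A (fun s => v (s, z.2)) z.1.

Lemma measurable_prim2 : measurable_fun (X `*` Y : set (mR * mR)) prim2.
Proof.
pose v0 : mR * mR -> R := v \_ (X `*` Y).
have m0 : measurable_fun setT v0.
  by apply/(measurable_restrictT _ mXY); exact: (L2_meas Lv).
pose k (w : (mR * mR) * mR) := v0 (w.2, w.1.2) * heav (w.1.1 - w.2).
have mk : measurable_fun setT k.
  have m2 := @measurable_snd _ _ (mR * mR)%type mR.
  have m11 := measurableT_comp (@measurable_fst _ _ mR mR) (@measurable_fst _ _ (mR * mR)%type mR).
  have m12 := measurableT_comp (@measurable_snd _ _ mR mR) (@measurable_fst _ _ (mR * mR)%type mR).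
  apply: measurable_funM; first exact: (measurableT_comp m0 (measurable_fun_pair m2 m12)).
  have mB : @measurable_fun _ _ ((mR * mR) * mR)%type mR setT (fun w => w.1.1 - w.2).
    exact: (measurable_funB m11 m2).
  exact: (measurableT_comp (@measurable_heav R) mB).
have := measurable_Rintegral_snd (@lebesgue_measure R) mk.
move=> /(measurable_funTS (D := X `*` Y)); apply: eq_measurable_fun => -[x y].
rewrite inE => -[/= Xx Yy]; rewrite /prim2 /prim [RHS]Rintegral_mkcond.
apply: eq_Rintegral => s _; rewrite /k /= /v0 !patchE /=.
have -> : ((s, y) \in X `*` Y) = (s \in X).
  by apply/idP/idP; rewrite !inE; [case|split].
by rewrite -/X; case: ifP; rewrite ?mul0r.
Qed.

(** Cauchy-Schwarz against the Heaviside function. *)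
Lemma prim_sq_le (h : R -> R) x : L2 (leb1 R) X h ->
  prim A h x ^+ 2 <= A * \int[leb1 R]_(s in X) (h s ^+ 2).
Proof.
move=> Lh; have Lx : L2 (leb1 R) X (fun s => heav (x - s)).
  apply: (L2_le mX (g := fun=> 1)).
  - apply: measurable_funTS; apply: (measurableT_comp (@measurable_heav R)).
    by apply: measurable_funB => //; exact: measurable_id.
  - exact: intble_cst_itv.
  - by move=> s _; rewrite /heav; case: ifP; rewrite ?expr1n ?expr0n.
apply: le_trans (Rcauchy_schwarz mX Lh Lx) _; rewrite mulrC.
apply: ler_wpM2r; first by apply: Rintegral_ge0 => s _; exact: sqr_ge0.
apply: (@le_trans _ _ (\int[leb1 R]_(s in X) 1)); last first.
  by rewrite (Rintegral_cst_itv _ (ltW A0)) subr0 mul1r.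
apply: le_Rintegral => //; [exact: (L2_sq Lx)|exact: intble_cst_itv|].
by move=> s _; rewrite /heav; case: ifP; rewrite ?expr1n ?expr0n.
Qed.

Lemma L2_prim2 : L2 (leb2 R) (X `*` Y) prim2.
Proof.
pose S y := \int[leb1 R]_(s in X) (v (s, y) ^+ 2).
have iS : intble (leb1 R) Y S := intble_Rintegral2 mX mY (L2_sq Lv).
apply: (L2_le_ae mXY measurable_prim2 (g := fun z => A * S z.2)).
  by apply: intbleZ => //; exact: intble_snd.
apply: filterS (ae_snd (@lebesgue_measure R) (L2_sections Lv)) => -[x y] /= h [_ Yy].
exact/prim_sq_le/h.
Qed.

Lemma prim_ibp2 (phi phix : R * R -> R) : xsmooth phi phix ->
  \int[leb2 R]_(z in X `*` Y) (prim2 z * phix z) =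
  \int[leb2 R]_(z in X `*` Y) (v z * (phi (A, z.2) - phi z)).
Proof.
move=> [dphi cphix mphi mphix [M hM]].
have XI x : X x -> 0 <= x <= A by rewrite /X /= in_itv/= => /andP[? ?]; rewrite !ltW.
have YI y : Y y -> 0 <= y <= B by rewrite /Y /= in_itv/= => /andP[? ?]; rewrite !ltW.
have mphiA : measurable_fun setT (fun y : mR => phi (A, y)).
  by apply: (measurableT_comp mphi); exact: pair1_measurable.
have A1 : 0 <= A <= A by rewrite lexx ltW.
have i1 : intble (leb2 R) (X `*` Y) (fun z => prim2 z * phix z).
  apply: L2M => //; first exact: L2_prim2.
  apply: (L2_le mXY (g := fun=> 1 * M ^+ 2)).
  - exact: measurable_funTS.
  - exact: (intble_tensor mX mY (intble_cst_itv 0 A 1) (intble_cst_itv 0 B (M ^+ 2))).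
  - move=> [x y] [/= /XI hx /YI hy]; have [_ h] := hM _ _ hx hy.
    rewrite mul1r -[leLHS]real_normK ?num_real// lerXn2r ?nnegrE//.
    exact: le_trans h.
have i2 : intble (leb2 R) (X `*` Y) (fun z => v z * (phi (A, z.2) - phi z)).
  apply: L2M => //; apply: (L2_le mXY (g := fun=> 1 * (M + M) ^+ 2)).
  - apply: measurable_funTS; apply: measurable_funB => //.
    by apply: (measurableT_comp mphiA); exact: measurable_snd.
  - exact: (intble_tensor mX mY (intble_cst_itv 0 A 1) (intble_cst_itv 0 B ((M + M) ^+ 2))).
  - move=> [x y] [/= /XI hx /YI hy]; have [h1 _] := hM _ _ hx hy.
    have [h2 _] := hM _ _ A1 hy.
    have h : `|phi (A, y) - phi (x, y)| <= M + M.
      by apply: le_trans (ler_normB _ _) _; exact: lerD.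
    rewrite mul1r -[leLHS]real_normK ?num_real// lerXn2r ?nnegrE//.
    exact: le_trans h.
rewrite (Rfubini2 mX mY i1) (Rfubini2 mX mY i2); apply: Rintegral_ae_eq => //.
- exact: (intbleP (intble_Rintegral2 mX mY i1)).
- exact: (intbleP (intble_Rintegral2 mX mY i2)).
have L1v : intble (leb2 R) (X `*` Y) v.
  apply: eq_intble (L2M mXY Lv (f := v) (g := fun=> 1) _) => //.
    by move=> z _; rewrite mulr1.
  apply: (L2_le mXY (g := fun=> 1 * 1)); first exact: measurable_cst.
    exact: (intble_tensor mX mY (intble_cst_itv 0 A 1) (intble_cst_itv 0 B 1)).
  by move=> z _; rewrite expr1n mulr1.
apply: filterS (intble_sections2 mX mY L1v) => y /= h Yy.
exact: (prim_ibp1 (h Yy) (dphi y) (cphix y)).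
Qed.

End rectangle_primitive.

(** * Weakly differentiable functions as primitives *)

Section representation.
Variable R : realType.
Local Notation mR := (measurableTypeR R).

Lemma smooth1_derive1 (f : R -> R) : smooth1 f -> smooth1 (derive1 f).
Proof. by move=> sf n x; rewrite -derive1Sn; exact: sf. Qed.

Lemma smooth1_is_derive (f : R -> R) (x : R) : smooth1 f -> is_derive x 1 f (derive1 f x).
Proof. by move=> sf; apply: is_derive_smooth; exact: (sf 0%N x). Qed.

Lemma smooth1_lin (k : R) (f g : R -> R) : smooth1 f -> smooth1 g ->
  smooth1 (fun x => f x + k * g x).
Proof.
move=> /smooth1P sf /smooth1P sg; apply/smooth1P => n.
by apply: smoothnD => //; exact: smoothnZ.
Qed.

Lemma test1_out (I : set R) f x : test1 I f -> ~ I x -> f x = 0.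
Proof.
move=> [_ _ h] nI; apply/eqP/negPn/negP => fx; apply: nI; apply: h.
exact: subset_closure.
Qed.

Lemma derive1_eq0_near (f : R -> R) (x : R) : (\near x, f x = 0) -> derive1 f x = 0.
Proof.
move=> h; rewrite derive1E -(derive_cst (0 : R) (1 : R) x).
by apply: near_eq_derive; apply: filterS h.
Qed.

Lemma test1_derive1 (I : set R) f : test1 I f -> test1 I (derive1 f).
Proof.
move=> [sf cf fI]; have h : [set x | derive1 f x != 0] `<=` closure [set x | f x != 0].
  move=> x /= fx; apply: contrapT => nc; move/eqP: fx; apply.
  apply: derive1_eq0_near.
  have : nbhs x (~` closure [set x | f x != 0]).
    by apply: open_nbhs_nbhs; split => //; apply: closed_openC; exact: closed_closure.
  apply: filterS => y /= ny; apply/eqP/negPn/negP => fy; apply: ny.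
  exact: subset_closure.
have h2 : closure [set x | derive1 f x != 0] `<=` closure [set x | f x != 0].
  have -> := (closure_id _).1 (@closed_closure _ [set x | f x != 0]).
  exact: closureS.
split; first exact: smooth1_derive1.
- by apply: subclosed_compact h2 => //; exact: closed_closure.
- exact: subset_trans h2 fI.
Qed.

Section rectangle.
Variables (A B : R).
Hypotheses (A0 : 0 < A) (B0 : 0 < B).
Let X : set mR := `]0, A[%classic.
Let Y : set mR := `]0, B[%classic.
Let mX : measurable X. Proof. exact: measurable_itv. Qed.
Let mY : measurable Y. Proof. exact: measurable_itv. Qed.
Let mXY : measurable (X `*` Y). Proof. exact: measurableX. Qed.

Lemma L2_cst_rect (c : R) : L2 (leb2 R) (X `*` Y) (fun=> c).
Proof. by have := L2_snd A (L2_cst_itv 0 B c). Qed.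

Lemma L2_intble f : L2 (leb2 R) (X `*` Y) f -> intble (leb2 R) (X `*` Y) f.
Proof.
move=> Lf; apply: eq_intble (L2M mXY Lf (L2_cst_rect 1)) => //.
by move=> z _; rewrite mulr1.
Qed.

Lemma xsmooth_tensor (f g : R -> R) : smooth1 f -> smooth1 g ->
  xsmooth A B (fun z => f z.1 * g z.2) (fun z => derive1 f z.1 * g z.2).
Proof.
move=> sf sg; have cf := smooth1_continuous sf; have cg := smooth1_continuous sg.
have cf' := smooth1_continuous (smooth1_derive1 sf).
have [Mf hf] := continuous_bounded_compact (@segment_compact R 0 A) cf.
have [Mf' hf'] := continuous_bounded_compact (@segment_compact R 0 A) cf'.
have [Mg hg] := continuous_bounded_compact (@segment_compact R 0 B) cg.
have mtens (h : R -> R) : continuous h ->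
    measurable_fun setT ((fun z => h z.1 * g z.2) : mR * mR -> R).
  move=> ch; apply: measurable_funM.
    exact: (measurableT_comp (continuous_measurable_fun ch) (@measurable_fst _ _ mR mR)).
  exact: (measurableT_comp (continuous_measurable_fun cg) (@measurable_snd _ _ mR mR)).
split.
- move=> y x /=; have := smooth1_is_derive x sf => h.
  by apply: is_derive_eq; rewrite /GRing.scale /=; ring.
- by move=> y x /=; apply: cvgM; [exact: cf'|exact: cvg_cst].
- exact: mtens.
- exact: mtens.
exists (Num.max Mf Mf' * Mg) => x y hx hy /=.
have hx' : `[0, A]%classic x by rewrite /= in_itv.
have hy' : `[0, B]%classic y by rewrite /= in_itv.
rewrite !normrM; split; apply: ler_pM => //; rewrite ?hg// le_max ?hf ?hf'// ?orbT//.
Qed.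

(** [v] is the [x]-derivative of [u] as far as products of test functions can
    tell. This form passes to higher derivatives by differentiating one factor. *)
Definition xweak (u v : R * R -> R) : Prop :=
  forall F g, test1 X F -> test1 Y g ->
    \int[leb2 R]_(z in X `*` Y) (u z * (derive1 F z.1 * g z.2)) =
    - \int[leb2 R]_(z in X `*` Y) (v z * (F z.1 * g z.2)).

Lemma Rintegral_bmp_gt0 n (p q : rat) : 0 < ratr p :> R -> ratr p < ratr q :> R -> ratr q < A ->
  0 < \int[leb1 R]_(x in X) @bmp R n p q x.
Proof.
move=> p0 pq qA; rewrite ltNge; apply/negP => le0.
have ib : intble (leb1 R) X (@bmp R n p q).
  apply: (intble_le mX (g := fun=> 1)); [exact: measurable_bmp|exact: intble_cst_itv|].
  by move=> x _; exact: bmp_norm_le1.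
have [N [mN N0 hN]] := Rintegral_eq0_ae mX ib (fun x _ => bump_ge0 _ _ _ _) le0.
have sub : `]ratr p, ratr q[%classic `<=` N.
  move=> x; rewrite /= in_itv /= => /andP[px xq]; apply: hN => /= h.
  have Xx : X x by rewrite /X /= in_itv/= (lt_trans p0 px) (lt_trans xq qA).
  have := h Xx; rewrite /bmp /bump !flat0E !subr_gt0 px xq => /eqP.
  by rewrite mulf_eq0 !gt_eqF ?expR_gt0.
have : (leb1 R `]ratr p, ratr q[%classic <= leb1 R N)%E.
  by apply: le_measure => //; rewrite inE//; exact: measurable_itv.
rewrite leb1_itv pq (_ : leb1 R N = 0%E)//.
by rewrite lee_fin subr_le0 leNgt pq.
Qed.

(** Let [w] be the difference of [u] and the primitive of [v]; its weak derivative in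
    [x] is zero. A bump [f] in [x], minus the multiple of a fixed bump [b] with the
    same integral, has an antiderivative that is a test function; so the integral
    of [w] against [f(x) g(y)] depends on [f] only through its integral, as for a
    function of [y] alone, which is the mean of [w] against [b]. *)
Lemma xrep (u v : R * R -> R) : L2 (leb2 R) (X `*` Y) u -> L2 (leb2 R) (X `*` Y) v ->
  xweak u v ->
  exists c, L2 (leb1 R) Y c /\
    ae_eq (leb2 R) (X `*` Y) u (fun z => c z.2 + prim2 A v z).
Proof.
move=> Lu Lv uv; pose w z := u z - prim2 A v z.
have Lw : L2 (leb2 R) (X `*` Y) w by apply: L2B => //; exact: L2_prim2.
have [p0 /andP[p00 p0A]] := rat_between A0.
have [q0 /andP[p0q0 q0A]] := rat_between p0A.
pose b := @bmp R 0 p0 q0; pose m0 := \int[leb1 R]_(x in X) b x.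
have m0p : 0 < m0 by exact: Rintegral_bmp_gt0.
have mb : measurable_fun X b by exact: measurable_bmp.
have Lbmp n p q : L2 (leb1 R) X (@bmp R n p q).
  apply: (L2_le mX (g := fun=> 1)); [exact: measurable_bmp|exact: intble_cst_itv|].
  by move=> x _; rewrite -[leLHS]real_normK ?num_real// exprn_ile1 ?bmp_norm_le1.
have LbmpY n p q : L2 (leb1 R) Y (@bmp R n p q).
  apply: (L2_le mY (g := fun=> 1)); [exact: measurable_bmp|exact: intble_cst_itv|].
  by move=> x _; rewrite -[leLHS]real_normK ?num_real// exprn_ile1 ?bmp_norm_le1.
have ibmp n p q : intble (leb1 R) X (@bmp R n p q).
  apply: (intble_le mX (g := fun=> 1)); [exact: measurable_bmp|exact: intble_cst_itv|].
  by move=> x _; exact: bmp_norm_le1.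
have mbz n p q : measurable_fun (X `*` Y) (fun z : mR * mR => @bmp R n p q z.1).
  apply: measurable_funTS.
  exact: (measurableT_comp (@measurable_bmp R setT n p q) (@measurable_fst _ _ mR mR)).
have mbz2 n p q : measurable_fun (X `*` Y) (fun z : mR * mR => @bmp R n p q z.2).
  apply: measurable_funTS.
  exact: (measurableT_comp (@measurable_bmp R setT n p q) (@measurable_snd _ _ mR mR)).
have Lwb : L2 (leb2 R) (X `*` Y) (fun z => w z * b z.1).
  exact: (L2Mb mXY (mbz 0%N p0 q0) (fun z _ => bmp_norm_le1 0 p0 q0 z.1) Lw).
pose c0 y := \int[leb1 R]_(x in X) (w (x, y) * b x).
pose c y := m0^-1 * c0 y.
have Lc : L2 (leb1 R) Y c.
  apply: L2Z => //.
  apply: (L2_le_ae mY (g := fun y => (\int[leb1 R]_(x in X) (b x ^+ 2)) * \int[leb1 R]_(x in X) (w (x, y) ^+ 2))).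
  - exact: (intbleP (intble_Rintegral2 mX mY (L2_intble Lwb))).
  - by apply: intbleZ => //; exact: (intble_Rintegral2 mX mY (L2_sq Lw)).
  - apply: filterS (L2_sections Lw) => y h Yy.
    by rewrite mulrC; apply: Rcauchy_schwarz => //; [exact: h|exact: Lbmp].
exists c; split => //.
pose W z := w z - c z.2.
have LW : L2 (leb2 R) (X `*` Y) W := L2B mXY Lw (L2_snd A Lc).
suff : ae_eq (leb2 R) (X `*` Y) W (fun=> 0).
  apply: filterS => z + XYz => /(_ XYz); rewrite /W /w => h.
  by lra.
apply: flcv2; first exact: L2_intble.
move=> p q r s m n hp hpq hq hr hrs hs.
set f := @bmp R m p q; set g := @bmp R n r s.
(* with this [k] the integral of [f + k b] is zero *)
pose mf := \int[leb1 R]_(x in X) f x; pose k := - (mf / m0).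
have b1 (e p1 q1 x : R) : ~~ (p1 <= x <= q1) -> bump e p1 q1 x = 0.
  by move=> h; apply: bump_out; apply: contra h => /andP[? ?]; rewrite !ltW.
have [F [tF F']] : exists F, test1 X F /\ derive1 F = (fun x => f x + k * b x).
  apply: (@test1_antiderivative R 0 A (Num.min (ratr p) (ratr p0)) (Num.max (ratr q) (ratr q0))).
  - by apply: smooth1_lin; apply: smooth1_bump; exact: bmp_eps.
  - by rewrite lt_min hp p00.
  - by rewrite gt_max hq q0A.
  - move=> x; rewrite ge_min le_max negb_and !negb_or => hx.
    by case/orP: hx => /andP[/negbTE h1 /negbTE h2];
      rewrite /f /b /bmp !b1 ?h1 ?h2 ?andbF ?mulr0 ?addr0.
  - rewrite RintegralD//; [|exact: ibmp|by apply: intbleZ => //; exact: ibmp].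
    rewrite RintegralZl//; last exact: ibmp.
    by rewrite -/mf -/m0 /k mulNr divfK ?subrr// gt_eqF.
have tg : test1 Y g.
  apply: test1_bump; first exact: bmp_eps.
  by move=> x; rewrite /Y /= !in_itv/= => /andP[h1 h2]; rewrite (lt_le_trans hr)//= (le_lt_trans h2).
have FA : F A = 0.
  by apply: (test1_out tF); rewrite /X /= in_itv/= ltxx andbF.
have [sF _ _] := tF; have [sg _ _] := tg.
have ft := xsmooth_tensor sF sg.
have hb z0 (n1 n2 : nat) (p1 q1 p2 q2 : rat) : L2 (leb2 R) (X `*` Y) z0 ->
    intble (leb2 R) (X `*` Y) (fun z => z0 z * (@bmp R n1 p1 q1 z.1 * @bmp R n2 p2 q2 z.2)).
  move=> Lz; apply: (intbleMb mXY (M := 1)); last exact: L2_intble.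
    exact: measurable_funM.
  by move=> z _; rewrite normrM -[1]mulr1 ler_pM ?bmp_norm_le1.
have hF z0 : L2 (leb2 R) (X `*` Y) z0 ->
    intble (leb2 R) (X `*` Y) (fun z => z0 z * (derive1 F z.1 * g z.2)).
  move=> Lz; have h := intbleD mXY (hb _ m n p q r s Lz) (intbleZ mXY k (hb _ 0%N n p0 q0 r s Lz)).
  by apply: eq_intble h => // z _; rewrite F' /f /b /g; ring.
have hvF : intble (leb2 R) (X `*` Y) (fun z => v z * (F z.1 * g z.2)).
  have [_ _ mFg _ [M hM]] := ft.
  apply: (intbleMb mXY (M := M)); [exact: measurable_funTS| |exact: L2_intble].
  move=> [x y] [/= Xx Yy]; apply: (hM x y _ _).1.
    by move: Xx; rewrite /X /= in_itv/= => /andP[? ?]; rewrite !ltW.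
  by move: Yy; rewrite /Y /= in_itv/= => /andP[? ?]; rewrite !ltW.
pose I1 := \int[leb2 R]_(z in X `*` Y) (w z * (f z.1 * g z.2)).
pose I2 := \int[leb2 R]_(z in X `*` Y) (w z * (b z.1 * g z.2)).
pose C := \int[leb1 R]_(y in Y) (c y * g y).
have icg : intble (leb1 R) Y (fun y => c y * g y) by exact: (L2M mY Lc (LbmpY _ _ _)).
have E1 : I1 + k * I2 = 0.
  transitivity (\int[leb2 R]_(z in X `*` Y) (w z * (derive1 F z.1 * g z.2))).
    rewrite /I1 /I2 -RintegralZl//; last exact: (hb _ _ _ _ _ _ _ Lw).
    rewrite -RintegralD//; [|exact: (hb _ _ _ _ _ _ _ Lw)|]; last first.
      by apply: intbleZ => //; exact: (hb _ _ _ _ _ _ _ Lw).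
    by apply: eq_Rintegral => z _; rewrite F'; ring.
  transitivity (\int[leb2 R]_(z in X `*` Y) (u z * (derive1 F z.1 * g z.2))
    - \int[leb2 R]_(z in X `*` Y) (prim2 A v z * (derive1 F z.1 * g z.2))).
    rewrite -RintegralB//; [|exact: (hF _ Lu)|exact: (hF _ (L2_prim2 A0 Lv))].
    by apply: eq_Rintegral => z _; rewrite /w; ring.
  rewrite (prim_ibp2 A0 Lv ft) (uv _ _ tF tg).
  transitivity (- (\int[leb2 R]_(z in X `*` Y) (v z * (F z.1 * g z.2)))
     - (-1) * \int[leb2 R]_(z in X `*` Y) (v z * (F z.1 * g z.2))); last by rewrite mulN1r opprK addNr.
  congr (_ - _); rewrite -RintegralZl//.
  by apply: eq_Rintegral => z _; rewrite /= FA; ring.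
have E2 : I2 = m0 * C.
  rewrite /I2 (Rfubini2 mX mY (hb _ _ _ _ _ _ _ Lw)) -RintegralZl//.
  apply: Rintegral_ae_eq => //.
  - exact: (intbleP (intble_Rintegral2 mX mY (hb _ _ _ _ _ _ _ Lw))).
  - exact: (intbleP (intbleZ mY m0 icg)).
  apply: filterS (intble_sections2 mX mY (L2_intble Lwb)) => y h Yy.
  have -> : m0 * (c y * g y) = c0 y * g y by rewrite /c; field; rewrite gt_eqF.
  rewrite /c0 -RintegralZr//; last exact: h.
  by apply: eq_Rintegral => x _ ; rewrite /= /b /g; ring.
have Lcz := L2_snd A Lc.
have E4 : \int[leb2 R]_(z in X `*` Y) (c z.2 * (f z.1 * g z.2)) = mf * C.
  rewrite (Rfubini2 mX mY (hb _ _ _ _ _ _ _ Lcz)) -RintegralZl//.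
  apply: eq_Rintegral => y _ /=; rewrite mulrC -RintegralZl//; last exact: ibmp.
  by apply: eq_Rintegral => x _ ; rewrite /= /f /g; ring.
transitivity (I1 - mf * C).
  rewrite -E4 -RintegralB//; [|exact: (hb _ _ _ _ _ _ _ Lw)|exact: (hb _ _ _ _ _ _ _ Lcz)].
  by apply: eq_Rintegral => z _; rewrite /W; ring.
have -> : I1 = - k * I2 by rewrite mulNr; apply/eqP; rewrite -addr_eq0 E1.
by rewrite E2 /k; field; rewrite gt_eqF.
Qed.

End rectangle.

End representation.

(** * Green's formula and bounds for traces *)

Section traces_of_weakly_differentiable.
Variable R : realType.
Local Notation mR := (measurableTypeR R).
Variables (A B : R).
Hypotheses (A0 : 0 < A) (B0 : 0 < B).
Let X : set mR := `]0, A[%classic.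
Let Y : set mR := `]0, B[%classic.
Let mX : measurable X. Proof. exact: measurable_itv. Qed.
Let mY : measurable Y. Proof. exact: measurable_itv. Qed.
Let mXY : measurable (X `*` Y). Proof. exact: measurableX. Qed.

Definition Ktr : R := 4 / A + 6 * A.

Definition L2sq (u : R * R -> R) : R := \int[leb2 R]_(z in X `*` Y) (u z ^+ 2).

Lemma xsmooth_L2 phi phix : xsmooth A B phi phix ->
  [/\ L2 (leb2 R) (X `*` Y) phi, L2 (leb2 R) (X `*` Y) phix,
      L2 (leb1 R) Y (fun y => phi (A, y)) & L2 (leb1 R) Y (fun y => phi (0, y))].
Proof.
move=> [_ _ mphi mphix [M hM]].
have sqM r : `|r| <= M -> r ^+ 2 <= M ^+ 2.
  move=> rM; rewrite -[leLHS]real_normK ?num_real// lerXn2r ?nnegrE//.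
  exact: le_trans rM.
have XI x : X x -> 0 <= x <= A by rewrite /X /= in_itv/= => /andP[? ?]; rewrite !ltW.
have YI y : Y y -> 0 <= y <= B by rewrite /Y /= in_itv/= => /andP[? ?]; rewrite !ltW.
have iM : intble (leb2 R) (X `*` Y) (fun=> M ^+ 2) := L2_intble (L2_cst_rect A B (M ^+ 2)).
split.
- apply: (L2_le mXY _ iM); first exact: measurable_funTS.
  by move=> [x y] [/= /XI hx /YI hy]; apply/sqM/(hM _ _ hx hy).1.
- apply: (L2_le mXY _ iM); first exact: measurable_funTS.
  by move=> [x y] [/= /XI hx /YI hy]; apply/sqM/(hM _ _ hx hy).2.
- apply: (L2_le mY _ (intble_cst_itv 0 B (M ^+ 2))).
    apply: measurable_funTS; apply: (measurableT_comp mphi).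
    exact: pair1_measurable.
  by move=> y /YI hy; apply/sqM/(hM _ _ _ hy).1; rewrite lexx ltW.
- apply: (L2_le mY _ (intble_cst_itv 0 B (M ^+ 2))).
    apply: measurable_funTS; apply: (measurableT_comp mphi).
    exact: pair1_measurable.
  by move=> y /YI hy; apply/sqM/(hM _ _ _ hy).1; rewrite lexx ltW.
Qed.

Lemma Rintegral_sq_le (h : R -> R) : L2 (leb1 R) X h ->
  (\int[leb1 R]_(s in X) h s) ^+ 2 <= A * \int[leb1 R]_(s in X) (h s ^+ 2).
Proof.
move=> Lh; have := Rcauchy_schwarz mX Lh (L2_cst_itv 0 A 1).
rewrite (_ : \int[leb1 R]_(x in X) (1 ^+ 2) = A); last first.
  by rewrite expr1n (Rintegral_cst_itv _ (ltW A0)) mul1r subr0.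
rewrite (_ : \int[leb1 R]_(x in X) (h x * 1) = \int[leb1 R]_(s in X) h s).
  by rewrite mulrC.
by apply: eq_Rintegral => x _; rewrite mulr1.
Qed.

Definition green (u v : R * R -> R) (g1 g2 : R -> R) : Prop :=
  forall phi phix, xsmooth A B phi phix ->
    \int[leb2 R]_(z in X `*` Y) (u z * phix z + v z * phi z) =
    \int[leb1 R]_(y in Y) (g2 y * phi (A, y) - g1 y * phi (0, y)).

(** Writing [u] as [c(y)] plus the primitive of [v], the two traces are [c] and [c]
    plus the whole integral of [v] in [x]. Both, and [u(x, .)] for almost every
    fixed [x], are controlled by averaging [c(y) = u(x, y) - prim(x, y)] over [x]. *)
Lemma xtrace (u v : R * R -> R) : L2 (leb2 R) (X `*` Y) u -> L2 (leb2 R) (X `*` Y) v ->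
  xweak A B u v -> exists g1 g2 : R -> R,
  [/\ L2 (leb1 R) Y g1, L2 (leb1 R) Y g2, green u v g1 g2,
      {ae leb1 R, forall y, Y y ->
        g1 y ^+ 2 <= Ktr * (\int[leb1 R]_(x in X) (u (x, y) ^+ 2) + \int[leb1 R]_(x in X) (v (x, y) ^+ 2)) /\
        g2 y ^+ 2 <= Ktr * (\int[leb1 R]_(x in X) (u (x, y) ^+ 2) + \int[leb1 R]_(x in X) (v (x, y) ^+ 2))} &
      {ae leb1 R, forall x, X x -> \int[leb1 R]_(y in Y) (u (x, y) ^+ 2) <= Ktr * (L2sq u + L2sq v)}].
Proof.
move=> Lu Lv uv; have [c [Lc ae_u]] := xrep A0 Lu Lv uv.
pose S y := \int[leb1 R]_(x in X) (v (x, y) ^+ 2).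
pose Su y := \int[leb1 R]_(x in X) (u (x, y) ^+ 2).
pose J y := \int[leb1 R]_(x in X) v (x, y).
have iS : intble (leb1 R) Y S := intble_Rintegral2 mX mY (L2_sq Lv).
have iSu : intble (leb1 R) Y Su := intble_Rintegral2 mX mY (L2_sq Lu).
have L1v := L2_intble Lv.
have S0 y : 0 <= S y by apply: Rintegral_ge0 => x _; exact: sqr_ge0.
have Su0 y : 0 <= Su y by apply: Rintegral_ge0 => x _; exact: sqr_ge0.
have aeS := L2_sections Lv; have aeSu := L2_sections Lu.
have aeJ : {ae leb1 R, forall y, Y y -> J y ^+ 2 <= A * S y}.
  by apply: filterS aeS => y h Yy; apply: Rintegral_sq_le; exact: h.
have LJ : L2 (leb1 R) Y J.
  apply: (L2_le_ae mY _ (intbleZ mY A iS) aeJ).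
  exact: (intbleP (intble_Rintegral2 mX mY L1v)).
have Ainv : 0 < A^-1 by rewrite invr_gt0.
have cle : {ae leb1 R, forall y, Y y -> c y ^+ 2 <= 2 / A * Su y + 2 * A * S y}.
  have h1 : {ae leb1 R, forall y, {ae leb1 R, forall x, (X `*` Y) (x, y) ->
     u (x, y) = c y + prim2 A v (x, y)}} := ae_sections2 ae_u.
  apply: filterS3 aeS aeSu h1 => y hS hSu hx Yy.
  have Lvy := hS Yy; have Luy := hSu Yy.
  have : A * c y ^+ 2 <= 2 * Su y + 2 * A * S y * A.
    have -> : A * c y ^+ 2 = \int[leb1 R]_(x in X) (c y ^+ 2).
      by rewrite (Rintegral_cst_itv _ (ltW A0)) subr0 mulrC.
    have -> : 2 * A * S y * A = \int[leb1 R]_(x in X) (2 * A * S y).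
      by rewrite (Rintegral_cst_itv _ (ltW A0)) subr0.
    rewrite /Su -RintegralZl//; last exact: (L2_sq Luy).
    rewrite -RintegralD//; [|by apply: intbleZ => //; exact: (L2_sq Luy)|exact: intble_cst_itv].
    apply: le_Rintegral_ae => //; first exact: intble_cst_itv.
      apply: intbleD => //; last exact: intble_cst_itv.
      by apply: intbleZ => //; exact: (L2_sq Luy).
    apply: filterS hx => x hx Xx; rewrite hx//.
    have := prim_sq_le A0 x Lvy; rewrite -/(S y) /prim2 /=.
    set p := prim A _ x => hp; have := sqr_ge0 (c y + 2 * p); nra.
  move=> h; rewrite -(ler_pM2l A0); apply: le_trans h _.
  by rewrite le_eqVlt; apply/orP; left; apply/eqP; field; rewrite gt_eqF.
exists c, (fun y => c y + J y); split => //.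
- exact: (L2D mY Lc LJ).
- move=> phi phix sphi; have [Lphi Lphix LphiA Lphi0] := xsmooth_L2 sphi.
  have [dphi cphix mphi mphix _] := sphi.
  have Lc2 := L2_snd A Lc; have LphiA2 := L2_snd A LphiA.
  have Lp := L2_prim2 A0 Lv.
  have iuphi := L2M mXY Lu Lphix; have ivphi := L2M mXY Lv Lphi.
  have icphi := L2M mXY Lc2 Lphix; have ipphi := L2M mXY Lp Lphix.
  have ivphiA := L2M mXY Lv LphiA2.
  rewrite RintegralD//.
  have -> : \int[leb2 R]_(z in X `*` Y) (u z * phix z) =
     \int[leb2 R]_(z in X `*` Y) (c z.2 * phix z) +
     \int[leb2 R]_(z in X `*` Y) (prim2 A v z * phix z).
    rewrite -RintegralD//; apply: Rintegral_ae_eq => //.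
    - exact: (intbleP iuphi).
    - exact: (intbleP (intbleD mXY icphi ipphi)).
    by apply: filterS ae_u => z h XYz; rewrite h//; ring.
  rewrite (prim_ibp2 A0 Lv sphi).
  have -> : \int[leb2 R]_(z in X `*` Y) (v z * (phi (A, z.2) - phi z)) =
     \int[leb2 R]_(z in X `*` Y) (v z * phi (A, z.2)) -
     \int[leb2 R]_(z in X `*` Y) (v z * phi z).
    rewrite -RintegralB//.
    by apply: eq_Rintegral => z _; ring.
  rewrite -addrA subrK.
  have -> : \int[leb2 R]_(z in X `*` Y) (c z.2 * phix z) =
     \int[leb1 R]_(y in Y) (c y * (phi (A, y) - phi (0, y))).
    rewrite (Rfubini2 mX mY icphi); apply: Rintegral_ae_eq => //.
    - exact: (intbleP (intble_Rintegral2 mX mY icphi)).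
    - exact: (intbleP (L2M mY Lc (L2B mY LphiA Lphi0))).
    apply: filterS (L2_sections Lphix) => y h Yy /=; rewrite RintegralZl//.
      by congr (_ * _); exact: (FTC_oo A0 (cphix y) (dphi y)).
    by apply: eq_intble (L2M mX (h Yy) (L2_cst_itv 0 A 1)) => // x _; rewrite mulr1.
  have -> : \int[leb2 R]_(z in X `*` Y) (v z * phi (A, z.2)) =
     \int[leb1 R]_(y in Y) (J y * phi (A, y)).
    rewrite (Rfubini2 mX mY ivphiA); apply: Rintegral_ae_eq => //.
    - exact: (intbleP (intble_Rintegral2 mX mY ivphiA)).
    - exact: (intbleP (L2M mY LJ LphiA)).
    apply: filterS (intble_sections2 mX mY L1v) => y h Yy /=; rewrite RintegralZr//.
    exact: h.
  rewrite -RintegralD//; [|exact: (L2M mY Lc (L2B mY LphiA Lphi0))|exact: (L2M mY LJ LphiA)].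
  by apply: eq_Rintegral => y _; ring.
- apply: filterS2 cle aeJ => y hc hJ Yy; rewrite -/(S y) -/(Su y).
  have {}hc := hc Yy; have {}hJ := hJ Yy.
  have k1 : 0 <= A^-1 * Su y by rewrite mulr_ge0// ltW.
  have k2 : 0 <= A * S y by rewrite mulr_ge0// ltW.
  have k3 : 0 <= A^-1 * S y by rewrite mulr_ge0// ltW.
  have k4 : 0 <= A * Su y by rewrite mulr_ge0// ltW.
  have := sqr_ge0 (c y - J y); rewrite /Ktr; split; nra.
- have h1 : {ae leb1 R, forall x, {ae leb1 R, forall y, (X `*` Y) (x, y) ->
     u (x, y) = c y + prim2 A v (x, y)}} := ae_sections1 ae_u.
  apply: filterS2 (intble_sections1 mX mY (L2_sq Lu)) h1 => x iu hx Xx.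
  have Sint : \int[leb1 R]_(y in Y) S y = L2sq v by rewrite /L2sq (Rfubini2 mX mY (L2_sq Lv)).
  have Suint : \int[leb1 R]_(y in Y) Su y = L2sq u by rewrite /L2sq (Rfubini2 mX mY (L2_sq Lu)).
  have -> : Ktr * (L2sq u + L2sq v) = \int[leb1 R]_(y in Y) (Ktr * (Su y + S y)).
    by rewrite RintegralZl// ?RintegralD ?Sint ?Suint//; exact: intbleD.
  apply: le_Rintegral_ae => //; first exact: (iu Xx).
    by apply: intbleZ => //; exact: intbleD.
  apply: filterS3 hx aeS cle => y hxy hS hc Yy; rewrite hxy//.
  have := prim_sq_le A0 x (hS Yy); rewrite -/(S y) /prim2 /=.
  set p := prim A _ x => hp; have {}hc := hc Yy.
  have k1 : 0 <= A^-1 * Su y by rewrite mulr_ge0// ltW.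
  have k2 : 0 <= A * S y by rewrite mulr_ge0// ltW.
  have k3 : 0 <= A^-1 * S y by rewrite mulr_ge0// ltW.
  have k4 : 0 <= A * Su y by rewrite mulr_ge0// ltW.
  have := sqr_ge0 (c y - p); rewrite /Ktr; nra.
Qed.

End traces_of_weakly_differentiable.

(** * Tensor products of test functions *)

Section smooth_two_variables.
Variable R : realType.
Local Notation mR := (measurableTypeR R).
Implicit Types (f g : R -> R) (phi : R * R -> R).

Definition tens f g : R * R -> R := fun z => f z.1 * g z.2.

Lemma pderx_tens f g : smooth1 f -> pderx (tens f g) = tens (derive1 f) g.
Proof.
move=> sf; apply/funext => -[x t]; rewrite /pderx /tens /=.
suff -> : derive1 (fun x => f x * g t) = (fun x => derive1 f x * g t) by [].
apply: derive1_fun => y.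
have h := smooth1_is_derive y sf.
by apply: is_derive_eq; rewrite /GRing.scale /=; ring.
Qed.

Lemma pdert_tens f g : smooth1 g -> pdert (tens f g) = tens f (derive1 g).
Proof.
move=> sg; apply/funext => -[x t]; rewrite /pdert /tens /=.
suff -> : derive1 (fun t => f x * g t) = (fun t => f x * derive1 g t) by [].
apply: derive1_fun => y.
have h := smooth1_is_derive y sg.
by apply: is_derive_eq; rewrite /GRing.scale /=; ring.
Qed.

Lemma smooth1_derive1n n f : smooth1 f -> smooth1 (derive1n n f).
Proof.
elim: n => [|n IH] sf; first exact: sf.
by rewrite derive1nS; apply: smooth1_derive1; exact: IH.
Qed.

Lemma pders_tens s f g : smooth1 f -> smooth1 g ->
  exists i j, pders s (tens f g) = tens (derive1n i f) (derive1n j g).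
Proof.
move=> sf sg; elim: s => [|b s [i [j IH]]]; first by exists 0%N, 0%N.
case: b; [exists i.+1, j|exists i, j.+1]; rewrite derive1nS /= -/(pders s _) IH.
  by rewrite pderx_tens; last exact: smooth1_derive1n.
by rewrite pdert_tens; last exact: smooth1_derive1n.
Qed.

Lemma iter_pder_tens i j f g : smooth1 f -> smooth1 g ->
  iter i (@pderx R) (iter j (@pdert R) (tens f g)) = tens (derive1n i f) (derive1n j g).
Proof.
move=> sf sg; elim: i => [|i IH] /=.
  elim: j => [//|j IH] /=; rewrite IH pdert_tens; first exact: erefl.
  exact: smooth1_derive1n.
by rewrite IH pderx_tens; [exact: erefl|exact: smooth1_derive1n].
Qed.

Lemma continuous_tens f g : continuous f -> continuous g -> continuous (tens f g).
Proof.
move=> cf cg z; apply: cvgM.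
  by apply: (continuous_comp (f := fst)); [exact: cvg_fst|exact: cf].
by apply: (continuous_comp (f := snd)); [exact: cvg_snd|exact: cg].
Qed.

Lemma smooth2_tens f g : smooth1 f -> smooth1 g -> smooth2 (tens f g).
Proof.
move=> sf sg s; have [i [j ->]] := pders_tens s sf sg.
have si := @smooth1_derive1n i _ sf; have sj := @smooth1_derive1n j _ sg.
split.
- by apply: continuous_tens; exact: smooth1_continuous.
- move=> p; rewrite /tens /=; apply: derivableM; last exact: derivable_cst.
  exact: (si 0%N p.1).
- move=> p; rewrite /tens /=; apply: derivableM; first exact: derivable_cst.
  exact: (sj 0%N p.2).
Qed.

Lemma test2_tens (U : set (R * R)) (I J : set R) f g : I `*` J `<=` U ->
  test1 I f -> test1 J g -> test2 U (tens f g).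
Proof.
move=> IJU [sf cf fI] [sg cg gJ].
have h : [set p | tens f g p != 0] `<=` closure [set x | f x != 0] `*` closure [set x | g x != 0].
  move=> [x t] /=; rewrite /tens mulf_eq0 negb_or /= => /andP[fx gt].
  by split; apply: subset_closure.
have cc := compact_setX cf cg.
have h2 : closure [set p | tens f g p != 0] `<=` closure [set x | f x != 0] `*` closure [set x | g x != 0].
  rewrite [X in _ `<=` X](closure_id _).1; first exact: closureS.
  by apply: compact_closed => //; exact: norm_hausdorff.
split; first exact: smooth2_tens.
- by apply: subclosed_compact h2 => //; exact: closed_closure.
- by apply: subset_trans h2 _; apply: subset_trans IJU => -[x t] [/= /fI ? /gJ].
Qed.

Lemma test2_out (U : set (R * R)) phi z : test2 U phi -> ~ U z -> phi z = 0.
Proof.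
move=> [_ _ h] nU; apply/eqP/negPn/negP => fx; apply: nU; apply: h.
exact: subset_closure.
Qed.

Lemma pder_pders i j phi :
  iter i (@pderx R) (iter j (@pdert R) phi) = pders (nseq i true ++ nseq j false) phi.
Proof.
elim: i => [|i IH] /=; last by rewrite IH.
by elim: j => [|j IH] //=; rewrite IH.
Qed.

Lemma smooth2_xsmooth A B phi : smooth2 phi -> xsmooth A B phi (pderx phi).
Proof.
move=> sphi; have [c0 d0 _] := sphi [::]; have [c1 _ _] := sphi [:: true].
have cx y (h : R * R -> R) : continuous h -> continuous (fun x => h (x, y)).
  move=> ch x; apply: (continuous_comp (f := fun x => (x, y))); last exact: ch.
  by apply: (@cvg_pair _ _ _ _ (nbhs x) (nbhs y)); [exact: cvg_id|exact: cvg_cst].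
have cK : compact (`[0, A]%classic `*` `[0, B]%classic).
  by apply: compact_setX; exact: segment_compact.
have [M0 h0] := continuous_bounded_compact cK c0.
have [M1 h1] := continuous_bounded_compact cK c1.
split.
- move=> y x; rewrite /pderx /= derive1E; exact/derivableP/(d0 (x, y)).
- by move=> y; apply: cx.
- exact: continuous_measurable2.
- exact: continuous_measurable2.
exists (Num.max M0 M1) => x y hx hy.
have hxy : (`[0, A]%classic `*` `[0, B]%classic) (x, y) by split; rewrite /= in_itv.
by rewrite !le_max h0// h1// orbT.
Qed.

Lemma smooth2_tsmooth A B phi : smooth2 phi ->
  xsmooth A B (fun z => phi (z.2, z.1)) (fun z => pdert phi (z.2, z.1)).
Proof.
move=> sphi; have [c0 _ d0] := sphi [::]; have [c1 _ _] := sphi [:: false].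
have cx y (h : R * R -> R) : continuous h -> continuous (fun x => h (y, x)).
  move=> ch x; apply: (continuous_comp (f := fun x => (y, x))); last exact: ch.
  by apply: (@cvg_pair _ _ _ _ (nbhs y) (nbhs x)); [exact: cvg_cst|exact: cvg_id].
have csw (h : R * R -> R) : continuous h -> continuous (fun z => h (z.2, z.1)).
  move=> ch z; apply: (continuous_comp (f := fun z => (z.2, z.1))); last exact: ch.
  by apply: (@cvg_pair _ _ _ _ (nbhs z.2) (nbhs z.1)); [exact: cvg_snd|exact: cvg_fst].
have cK : compact (`[0, B]%classic `*` `[0, A]%classic).
  by apply: compact_setX; exact: segment_compact.
have [M0 h0] := continuous_bounded_compact cK c0.
have [M1 h1] := continuous_bounded_compact cK c1.
split.
- move=> y x; rewrite /pdert /= derive1E; exact/derivableP/(d0 (y, x)).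
- by move=> y; apply: cx.
- by apply: continuous_measurable2; exact: csw.
- by apply: continuous_measurable2; exact: csw.
exists (Num.max M0 M1) => x y hx hy.
have hxy : (`[0, B]%classic `*` `[0, A]%classic) (y, x) by split; rewrite /= in_itv.
by rewrite !le_max h0// h1// orbT.
Qed.

End smooth_two_variables.

Section uniqueness.
Variable R : realType.
Local Notation mR := (measurableTypeR R).

(** On each rational box contained in [U] the fundamental lemma applies. *)
Lemma test_uniq2 (U : set (R * R)) (u v : R * R -> R) : open U ->
  intble (leb2 R) U (fun=> 1) -> L2 (leb2 R) U u -> L2 (leb2 R) U v ->
  (forall phi, test2 U phi ->
    \int[leb2 R]_(p in U) (u p * phi p) = \int[leb2 R]_(p in U) (v p * phi p)) ->
  ae_eq (leb2 R) U u v.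
Proof.
move=> oU i1 Lu Lv h; have mU := open_measurable2 oU.
pose w z := u z - v z; have Lw : L2 (leb2 R) U w := L2B mU Lu Lv.
have box i : ratbox i `<=` U -> ae_eq (leb2 R) (ratbox i) w (fun=> 0).
  move=> iU; have mi := @measurable_ratbox R i.
  have L1 : L2 (leb2 R) (ratbox i) (fun=> 1).
    have i1' : intble (leb2 R) (ratbox i) (fun=> 1) := integrableS mU mi iU i1.
    apply: (L2_le mi _ i1'); first exact: measurable_cst.
    by move=> z _; rewrite expr1n.
  have Lwi : L2 (leb2 R) (ratbox i) w.
    apply/L2P; split; first exact: (measurable_funS mU iU (L2_meas Lw)).
    exact: (integrableS mU mi iU (L2_sq Lw)).
  apply: flcv2.
    by apply: eq_intble (L2M mi Lwi L1) => // z _; rewrite mulr1.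
  move=> p q r s m n c1p pq qd1 c2r rs sd2; rewrite -/(ratbox i).
  set f := bmp m p q; set g := bmp n r s.
  have sub (c d e k : R) : c < e -> k < d -> `[e, k] `<=` `]c, d[.
    move=> ce kd x; rewrite /= !in_itv /= => /andP[ex xk].
    by rewrite (lt_le_trans ce)//= (le_lt_trans xk).
  have tf : test1 `]ratr i.1.1, ratr i.1.2[ f by apply: test1_bump; [exact: bmp_eps|exact: sub].
  have tg : test1 `]ratr i.2.1, ratr i.2.2[ g by apply: test1_bump; [exact: bmp_eps|exact: sub].
  have tU : test2 U (tens f g) by apply: test2_tens tf tg.
  have ti : test2 (ratbox i) (tens f g) by apply: test2_tens tf tg.
  have iz z0 : L2 (leb2 R) U z0 -> intble (leb2 R) U (fun p => z0 p * tens f g p).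
    move=> Lz; apply: (L2M mU Lz); apply: (L2_le mU _ i1).
      apply: measurable_funTS; apply: continuous_measurable2.
      by have [/(_ [::])[]] := tU.
    move=> z _; rewrite -[leLHS]real_normK ?num_real// exprn_ile1//.
    by rewrite normrM -[1]mulr1 ler_pM ?bmp_norm_le1.
  transitivity (\int[leb2 R]_(z in U) (w z * tens f g z)).
    rewrite Rintegral_mkcond [RHS]Rintegral_mkcond; apply: eq_Rintegral => z _.
    rewrite !patchE; case: ifPn => [/set_mem zi|/negP zi].
      by rewrite mem_set//; exact: iU.
    case: ifP => // _; rewrite (test2_out ti) ?mulr0// => zi2; apply: zi.
    exact: mem_set.
  rewrite -[RHS](subrr (\int[leb2 R]_(p in U) (v p * tens f g p))) -[X in _ = X - _](h _ tU).
  rewrite -RintegralB//; [|exact: iz|exact: iz].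
  by apply: eq_Rintegral => z _; rewrite /w; ring.
have A : forall i : rat * rat * (rat * rat), {ae leb2 R, forall z, ratbox i `<=` U ->
    ratbox i z -> w z = 0}.
  move=> i; have [iU|niU] := pselect (ratbox i `<=` U); last by apply: aeW.
  by apply: filterS (box i iU) => z hz _ iz; exact: hz.
apply: filterS (ae_forall_count A) => z hz /= Uz.
have [i iU iz] := open_ratbox oU Uz.
by apply/eqP; rewrite -subr_eq0; apply/eqP; exact: (hz i).
Qed.

Lemma test_uniq1 (c d : R) (u v : R -> R) :
  L2 (leb1 R) `]c, d[ u -> L2 (leb1 R) `]c, d[ v ->
  (forall f, test1 `]c, d[ f ->
    \int[leb1 R]_(p in `]c, d[) (u p * f p) = \int[leb1 R]_(p in `]c, d[) (v p * f p)) ->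
  ae_eq (leb1 R) `]c, d[%classic u v.
Proof.
move=> Lu Lv h; have mI : measurable (`]c, d[%classic : set mR) by exact: measurable_itv.
have L1 := L2_cst_itv c d 1; have Lw := L2B mI Lu Lv.
suff hw : ae_eq (leb1 R) `]c, d[%classic (fun x => u x - v x) (fun=> 0).
  by apply: filterS hw => x hx Ix; apply/eqP; rewrite -subr_eq0; apply/eqP/hx.
apply: flcv1; first by apply: eq_intble (L2M mI Lw L1) => // x _; rewrite mulr1.
move=> p q n cp pq qd; rewrite -/(bmp n p q).
have tf : test1 `]c, d[ (@bmp R n p q).
  apply: test1_bump; first exact: bmp_eps.
  move=> x; rewrite /= !in_itv /= => /andP[ex xk].
  by rewrite (lt_le_trans cp)//= (le_lt_trans xk).
have Lb : L2 (leb1 R) `]c, d[ (@bmp R n p q).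
  apply: (L2_le mI _ (intble_cst_itv c d 1)); first exact: measurable_bmp.
  by move=> x _; rewrite -[leLHS]real_normK ?num_real// exprn_ile1 ?bmp_norm_le1.
rewrite -[RHS](subrr (\int[leb1 R]_(x in `]c, d[) (v x * bmp n p q x))).
rewrite -[X in _ = X - _](h _ tf) -RintegralB//; [|exact: (L2M mI Lu Lb)|exact: (L2M mI Lv Lb)].
by apply: eq_Rintegral => x _; ring.
Qed.

End uniqueness.

(** * Weak derivatives on the rectangle *)

Section sobolev_on_rectangle.
Variable R : realType.
Local Notation mR := (measurableTypeR R).
Variable a : R.
Hypothesis a0 : 0 < a.
Let X : set mR := `]0, a[%classic.
Let Y : set mR := `]0, 2 * a[%classic.
Let mX : measurable X. Proof. exact: measurable_itv. Qed.
Let mY : measurable Y. Proof. exact: measurable_itv. Qed.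
Let mXY : measurable (X `*` Y). Proof. exact: measurableX. Qed.
Let T0 : 0 < 2 * a. Proof. by rewrite mulr_gt0. Qed.
Implicit Types (u v w : R * R -> R).

Lemma OmegaE : Omega a = X `*` Y.
Proof.
by apply/seteqP; split => -[x t] /=; rewrite /X /Y /= !in_itv.
Qed.

Lemma open_Omega : open (Omega a).
Proof.
have o1 (c d : R) : open ((fst : R * R -> R) @^-1` `]c, d[).
  by apply: open_comp; [move=> z _; exact: cvg_fst|exact: interval_open].
have o2 (c d : R) : open ((snd : R * R -> R) @^-1` `]c, d[).
  by apply: open_comp; [move=> z _; exact: cvg_snd|exact: interval_open].
rewrite OmegaE (_ : X `*` Y = (fst @^-1` X) `&` (snd @^-1` Y)); first by apply: openI; [exact: o1|exact: o2].
by apply/seteqP; split => -[].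
Qed.

Lemma measurable_Omega : measurable (Omega a : set (mR * mR)).
Proof. by rewrite OmegaE. Qed.
Let mO := measurable_Omega.

Lemma L2_continuous (f : R * R -> R) : continuous f -> L2 (leb2 R) (Omega a) f.
Proof.
move=> cf; rewrite OmegaE.
have cK : compact (`[0, a]%classic `*` `[0, 2 * a]%classic).
  by apply: compact_setX; exact: segment_compact.
have [M hM] := continuous_bounded_compact cK cf.
have i1 := L2_intble (L2_cst_rect a (2 * a) (M ^+ 2)).
apply: (L2_le mXY _ i1).
  by apply: measurable_funTS; exact: continuous_measurable2.
move=> [x t] [Xx Yt]; have h : `|f (x, t)| <= M.
  apply: hM; split => /=.
    by move: Xx; rewrite /X /= !in_itv/= => /andP[? ?]; rewrite !ltW.
  by move: Yt; rewrite /Y /= !in_itv/= => /andP[? ?]; rewrite !ltW.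
rewrite -[leLHS]real_normK ?num_real// lerXn2r ?nnegrE//.
exact: le_trans h.
Qed.

Lemma intble1_Omega : intble (leb2 R) (Omega a) (fun=> 1).
Proof. by rewrite OmegaE; exact: (L2_intble (L2_cst_rect a (2 * a) 1)). Qed.

Lemma test2_continuous (U : set (R * R)) i j phi : test2 U phi ->
  continuous (iter i (@pderx R) (iter j (@pdert R) phi)).
Proof.
by move=> [sphi _ _]; rewrite pder_pders; have [] := sphi (nseq i true ++ nseq j false).
Qed.

Lemma is_wder_uniq (U : set (R * R)) i j u v w : open U ->
  intble (leb2 R) U (fun=> 1) -> is_wder U i j u v -> is_wder U i j u w ->
  ae_eq (leb2 R) U v w.
Proof.
move=> oU i1 [Lv hv] [Lw hw]; apply: test_uniq2 => // phi tphi.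
have s0 : (-1) ^+ (i + j) != 0 :> R by rewrite expf_neq0// oppr_eq0 oner_eq0.
by apply: (mulfI s0); rewrite -(hv _ tphi) -(hw _ tphi).
Qed.

Lemma wderP (U : set (R * R)) i j u v : is_wder U i j u v -> is_wder U i j u (wder U i j u).
Proof. by move=> h; apply: (@xgetPex _ (fun=> 0) [set v | is_wder U i j u v]); exists v. Qed.

Lemma wder_ae (U : set (R * R)) i j u v : open U -> intble (leb2 R) U (fun=> 1) ->
  is_wder U i j u v -> ae_eq (leb2 R) U (wder U i j u) v.
Proof. by move=> oU i1 h; exact: (is_wder_uniq oU i1 (wderP h) h). Qed.

Lemma is_wder_lin i j c u v w z : L2 (leb2 R) (Omega a) u -> L2 (leb2 R) (Omega a) w ->
  is_wder (Omega a) i j u v -> is_wder (Omega a) i j w z ->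
  is_wder (Omega a) i j (fun p => c * u p + w p) (fun p => c * v p + z p).
Proof.
move=> Lu Lw [Lv hv] [Lz hz]; split; first by apply: L2D => //; exact: L2Z.
move=> phi tphi.
have Ld := L2_continuous (@test2_continuous _ i j _ tphi).
have L0 := L2_continuous (@test2_continuous _ 0 0 _ tphi).
have dist (f g h : R * R -> R) : L2 (leb2 R) (Omega a) f -> L2 (leb2 R) (Omega a) g ->
    L2 (leb2 R) (Omega a) h ->
    \int[leb2 R]_(p in Omega a) ((c * f p + g p) * h p) =
    c * \int[leb2 R]_(p in Omega a) (f p * h p) + \int[leb2 R]_(p in Omega a) (g p * h p).
  move=> Lf Lg Lh; have i1 := L2M mO Lf Lh; have i2 := L2M mO Lg Lh.
  rewrite -RintegralZl// -RintegralD//; last exact: intbleZ.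
  by apply: eq_Rintegral => p _; ring.
by rewrite (dist _ _ _ Lu Lw Ld) (dist _ _ _ Lv Lz L0) (hv _ tphi) (hz _ tphi); ring.
Qed.

Lemma is_wder00 u : L2 (leb2 R) (Omega a) u -> is_wder (Omega a) 0 0 u u.
Proof. by move=> Lu; split => // phi tphi; rewrite mul1r. Qed.

(** A test function of a smaller open set is one of the rectangle, and it
    vanishes, together with its derivatives, outside the smaller set. *)
Lemma is_wder_restrict (U : set (R * R)) i j u v : open U -> U `<=` Omega a -> (i + j <= 1)%N ->
  is_wder (Omega a) i j u v -> is_wder U i j u v.
Proof.
move=> oU UO ij [Lv hv]; have mU := open_measurable2 oU.
have Lv' : L2 (leb2 R) U v.
  apply/L2P; split; first exact: (measurable_funS mO UO (L2_meas Lv)).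
  exact: (integrableS mO mU UO (L2_sq Lv)).
split => // phi tphi; have [sphi cphi phiU] := tphi.
have tO : test2 (Omega a) phi by split => //; exact: subset_trans UO.
have out0 z : ~ U z -> phi z = 0 by exact: test2_out.
have nearout z : ~ U z -> \forall y \near z, phi y = 0.
  move=> nU; have : nbhs z (~` closure [set p | phi p != 0]).
    apply: open_nbhs_nbhs; split; last by move=> /phiU.
    by apply: closed_openC; exact: closed_closure.
  apply: filterS => y /= ny; apply/eqP/negPn/negP => fy; apply: ny.
  exact: subset_closure.
have dout z : ~ U z -> iter i (@pderx R) (iter j (@pdert R) phi) z = 0.
  move=> nU; have hz := nearout _ nU; case: z nU hz => x t nU hz.
  have hx : \forall y \near x, phi (y, t) = 0.
    have h : {for x, continuous (fun x : R => (x, t))}.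
      by apply: (@cvg_pair _ _ _ _ (nbhs x) (nbhs t)); [exact: cvg_id|exact: cvg_cst].
    exact: h hz.
  have ht : \forall y \near t, phi (x, y) = 0.
    have h : {for t, continuous (fun t : R => (x, t))}.
      by apply: (@cvg_pair _ _ _ _ (nbhs x) (nbhs t)); [exact: cvg_cst|exact: cvg_id].
    exact: h hz.
  clear hv; move: i j ij => [|[|i']] [|[|j']] // _ /=.
  - exact: out0.
  - exact: derive1_eq0_near ht.
  - exact: derive1_eq0_near hx.
have restr f : (forall z, ~ U z -> f z = 0) ->
    \int[leb2 R]_(p in U) f p = \int[leb2 R]_(p in Omega a) f p.
  move=> f0; rewrite Rintegral_mkcond [RHS]Rintegral_mkcond; apply: eq_Rintegral => z _.
  rewrite !patchE; case: ifPn => [/set_mem zU|/negP zU].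
    by rewrite mem_set//; exact: UO.
  by case: ifP => // _; rewrite f0// => zU2; apply: zU; exact: mem_set.
rewrite !restr; last 2 first.
- by move=> z nU; rewrite out0// mulr0.
- by move=> z nU; rewrite dout// mulr0.
exact: hv.
Qed.

Lemma is_wder_tens i j u v f g : is_wder (Omega a) i j u v -> test1 X f -> test1 Y g ->
  \int[leb2 R]_(p in Omega a) (u p * (derive1n i f p.1 * derive1n j g p.2)) =
  (-1) ^+ (i + j) * \int[leb2 R]_(p in Omega a) (v p * (f p.1 * g p.2)).
Proof.
move=> [_ hv] tf tg; have [sf _ _] := tf; have [sg _ _] := tg.
have tt : test2 (Omega a) (tens f g) by apply: test2_tens tf tg; rewrite OmegaE.
by rewrite -(hv _ tt) iter_pder_tens.
Qed.

(** [v] is the weak derivative of [u] in the direction [x], in the form that the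
    one-directional theory uses; [Wt] is the same for [t], with the coordinates
    exchanged. *)
Definition Wx u v := [/\ L2 (leb2 R) (Omega a) u, L2 (leb2 R) (Omega a) v &
  xweak a (2 * a) u v].

Definition Wt u v := [/\ L2 (leb2 R) (Omega a) u, L2 (leb2 R) (Omega a) v &
  xweak (2 * a) a (fun z => u (z.2, z.1)) (fun z => v (z.2, z.1))].

Lemma derive1n_derive1 n (f : R -> R) : derive1n n (derive1 f) = derive1n n.+1 f.
Proof. by rewrite /derive1n iterSr. Qed.

(** Testing with the derivative of a tensor product raises the order in [x] by one. *)
Lemma Wx_step i j q v w : is_wder (Omega a) i j q v -> is_wder (Omega a) i.+1 j q w -> Wx v w.
Proof.
move=> hv hw; split; [exact: hv.1|exact: hw.1|].
move=> F G tF tG; rewrite -/X -/Y -OmegaE.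
have s0 : (-1) ^+ (i + j) != 0 :> R by rewrite expf_neq0// oppr_eq0 oner_eq0.
apply: (mulfI s0); rewrite -(is_wder_tens hv (test1_derive1 tF) tG) derive1n_derive1.
by rewrite (is_wder_tens hw tF tG) addSn exprS; ring.
Qed.

Lemma xweak_swap (A B : R) u v : 0 < A -> 0 < B ->
  L2 (leb2 R) (`]0, A[ `*` `]0, B[) u -> L2 (leb2 R) (`]0, A[ `*` `]0, B[) v ->
  (forall F G, test1 `]0, A[ F -> test1 `]0, B[ G ->
    \int[leb2 R]_(z in `]0, A[ `*` `]0, B[) (u z * (F z.1 * derive1 G z.2)) =
    - (\int[leb2 R]_(z in `]0, A[ `*` `]0, B[) (v z * (F z.1 * G z.2)))) ->
  xweak B A (fun z => u (z.2, z.1)) (fun z => v (z.2, z.1)).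
Proof.
move=> A0 B0 Lu Lv h F G tF tG.
have mA : measurable (`]0, A[%classic : set mR) by exact: measurable_itv.
have mB : measurable (`]0, B[%classic : set mR) by exact: measurable_itv.
have mm w f g : L2 (leb2 R) (`]0, A[ `*` `]0, B[) w -> smooth1 f -> smooth1 g ->
    measurable_fun (`]0, A[ `*` `]0, B[ : set (mR * mR)) (fun z => w z * (f z.1 * g z.2)).
  move=> Lw sf sg; apply: measurable_funM; first exact: (L2_meas Lw).
  apply: measurable_funTS; apply: (@continuous_measurable2 R (tens f g)).
  by apply: continuous_tens; exact: smooth1_continuous.
have [sF _ _] := tF; have [sG _ _] := tG.
have e1 := Rintegral_swap mA mB (mm _ _ _ Lu sG (smooth1_derive1 sF)).
have e2 := Rintegral_swap mA mB (mm _ _ _ Lv sG sF).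
transitivity (\int[leb2 R]_(z in `]0, A[ `*` `]0, B[) (u z * (G z.1 * derive1 F z.2))).
  rewrite -[RHS]e1; apply: eq_Rintegral => z _ /=; ring.
rewrite (h _ _ tG tF); congr (- _); rewrite -[LHS]e2.
by apply: eq_Rintegral => z _ /=; ring.
Qed.

Lemma Wt_step i j q v w : is_wder (Omega a) i j q v -> is_wder (Omega a) i j.+1 q w -> Wt v w.
Proof.
move=> hv hw; split; [exact: hv.1|exact: hw.1|].
apply: xweak_swap => //; [by have := hv.1; rewrite OmegaE|by have := hw.1; rewrite OmegaE|].
move=> F G tF tG; rewrite -/X -/Y -OmegaE.
have s0 : (-1) ^+ (i + j) != 0 :> R by rewrite expf_neq0// oppr_eq0 oner_eq0.
apply: (mulfI s0); rewrite -(is_wder_tens hv tF (test1_derive1 tG)) derive1n_derive1.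
by rewrite (is_wder_tens hw tF tG) addnS exprS; ring.
Qed.

Lemma L2_swap (A B : R) u : L2 (leb2 R) (`]0, A[ `*` `]0, B[) u ->
  L2 (leb2 R) (`]0, B[ `*` `]0, A[) (fun z => u (z.2, z.1)).
Proof.
move=> Lu; have mA : measurable (`]0, A[%classic : set mR) by exact: measurable_itv.
have mB : measurable (`]0, B[%classic : set mR) by exact: measurable_itv.
apply/L2P; split; first exact: (measurable_fun_swap mA mB (L2_meas Lu)).
exact: (intble_swap mA mB (L2_sq Lu)).
Qed.

End sobolev_on_rectangle.

(** * Traces on the sides of the rectangle *)

Section traces_on_rectangle.
Variable R : realType.
Local Notation mR := (measurableTypeR R).
Variable a : R.
Hypothesis a0 : 0 < a.
Let X : set mR := `]0, a[%classic.
Let Y : set mR := `]0, 2 * a[%classic.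
Let mX : measurable X. Proof. exact: measurable_itv. Qed.
Let mY : measurable Y. Proof. exact: measurable_itv. Qed.
Let mXY : measurable (X `*` Y). Proof. exact: measurableX. Qed.
Let T0 : 0 < 2 * a. Proof. by rewrite mulr_gt0. Qed.
Let mO := @measurable_Omega R a.
Implicit Types (u v w : R * R -> R).

Lemma smooth1_affine (b c : R) : smooth1 (fun x => b * x + c).
Proof. by apply/smooth1P => n; exact: smoothn_id. Qed.

Lemma test1_L2 (c d : R) (h : R -> R) : test1 `]c, d[ h -> L2 (leb1 R) `]c, d[ h.
Proof.
move=> [sh _ _]; have ch := smooth1_continuous sh.
have [M hM] := continuous_bounded_compact (@segment_compact R c d) ch.
have mI : measurable (`]c, d[%classic : set mR) by exact: measurable_itv.
apply: (L2_le mI _ (intble_cst_itv c d (M ^+ 2))).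
  by apply: measurable_funTS; exact: continuous_measurable_fun.
move=> x; rewrite /= in_itv/= => /andP[cx xd].
have h1 : `|h x| <= M by apply: hM; rewrite /= in_itv /= !ltW.
rewrite -[leLHS]real_normK ?num_real// lerXn2r ?nnegrE//.
exact: le_trans h1.
Qed.

(** The pairing with all combinations of the two end values separates the two
    traces. *)
Lemma trace_pair_uniq (A : R) (g g' : (R -> R) * (R -> R)) :
  L2 (leb1 R) `]0, A[ g.1 -> L2 (leb1 R) `]0, A[ g.2 ->
  L2 (leb1 R) `]0, A[ g'.1 -> L2 (leb1 R) `]0, A[ g'.2 ->
  (forall (e1 e2 : R) h, test1 `]0, A[ h ->
    \int[leb1 R]_(t in `]0, A[) (e2 * (g.2 t * h t) - e1 * (g.1 t * h t)) =
    \int[leb1 R]_(t in `]0, A[) (e2 * (g'.2 t * h t) - e1 * (g'.1 t * h t))) ->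
  ae_eq (leb1 R) `]0, A[%classic g.1 g'.1 /\ ae_eq (leb1 R) `]0, A[%classic g.2 g'.2.
Proof.
move=> L1 L2' L1' L2'' key; split; apply: test_uniq1 => // h th.
- have e := key (-1) 0 h th.
  transitivity (\int[leb1 R]_(t in `]0, A[) (0 * (g.2 t * h t) - -1 * (g.1 t * h t))).
    by apply: eq_Rintegral => t _; ring.
  by rewrite e; apply: eq_Rintegral => t _; ring.
- have e := key 0 1 h th.
  transitivity (\int[leb1 R]_(t in `]0, A[) (1 * (g.2 t * h t) - 0 * (g.1 t * h t))).
    by apply: eq_Rintegral => t _; ring.
  by rewrite e; apply: eq_Rintegral => t _; ring.
Qed.

Lemma affine_ends (A e1 e2 : R) : 0 < A -> exists f : R -> R,
  [/\ smooth1 f, f 0 = e1 & f A = e2].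
Proof.
move=> A0; exists (fun x => (e2 - e1) / A * x + e1); split.
- exact: smooth1_affine.
- by rewrite mulr0 add0r.
- by rewrite divfK ?subrK// gt_eqF.
Qed.

(** Green's formula is bilinear, so a linear combination of traces is the trace of
    the linear combination. *)
Lemma green_lin (I : set mR) c (u w z du dw dz phi dphi : R * R -> R)
    (gu gw : (R -> R) * (R -> R)) (b0 b1 : R -> R) : measurable I ->
  [/\ L2 (leb2 R) (Omega a) u, L2 (leb2 R) (Omega a) w & L2 (leb2 R) (Omega a) z] ->
  [/\ L2 (leb2 R) (Omega a) du, L2 (leb2 R) (Omega a) dw & L2 (leb2 R) (Omega a) dz] ->
  L2 (leb2 R) (Omega a) phi -> L2 (leb2 R) (Omega a) dphi ->
  L2 (leb1 R) I b0 -> L2 (leb1 R) I b1 ->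
  L2 (leb1 R) I gu.1 -> L2 (leb1 R) I gu.2 -> L2 (leb1 R) I gw.1 -> L2 (leb1 R) I gw.2 ->
  ae_eq (leb2 R) (Omega a) z (fun p => c * u p + w p) ->
  ae_eq (leb2 R) (Omega a) dz (fun p => c * du p + dw p) ->
  \int[leb2 R]_(p in Omega a) (u p * dphi p + du p * phi p) =
    \int[leb1 R]_(t in I) (gu.2 t * b1 t - gu.1 t * b0 t) ->
  \int[leb2 R]_(p in Omega a) (w p * dphi p + dw p * phi p) =
    \int[leb1 R]_(t in I) (gw.2 t * b1 t - gw.1 t * b0 t) ->
  \int[leb2 R]_(p in Omega a) (z p * dphi p + dz p * phi p) =
    \int[leb1 R]_(t in I) ((c * gu.2 t + gw.2 t) * b1 t - (c * gu.1 t + gw.1 t) * b0 t).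
Proof.
move=> mI [Lu Lw Lz] [Ldu Ldw Ldz] Lphi Ldphi L0 L1 Lu1 Lu2 Lw1 Lw2 ez edz Gu Gw.
have iu := intbleD mO (L2M mO Lu Ldphi) (L2M mO Ldu Lphi).
have iw := intbleD mO (L2M mO Lw Ldphi) (L2M mO Ldw Lphi).
have ju := intbleB mI (L2M mI Lu2 L1) (L2M mI Lu1 L0).
have jw := intbleB mI (L2M mI Lw2 L1) (L2M mI Lw1 L0).
transitivity (c * \int[leb2 R]_(p in Omega a) (u p * dphi p + du p * phi p)
  + \int[leb2 R]_(p in Omega a) (w p * dphi p + dw p * phi p)).
  rewrite -(RintegralZl _ mO iu) -(RintegralD mO (intbleZ mO c iu) iw).
  apply: (Rintegral_ae_eq mO).
  - exact: (intbleP (intbleD mO (L2M mO Lz Ldphi) (L2M mO Ldz Lphi))).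
  - exact: (intbleP (intbleD mO (intbleZ mO c iu) iw)).
  by apply: filterS2 ez edz => p h1 h2 Op; rewrite h1// h2//; ring.
rewrite Gu Gw -(RintegralZl _ mI ju) -(RintegralD mI (intbleZ mI c ju) jw).
by apply: eq_Rintegral => t _; ring.
Qed.

(** Tested against compactly supported functions, Green's formula says that [v]
    is a weak derivative of [u]; hence it also holds with [wder] instead of [v]. *)
Lemma green_wder i j u v (bd : (R * R -> R) -> R) : (i + j = 1)%N ->
  L2 (leb2 R) (Omega a) u -> L2 (leb2 R) (Omega a) v ->
  (forall phi, smooth2 phi -> \int[leb2 R]_(p in Omega a)
     (u p * iter i (@pderx R) (iter j (@pdert R) phi) p + v p * phi p) = bd phi) ->
  (forall phi, test2 (Omega a) phi -> bd phi = 0) ->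
  is_wder (Omega a) i j u v /\
  forall phi, smooth2 phi -> \int[leb2 R]_(p in Omega a)
    (u p * iter i (@pderx R) (iter j (@pdert R) phi) p + wder (Omega a) i j u p * phi p) = bd phi.
Proof.
move=> ij Lu Lv gr bd0.
have Ls phi k l : smooth2 phi ->
    L2 (leb2 R) (Omega a) (iter k (@pderx R) (iter l (@pdert R) phi)).
  by move=> sphi; rewrite pder_pders; have [c _ _] := sphi (nseq k true ++ nseq l false);
    exact: (L2_continuous a c).
have hw : is_wder (Omega a) i j u v.
  split=> // phi tphi; have [sphi _ _] := tphi; have := gr _ sphi; rewrite (bd0 _ tphi).
  rewrite (RintegralD mO (L2M mO Lu (Ls phi i j sphi)) (L2M mO Lv (Ls phi 0%N 0%N sphi))).
  by move=> /eqP; rewrite addr_eq0 => /eqP ->; rewrite ij expr1 mulN1r.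
split=> // phi sphi; rewrite -(gr _ sphi).
have i1 := L2M mO Lu (Ls phi i j sphi); have Lphi := Ls phi 0%N 0%N sphi.
apply: (Rintegral_ae_eq mO).
- exact: (intbleP (intbleD mO i1 (L2M mO (wderP hw).1 Lphi))).
- exact: (intbleP (intbleD mO i1 (L2M mO Lv Lphi))).
apply: filterS (wder_ae (@open_Omega R a) (@intble1_Omega R a) hw) => z h Oz.
by rewrite (h Oz).
Qed.

Lemma xtraces_uniq u g g' : is_xtraces a u g -> is_xtraces a u g' ->
  ae_eq (leb1 R) Y g.1 g'.1 /\ ae_eq (leb1 R) Y g.2 g'.2.
Proof.
move=> [L1 L2' hg] [L1' L2'' hg']; apply: trace_pair_uniq => // e1 e2 h [sh _ _].
have [f [sf f0 fa]] := affine_ends e1 e2 a0; have s2 := smooth2_tens sf sh.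
have E := etrans (esym (hg _ s2)) (hg' _ s2).
have tE (k : (R -> R) * (R -> R)) :
    \int[leb1 R]_(t in It a) (k.2 t * tens f h (a, t) - k.1 t * tens f h (0, t)) =
    \int[leb1 R]_(t in It a) (e2 * (k.2 t * h t) - e1 * (k.1 t * h t)).
  by apply: eq_Rintegral => t _; rewrite /tens /= fa f0; ring.
by rewrite -/(It a) -!tE.
Qed.

Lemma xtraces_spec u v : Wx a u v ->
  [/\ is_wder (Omega a) 1 0 u v, is_xtraces a u (xtraces a u),
      {ae leb1 R, forall t, Y t ->
        (xtraces a u).1 t ^+ 2 <= Ktr (a) * (\int[leb1 R]_(x in X) (u (x, t) ^+ 2) + \int[leb1 R]_(x in X) (v (x, t) ^+ 2)) /\
        (xtraces a u).2 t ^+ 2 <= Ktr (a) * (\int[leb1 R]_(x in X) (u (x, t) ^+ 2) + \int[leb1 R]_(x in X) (v (x, t) ^+ 2))} &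
      {ae leb1 R, forall x, X x -> \int[leb1 R]_(t in Y) (u (x, t) ^+ 2) <=
        Ktr (a) * (\int[leb2 R]_(z in Omega a) (u z ^+ 2) + \int[leb2 R]_(z in Omega a) (v z ^+ 2))}].
Proof.
move=> [Lu Lv uv].
have Lu' := Lu; have Lv' := Lv; rewrite OmegaE in Lu' Lv'.
have [g1 [g2 [Lg1 Lg2 gr bd B1]]] := xtrace a0 Lu' Lv' uv.
have gr' phi : smooth2 phi -> \int[leb2 R]_(p in Omega a) (u p * pderx phi p + v p * phi p) =
    \int[leb1 R]_(t in Y) (g2 t * phi (a, t) - g1 t * phi (0, t)).
  by move=> sphi; rewrite OmegaE; exact: (gr _ _ (smooth2_xsmooth _ _ sphi)).
have [|hw gw] := @green_wder 1 0 u v (fun phi => \int[leb1 R]_(t in Y) (g2 t * phi (a, t) - g1 t * phi (0, t))) erefl Lu Lv gr'.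
  move=> phi tphi; rewrite (_ : Rintegral _ _ _ = \int[leb1 R]_(t in Y) 0).
    by rewrite Rintegral_cst// mul0r.
  apply: eq_Rintegral => t _; rewrite !(test2_out tphi) ?mulr0 ?subrr// OmegaE => -[/=];
    rewrite /X /Y /= !in_itv /= ?ltxx ?andbF//.
have tg : is_xtraces a u (g1, g2) by [].
have tt : is_xtraces a u (xtraces a u).
  by apply: (@xgetPex _ (fun=> 0, fun=> 0) [set g | is_xtraces a u g]); exists (g1, g2).
have [e1 e2] := xtraces_uniq tt tg.
split; [exact: hw|exact: tt| |].
- by apply: filterS3 e1 e2 bd => t h1 h2 h3 Yt; rewrite h1// h2//; exact: h3.
- apply: filterS B1 => x h Xx; apply: le_trans (h Xx) _.
  by rewrite /L2sq OmegaE.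
Qed.

Lemma xtraces_lin c u u' w w' z z' : Wx a u u' -> Wx a w w' -> Wx a z z' ->
  ae_eq (leb2 R) (Omega a) z (fun p => c * u p + w p) ->
  ae_eq (leb2 R) (Omega a) z' (fun p => c * u' p + w' p) ->
  ae_eq (leb1 R) Y (xtraces a z).1 (fun t => c * (xtraces a u).1 t + (xtraces a w).1 t) /\
  ae_eq (leb1 R) Y (xtraces a z).2 (fun t => c * (xtraces a u).2 t + (xtraces a w).2 t).
Proof.
move=> Wu Ww Wz ez ez'.
have [hu tu _ _] := xtraces_spec Wu; have [hw tw _ _] := xtraces_spec Ww.
have [hz tz _ _] := xtraces_spec Wz.
have [Lu _ _] := Wu; have [Lw _ _] := Ww; have [Lz _ _] := Wz.
have eu := wder_ae (@open_Omega R a) (@intble1_Omega R a) hu.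
have ew := wder_ae (@open_Omega R a) (@intble1_Omega R a) hw.
have edz := wder_ae (@open_Omega R a) (@intble1_Omega R a) hz.
move: (xtraces a u) (xtraces a w) tu tw => gu gw [Lu1 Lu2 Gu] [Lw1 Lw2 Gw].
suff h : is_xtraces a z (fun t => c * gu.1 t + gw.1 t, fun t => c * gu.2 t + gw.2 t).
  exact: (xtraces_uniq tz h).
split => /=; [exact: (L2D mY (L2Z mY c Lu1) Lw1)|exact: (L2D mY (L2Z mY c Lu2) Lw2)|].
move=> phi sphi; have [c0 _ _] := sphi [::]; have [c1 _ _] := sphi [:: true].
have [_ _ LA L0] := xsmooth_L2 a0 (smooth2_xsmooth a (2 * a) sphi).
have ee : ae_eq (leb2 R) (Omega a) (wder (Omega a) 1 0 z)
    (fun p => c * wder (Omega a) 1 0 u p + wder (Omega a) 1 0 w p).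
  apply: filterS2 (filterI ez' edz) (filterI eu ew) => p [h1 h2] [h3 h4] Op.
  by rewrite (h2 Op) (h1 Op) (h3 Op) (h4 Op).
exact: (green_lin mY (And3 Lu Lw Lz) (And3 (wderP hu).1 (wderP hw).1 (wderP hz).1)
  (L2_continuous a c0) (L2_continuous a c1) L0 LA Lu1 Lu2 Lw1 Lw2 ez ee (Gu _ sphi) (Gw _ sphi)).
Qed.

Lemma ttraces_uniq u g g' : is_ttraces a u g -> is_ttraces a u g' ->
  ae_eq (leb1 R) X g.1 g'.1 /\ ae_eq (leb1 R) X g.2 g'.2.
Proof.
move=> [L1 L2' hg] [L1' L2'' hg']; apply: trace_pair_uniq => // e1 e2 h [sh _ _].
have [f [sf f0 fT]] := affine_ends e1 e2 T0; have s2 := smooth2_tens sh sf.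
have E := etrans (esym (hg _ s2)) (hg' _ s2).
have tE (k : (R -> R) * (R -> R)) :
    \int[leb1 R]_(x in Ix a) (k.2 x * tens h f (x, 2 * a) - k.1 x * tens h f (x, 0)) =
    \int[leb1 R]_(x in Ix a) (e2 * (k.2 x * h x) - e1 * (k.1 x * h x)).
  by apply: eq_Rintegral => t _; rewrite /tens /= fT f0; ring.
by rewrite -/(Ix a) -!tE.
Qed.

Lemma ttraces_spec u v : Wt a u v ->
  [/\ is_wder (Omega a) 0 1 u v, is_ttraces a u (ttraces a u),
      {ae leb1 R, forall t, X t ->
        (ttraces a u).1 t ^+ 2 <= Ktr (2 * a) * (\int[leb1 R]_(x in Y) (u (t, x) ^+ 2) + \int[leb1 R]_(x in Y) (v (t, x) ^+ 2)) /\
        (ttraces a u).2 t ^+ 2 <= Ktr (2 * a) * (\int[leb1 R]_(x in Y) (u (t, x) ^+ 2) + \int[leb1 R]_(x in Y) (v (t, x) ^+ 2))} &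
      {ae leb1 R, forall x, Y x -> \int[leb1 R]_(t in X) (u (t, x) ^+ 2) <=
        Ktr (2 * a) * (\int[leb2 R]_(z in Omega a) (u z ^+ 2) + \int[leb2 R]_(z in Omega a) (v z ^+ 2))}].
Proof.
move=> [Lu Lv uv].
have Lu' := Lu; have Lv' := Lv; rewrite OmegaE in Lu' Lv'.
have [g1 [g2 [Lg1 Lg2 gr bd B1]]] := xtrace T0 (L2_swap Lu') (L2_swap Lv') uv.
have gr' phi : smooth2 phi -> \int[leb2 R]_(p in Omega a) (u p * pdert phi p + v p * phi p) =
    \int[leb1 R]_(t in X) (g2 t * phi (t, 2 * a) - g1 t * phi (t, 0)).
  move=> sphi; rewrite OmegaE.
  have Lphi : L2 (leb2 R) (X `*` Y) phi.
    by rewrite -OmegaE; have [cphi _ _] := sphi [::]; exact: (L2_continuous a cphi).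
  have Lphid : L2 (leb2 R) (X `*` Y) (pdert phi).
    by rewrite -OmegaE; have [cphi _ _] := sphi [:: false]; exact: (L2_continuous a cphi).
  have := gr _ _ (smooth2_tsmooth _ _ sphi); rewrite /= => <-.
  rewrite -(Rintegral_swap mX mY)//.
  exact: (intbleP (intbleD mXY (L2M mXY Lu' Lphid) (L2M mXY Lv' Lphi))).
have [|hw gw] := @green_wder 0 1 u v (fun phi => \int[leb1 R]_(t in X) (g2 t * phi (t, 2 * a) - g1 t * phi (t, 0))) erefl Lu Lv gr'.
  move=> phi tphi; rewrite (_ : Rintegral _ _ _ = \int[leb1 R]_(t in X) 0).
    by rewrite Rintegral_cst// mul0r.
  apply: eq_Rintegral => t _; rewrite !(test2_out tphi) ?mulr0 ?subrr// OmegaE => -[/=];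
    rewrite /X /Y /= !in_itv /= ?ltxx ?andbF//.
have tg : is_ttraces a u (g1, g2) by [].
have tt : is_ttraces a u (ttraces a u).
  by apply: (@xgetPex _ (fun=> 0, fun=> 0) [set g | is_ttraces a u g]); exists (g1, g2).
have [e1 e2] := ttraces_uniq tt tg.
split; [exact: hw|exact: tt| |].
- by apply: filterS3 e1 e2 bd => t h1 h2 h3 Yt; rewrite h1// h2//; exact: h3.
- apply: filterS B1 => x h Xx; apply: le_trans (h Xx) _.
  rewrite /L2sq OmegaE -(Rintegral_swap mX mY (intbleP (L2_sq Lu'))).
  by rewrite -(Rintegral_swap mX mY (intbleP (L2_sq Lv'))).
Qed.

Lemma ttraces_lin c u u' w w' z z' : Wt a u u' -> Wt a w w' -> Wt a z z' ->
  ae_eq (leb2 R) (Omega a) z (fun p => c * u p + w p) ->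
  ae_eq (leb2 R) (Omega a) z' (fun p => c * u' p + w' p) ->
  ae_eq (leb1 R) X (ttraces a z).1 (fun t => c * (ttraces a u).1 t + (ttraces a w).1 t) /\
  ae_eq (leb1 R) X (ttraces a z).2 (fun t => c * (ttraces a u).2 t + (ttraces a w).2 t).
Proof.
move=> Wu Ww Wz ez ez'.
have [hu tu _ _] := ttraces_spec Wu; have [hw tw _ _] := ttraces_spec Ww.
have [hz tz _ _] := ttraces_spec Wz.
have [Lu _ _] := Wu; have [Lw _ _] := Ww; have [Lz _ _] := Wz.
have eu := wder_ae (@open_Omega R a) (@intble1_Omega R a) hu.
have ew := wder_ae (@open_Omega R a) (@intble1_Omega R a) hw.
have edz := wder_ae (@open_Omega R a) (@intble1_Omega R a) hz.
move: (ttraces a u) (ttraces a w) tu tw => gu gw [Lu1 Lu2 Gu] [Lw1 Lw2 Gw].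
suff h : is_ttraces a z (fun t => c * gu.1 t + gw.1 t, fun t => c * gu.2 t + gw.2 t).
  exact: (ttraces_uniq tz h).
split => /=; [exact: (L2D mX (L2Z mX c Lu1) Lw1)|exact: (L2D mX (L2Z mX c Lu2) Lw2)|].
move=> phi sphi; have [c0 _ _] := sphi [::]; have [c1 _ _] := sphi [:: false].
have [_ _ LA L0] := xsmooth_L2 T0 (smooth2_tsmooth (2 * a) a sphi).
have ee : ae_eq (leb2 R) (Omega a) (wder (Omega a) 0 1 z)
    (fun p => c * wder (Omega a) 0 1 u p + wder (Omega a) 0 1 w p).
  apply: filterS2 (filterI ez' edz) (filterI eu ew) => p [h1 h2] [h3 h4] Op.
  by rewrite (h2 Op) (h1 Op) (h3 Op) (h4 Op).
exact: (green_lin mX (And3 Lu Lw Lz) (And3 (wderP hu).1 (wderP hw).1 (wderP hz).1)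
  (L2_continuous a c0) (L2_continuous a c1) L0 LA Lu1 Lu2 Lw1 Lw2 ez ee (Gu _ sphi) (Gw _ sphi)).
Qed.

End traces_on_rectangle.

(** * The space H^4 and its traces *)

Section H4_functions.
Variable R : realType.
Local Notation mR := (measurableTypeR R).
Variable a : R.
Hypothesis a0 : 0 < a.
Let X : set mR := `]0, a[%classic.
Let Y : set mR := `]0, 2 * a[%classic.
Let mX : measurable X. Proof. exact: measurable_itv. Qed.
Let mY : measurable Y. Proof. exact: measurable_itv. Qed.
Let mXY : measurable (X `*` Y). Proof. exact: measurableX. Qed.
Let T0 : 0 < 2 * a. Proof. by rewrite mulr_gt0. Qed.
Let mO := @measurable_Omega R a.
Let oO := @open_Omega R a.
Let i1O := @intble1_Omega R a.
Implicit Types (u v w q h : R * R -> R).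
Local Notation D i j q := (wder (Omega a) i j q).
Local Notation N q := (hnorm (Omega a) 4 q).
Local Notation sq u := (\int[leb2 R]_(z in Omega a) (u z ^+ 2)).

Lemma sq_ge0 u : 0 <= sq u.
Proof. by apply: Rintegral_ge0 => z _; exact: sqr_ge0. Qed.

Lemma H4_wder q i j : H4 a q -> (i + j <= 4)%N -> is_wder (Omega a) i j q (D i j q).
Proof. by move=> [_ h] /h[v hv]; exact: wderP hv. Qed.

Lemma H4_L2 q i j : H4 a q -> (i + j <= 4)%N -> L2 (leb2 R) (Omega a) (D i j q).
Proof. by move=> hq ij; have [] := H4_wder hq ij. Qed.

Lemma H4_L2q q : H4 a q -> L2 (leb2 R) (Omega a) q.
Proof. by case. Qed.

Lemma H4_lin c u w : H4 a u -> H4 a w -> H4 a (fun p => c * u p + w p).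
Proof.
move=> hu hw; split; first exact: (L2D mO (L2Z mO c (H4_L2q hu)) (H4_L2q hw)).
move=> i j ij; exists (fun p => c * D i j u p + D i j w p).
by apply: is_wder_lin; [exact: H4_L2q|exact: H4_L2q|exact: H4_wder|exact: H4_wder].
Qed.

Lemma D_lin c u w i j : H4 a u -> H4 a w -> (i + j <= 4)%N ->
  ae_eq (leb2 R) (Omega a) (D i j (fun p => c * u p + w p)) (fun p => c * D i j u p + D i j w p).
Proof.
move=> hu hw ij; apply: wder_ae => //.
by apply: is_wder_lin; [exact: H4_L2q|exact: H4_L2q|exact: H4_wder|exact: H4_wder].
Qed.

Lemma D00 q : L2 (leb2 R) (Omega a) q -> ae_eq (leb2 R) (Omega a) (D 0 0 q) q.
Proof. by move=> Lq; apply: wder_ae => //; exact: is_wder00. Qed.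

Lemma hinner_sym u v : hinner (Omega a) 4 u v = hinner (Omega a) 4 v u.
Proof.
rewrite /hinner; apply: eq_bigr => i _; apply: eq_bigr => j _.
by apply: eq_Rintegral => z _; rewrite mulrC.
Qed.

Lemma hinner_lin c u w h : H4 a u -> H4 a w -> H4 a h ->
  hinner (Omega a) 4 (fun p => c * u p + w p) h =
  c * hinner (Omega a) 4 u h + hinner (Omega a) 4 w h.
Proof.
move=> hu hw hh; rewrite /hinner mulr_sumr -big_split /=; apply: eq_bigr => i _.
rewrite mulr_sumr -big_split /=; apply: eq_bigr => j ij.
have i1 := L2M mO (H4_L2 hu ij) (H4_L2 hh ij).
have i2 := L2M mO (H4_L2 hw ij) (H4_L2 hh ij).
rewrite -(RintegralZl _ mO i1) -(RintegralD mO (intbleZ mO c i1) i2).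
apply: (Rintegral_ae_eq mO).
- exact: (intbleP (L2M mO (H4_L2 (H4_lin c hu hw) ij) (H4_L2 hh ij))).
- exact: (intbleP (intbleD mO (intbleZ mO c i1) i2)).
by apply: filterS (D_lin c hu hw ij) => z e Oz; rewrite e//; ring.
Qed.

Lemma hinner_ge0 u : 0 <= hinner (Omega a) 4 u u.
Proof.
apply: sumr_ge0 => i _; apply: sumr_ge0 => j _; apply: Rintegral_ge0 => z _.
by rewrite -expr2 sqr_ge0.
Qed.

Lemma hnorm_sq u : N u ^+ 2 = hinner (Omega a) 4 u u.
Proof. by rewrite /hnorm sqr_sqrtr// hinner_ge0. Qed.

Lemma hnorm_ge0 u : 0 <= N u.
Proof. exact: sqrtr_ge0. Qed.

(** Keep one term of the sum of squares that defines the norm. *)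
Lemma D_le q i j : (i + j <= 4)%N -> sq (D i j q) <= N q ^+ 2.
Proof.
move=> ij; rewrite hnorm_sq /hinner.
have hi : (i < 5)%N by rewrite ltnS (leq_trans _ ij)// leq_addr.
have hj : (j < 5)%N by rewrite ltnS (leq_trans _ ij)// leq_addl.
have pos (i' j' : nat) : 0 <= \int[leb2 R]_(p in Omega a) (D i' j' q p * D i' j' q p).
  by apply: Rintegral_ge0 => z _; rewrite -expr2 sqr_ge0.
rewrite (bigD1 (Ordinal hi))//= (bigD1 (Ordinal hj))//=.
rewrite (_ : sq (D i j q) = \int[leb2 R]_(p in Omega a) (D i j q p * D i j q p)); last first.
  by apply: eq_Rintegral => z _; rewrite expr2.
rewrite -addrA lerDl addr_ge0// ?sumr_ge0//.
by move=> k _; apply: sumr_ge0.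
Qed.

Lemma q_le q : H4 a q -> sq q <= N q ^+ 2.
Proof.
move=> hq; apply: le_trans (@D_le q 0 0 _) => //.
rewrite le_eqVlt; apply/orP; left; apply/eqP; apply: (Rintegral_ae_eq mO).
- exact: (intbleP (L2_sq (H4_L2q hq))).
- exact: (intbleP (L2_sq (@H4_L2 _ 0 0 hq isT))).
by apply: filterS (D00 (H4_L2q hq)) => z e Oz; rewrite e.
Qed.

Lemma H4_Wx q i j : H4 a q -> (i + j <= 3)%N -> Wx a (D i j q) (D i.+1 j q).
Proof.
move=> hq ij; apply: (@Wx_step _ _ i j q); apply: H4_wder => //.
exact: leq_trans ij _.
Qed.

Lemma H4_Wt q i j : H4 a q -> (i + j <= 3)%N -> Wt a (D i j q) (D i j.+1 q).
Proof.
move=> hq ij; apply: (@Wt_step _ _ a0 i j q); apply: H4_wder => //.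
  exact: leq_trans ij _.
by rewrite addnS.
Qed.

Lemma H4_Wxq q : H4 a q -> Wx a q (D 1 0 q).
Proof.
move=> hq; apply: (@Wx_step _ _ 0 0 q); first exact/is_wder00/H4_L2q.
exact: H4_wder.
Qed.

Lemma H4_Wtq q : H4 a q -> Wt a q (D 0 1 q).
Proof.
move=> hq; apply: (@Wt_step _ _ a0 0 0 q); first exact/is_wder00/H4_L2q.
exact: H4_wder.
Qed.

Let Kx := Ktr a.
Let Kt := Ktr (2 * a).

Lemma Ktr_gt0 (A : R) : 0 < A -> 0 < Ktr A.
Proof. by move=> A0; rewrite /Ktr addr_gt0// ?divr_gt0 ?mulr_gt0. Qed.

Lemma xtraces_L2 u v : Wx a u v ->
  [/\ L2 (leb1 R) Y (tr_x0 a u), L2 (leb1 R) Y (tr_xa a u),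
     \int[leb1 R]_(t in Y) (tr_x0 a u t ^+ 2) <= Kx * (sq u + sq v) &
     \int[leb1 R]_(t in Y) (tr_xa a u t ^+ 2) <= Kx * (sq u + sq v)].
Proof.
move=> W; have [_ [L1 L2' _] bd _] := xtraces_spec a0 W; have [Lu Lv _] := W.
have Lu' := Lu; have Lv' := Lv; rewrite OmegaE in Lu' Lv'.
have iu := intble_Rintegral2 mX mY (L2_sq Lu').
have iv := intble_Rintegral2 mX mY (L2_sq Lv').
have -> : Kx * (sq u + sq v) = \int[leb1 R]_(t in Y) (Kx *
    (\int[leb1 R]_(x in X) (u (x, t) ^+ 2) + \int[leb1 R]_(x in X) (v (x, t) ^+ 2))).
  rewrite (RintegralZl _ mY (intbleD mY iu iv)) (RintegralD mY iu iv) OmegaE.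
  by rewrite (Rfubini2 mX mY (L2_sq Lu')) (Rfubini2 mX mY (L2_sq Lv')).
have iK := intbleZ mY Kx (intbleD mY iu iv).
split => //.
- apply: (le_Rintegral_ae mY (L2_sq L1) iK).
  by apply: filterS bd => t h Yt; have [] := h Yt.
- apply: (le_Rintegral_ae mY (L2_sq L2') iK).
  by apply: filterS bd => t h Yt; have [] := h Yt.
Qed.

Lemma ttraces_L2 u v : Wt a u v ->
  [/\ L2 (leb1 R) X (tr_t0 a u), L2 (leb1 R) X (tr_tT a u),
     \int[leb1 R]_(x in X) (tr_t0 a u x ^+ 2) <= Kt * (sq u + sq v) &
     \int[leb1 R]_(x in X) (tr_tT a u x ^+ 2) <= Kt * (sq u + sq v)].
Proof.
move=> W; have [_ [L1 L2' _] bd _] := ttraces_spec a0 W; have [Lu Lv _] := W.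
have Lu' := Lu; have Lv' := Lv; rewrite OmegaE in Lu' Lv'.
have iu := intble_Rintegral1 mX mY (L2_sq Lu').
have iv := intble_Rintegral1 mX mY (L2_sq Lv').
have -> : Kt * (sq u + sq v) = \int[leb1 R]_(x in X) (Kt *
    (\int[leb1 R]_(t in Y) (u (x, t) ^+ 2) + \int[leb1 R]_(t in Y) (v (x, t) ^+ 2))).
  rewrite (RintegralZl _ mX (intbleD mX iu iv)) (RintegralD mX iu iv) OmegaE.
  by rewrite (Rfubini1 mX mY (L2_sq Lu')) (Rfubini1 mX mY (L2_sq Lv')).
have iK := intbleZ mX Kt (intbleD mX iu iv).
split => //.
- apply: (le_Rintegral_ae mX (L2_sq L1) iK).
  by apply: filterS bd => t h Yt; have [] := h Yt.
- apply: (le_Rintegral_ae mX (L2_sq L2') iK).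
  by apply: filterS bd => t h Yt; have [] := h Yt.
Qed.

Lemma xgreen u v phi : Wx a u v -> smooth2 phi ->
  \int[leb2 R]_(p in Omega a) (u p * pderx phi p + v p * phi p) =
  \int[leb1 R]_(t in Y) (tr_xa a u t * phi (a, t) - tr_x0 a u t * phi (0, t)).
Proof.
move=> W sphi; have [hw [_ _ G] _ _] := xtraces_spec a0 W; have [Lu Lv _] := W.
rewrite -(G _ sphi).
have [c1 _ _] := sphi [::]; have [c2 _ _] := sphi [:: true].
have Lphi := L2_continuous a c1; have Lphid := L2_continuous a c2.
apply: (Rintegral_ae_eq mO).
- exact: (intbleP (intbleD mO (L2M mO Lu Lphid) (L2M mO Lv Lphi))).
- exact: (intbleP (intbleD mO (L2M mO Lu Lphid) (L2M mO (wderP hw).1 Lphi))).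
by apply: filterS (wder_ae oO i1O hw) => p e Op; rewrite e.
Qed.

Lemma tgreen u v phi : Wt a u v -> smooth2 phi ->
  \int[leb2 R]_(p in Omega a) (u p * pdert phi p + v p * phi p) =
  \int[leb1 R]_(x in X) (tr_tT a u x * phi (x, 2 * a) - tr_t0 a u x * phi (x, 0)).
Proof.
move=> W sphi; have [hw [_ _ G] _ _] := ttraces_spec a0 W; have [Lu Lv _] := W.
rewrite -(G _ sphi).
have [c1 _ _] := sphi [::]; have [c2 _ _] := sphi [:: false].
have Lphi := L2_continuous a c1; have Lphid := L2_continuous a c2.
apply: (Rintegral_ae_eq mO).
- exact: (intbleP (intbleD mO (L2M mO Lu Lphid) (L2M mO Lv Lphi))).
- exact: (intbleP (intbleD mO (L2M mO Lu Lphid) (L2M mO (wderP hw).1 Lphi))).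
by apply: filterS (wder_ae oO i1O hw) => p e Op; rewrite e.
Qed.

Definition KB : R := 2 * Kx.
Definition KS : R := 4 * Kt * Kx.

(** Only one variable is integrated: the bound is uniform in the other one. *)
Lemma slice_bound q i j : H4 a q -> (i + j <= 3)%N ->
  {ae leb1 R, forall x, X x -> \int[leb1 R]_(t in Y) (D i j q (x, t) ^+ 2) <= KB * N q ^+ 2}.
Proof.
move=> hq ij; have [_ _ _ h] := xtraces_spec a0 (H4_Wx hq ij).
apply: filterS h => x hx Xx; apply: le_trans (hx Xx) _; rewrite -/Kx /KB.
have := @D_le q i j (leq_trans ij (isT : (3 <= 4)%N)).
have := @D_le q i.+1 j ij; have := Ktr_gt0 a0; rewrite -/Kx; nra.
Qed.

Lemma slice_bound_q q : H4 a q ->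
  {ae leb1 R, forall x, X x -> \int[leb1 R]_(t in Y) (q (x, t) ^+ 2) <= KB * N q ^+ 2}.
Proof.
move=> hq; have [_ _ _ h] := xtraces_spec a0 (H4_Wxq hq).
apply: filterS h => x hx Xx; apply: le_trans (hx Xx) _; rewrite -/Kx /KB.
have := q_le hq; have := @D_le q 1 0 isT; have := Ktr_gt0 a0; rewrite -/Kx; nra.
Qed.

(** The trace at [x] is bounded by the slices at [x] of [q_x] and of [q_xt], and each
    of these is bounded uniformly in [x]. *)
Lemma trace_sup_bound q : H4 a q ->
  {ae leb1 R, forall x, X x -> tr_t0 a (Dx a q) x ^+ 2 <= KS * N q ^+ 2}.
Proof.
move=> hq; have [_ _ h _] := ttraces_spec a0 (@H4_Wt q 1 0 hq isT).
apply: filterS3 h (@slice_bound q 1 0 hq isT) (@slice_bound q 1 1 hq isT) => x h1 h2 h3 Xx.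
have [{}h1 _] := h1 Xx; apply: le_trans h1 _; rewrite -/Kt /KS.
have := h2 Xx; have := h3 Xx; have := Ktr_gt0 T0; rewrite -/Kt /KB; nra.
Qed.

(** Green's formula in [t] for [eta'(x) zeta(t)] and in [x] for [eta(x) zeta'(t)],
    with [zeta] affine from 1 at [t = 0] to 0 at [t = 2a], and likewise for [q_x]. *)
Lemma is_wder1_trace q (r : R) : H4 a q -> r <= a ->
  is_wder1 `]0, r[%classic (tr_t0 a q) (tr_t0 a (Dx a q)).
Proof.
move=> hq ra; have IX : `]0, r[%classic `<=` X.
  by move=> x; rewrite /X /= !in_itv/= => /andP[-> xr] /=; exact: lt_le_trans ra.
have mI : measurable (`]0, r[%classic : set mR) by exact: measurable_itv.
have W1 := H4_Wtq hq; have W2 := @H4_Wt q 1 0 hq isT.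
have W3 := H4_Wxq hq; have W4 := @H4_Wx q 0 1 hq isT.
have [Lt _ _ _] := ttraces_L2 W1; have [Ltx _ _ _] := ttraces_L2 W2.
split.
  apply/L2P; split; first exact: (measurable_funS mX IX (L2_meas Ltx)).
  exact: (integrableS mX mI IX (L2_sq Ltx)).
move=> eta teta; have [seta ceta etaI] := teta.
have tX : test1 X eta by split => //; exact: subset_trans IX.
have tI' := test1_derive1 teta.
pose zeta (t : R) : R := - (2 * a)^-1 * t + 1.
have sz : smooth1 zeta := @smooth1_affine R _ _.
have seta' := smooth1_derive1 seta; have sz' := smooth1_derive1 sz.
have z0 : zeta 0 = 1 by rewrite /zeta mulr0 add0r.
have zT : zeta (2 * a) = 0 by rewrite /zeta mulNr mulVf ?gt_eqF// addNr.
have eta0 x : ~ X x -> eta x = 0 by exact: test1_out.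
have e0 : eta 0 = 0 by apply: eta0; rewrite /X /= in_itv /= ltxx.
have ea : eta a = 0 by apply: eta0; rewrite /X /= in_itv /= ltxx andbF.
have G1 := tgreen W1 (smooth2_tens seta' sz).
have G2 := tgreen W2 (smooth2_tens seta sz).
have G3 := xgreen W3 (smooth2_tens seta sz').
have G4 := xgreen W4 (smooth2_tens seta sz).
have restr f : (forall x, ~ `]0, r[%classic x -> f x = 0) ->
    \int[leb1 R]_(x in `]0, r[) f x = \int[leb1 R]_(x in X) f x.
  move=> f0; rewrite Rintegral_mkcond [RHS]Rintegral_mkcond; apply: eq_Rintegral => x _.
  rewrite !patchE; case: ifPn => [/set_mem xI|/negP xI].
    by rewrite mem_set//; exact: IX.
  by case: ifP => // _; rewrite f0// => xI2; apply: xI; exact: mem_set.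
rewrite !restr; last 2 first.
- by move=> x nI; rewrite (test1_out teta nI) mulr0.
- by move=> x nI; rewrite (test1_out tI' nI) mulr0.
rewrite !(pdert_tens _ sz) in G1 G2; rewrite (pderx_tens _ seta) in G3.
rewrite (pderx_tens _ seta) in G4.
have zeroY (f1 f2 : R -> R) g : \int[leb1 R]_(t in Y) (f1 t * tens eta g (a, t) - f2 t * tens eta g (0, t)) = 0.
  rewrite (_ : Rintegral _ _ _ = \int[leb1 R]_(t in Y) 0); first by rewrite Rintegral_cst// mul0r.
  by apply: eq_Rintegral => t _; rewrite /tens /= ea e0 !mul0r !mulr0 subrr.
rewrite zeroY in G3; rewrite zeroY in G4.
have tX' := test1_derive1 tX.
have atT (f1 f2 : R -> R) g : test1 X g -> L2 (leb1 R) X f2 ->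
    \int[leb1 R]_(x in X) (f1 x * tens g zeta (x, 2 * a) - f2 x * tens g zeta (x, 0)) =
    - (\int[leb1 R]_(x in X) (f2 x * g x)).
  move=> tg Lf; rewrite -mulN1r -(RintegralZl _ mX (L2M mX Lf (test1_L2 tg))).
  by apply: eq_Rintegral => x _; rewrite /tens /= zT z0; ring.
rewrite (atT _ _ _ tX' Lt) in G1; rewrite (atT _ _ _ tX Ltx) in G2.
have cc f g : smooth1 f -> smooth1 g -> L2 (leb2 R) (Omega a) (tens f g).
  by move=> sf sg; apply: L2_continuous; apply: continuous_tens; exact: smooth1_continuous.
have Lq := H4_L2q hq; have L10 := @H4_L2 q 1 0 hq isT.
have L01 := @H4_L2 q 0 1 hq isT; have L11 := @H4_L2 q 1 1 hq isT.
have t1 := cc _ _ seta' sz'; have t2 := cc _ _ seta' sz.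
have t3 := cc _ _ seta sz'; have t4 := cc _ _ seta sz.
have i1 := L2M mO Lq t1; have i2 := L2M mO L01 t2.
have i3 := L2M mO L10 t3; have i4 := L2M mO L11 t4.
rewrite (RintegralD mO i1 i2) in G1; rewrite (RintegralD mO i3 i4) in G2.
rewrite (RintegralD mO i1 i3) in G3; rewrite (RintegralD mO i2 i4) in G4.
by rewrite /Dx; lra.
Qed.

End H4_functions.

(** * Completeness of L^2 and Riesz representation *)

Section fast_cauchy.
Variable R : realType.

(** Adding or subtracting the tail of the geometric series makes the sequence
    monotone. *)
Lemma fast_cauchy_real (y : nat -> R) (s : R) : 0 <= s ->
  (forall n, `|y n.+1 - y n| <= s * 2^-1 ^+ n) ->
  cvgn y /\ forall n, `|limn y - y n| <= 2 * s * 2^-1 ^+ n.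
Proof.
move=> s0 hy; pose b n : R := 2 * s * 2^-1 ^+ n.
have bS n : b n.+1 = b n / 2 by rewrite /b exprS; field.
have b2 n : b n = 2 * (s * 2^-1 ^+ n) by rewrite /b mulrA.
have b0 n : 0 <= b n by rewrite /b !mulr_ge0.
have hy' n := hy n.
have dz : nonincreasing_seq (fun n => y n + b n).
  apply/nonincreasing_seqP => n.
  have := hy' n; rewrite ler_norml => /andP[_ h]; have := bS n; have := b2 n; lra.
have iw : nondecreasing_seq (fun n => y n - b n).
  apply/nondecreasing_seqP => n.
  have := hy' n; rewrite ler_norml => /andP[h _]; have := bS n; have := b2 n; lra.
have cz : cvgn (fun n => y n + b n).
  apply: nonincreasing_is_cvgn => //; exists (y 0%N - b 0%N) => _ [n _ <-].
  by apply: le_trans (iw 0%N n (leq0n n)) _; rewrite lerD2l; have := b0 n; lra.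
have cb : b @ \oo --> (0 : R).
  have h : (fun n => 2 * s * 2^-1 ^+ n) @ \oo --> (2 * s * 0 : R).
    apply: cvgM; first exact: cvg_cst.
    by apply: cvg_expr; rewrite ger0_norm ?invr_ge0// invf_lt1// ltr1n.
  by rewrite mulr0 in h.
have cy : y @ \oo --> limn (fun n => y n + b n).
  have h : (fun n => (y n + b n) - b n) @ \oo --> (limn (fun n => y n + b n) - 0 : R).
    by apply: cvgB.
  have e : (fun n => (y n + b n) - b n) = y by apply/funext => n; rewrite addrK.
  by rewrite subr0 e in h.
have cvy : cvgn y by apply/cvg_ex; eexists; exact: cy.
split => // n; have ly := cvg_lim (@Rhausdorff R) cy.
have cw : (fun n => y n - b n) @ \oo --> limn y.
  have h : (fun n => y n - b n) @ \oo --> (limn y - 0 : R) by apply: cvgB.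
  by rewrite subr0 in h.
have h1 := nonincreasing_cvgn_ge dz cz n.
have cvw : cvgn (fun n => y n - b n) by apply/cvg_ex; eexists; exact: cw.
have h2 := nondecreasing_cvgn_le iw cvw n.
rewrite (cvg_lim (@Rhausdorff R) cw) /= in h2; rewrite -ly /= in h1.
rewrite ler_norml -/(b n); apply/andP; split; lra.
Qed.

End fast_cauchy.

Section L2_complete.
Context {d : measure_display} {T : measurableType d} {R : realType}.
Variables (mu : {measure set T -> \bar R}) (D : set T).
Hypothesis mD : measurable D.

(** A sequence with [ |f_(n+1) - f_n|^2 ] of order [8^-n] in the mean: the series
    of [ 4^n |f_(n+1) - f_n|^2 ] is integrable, so almost every point sees a
    geometrically convergent sequence, dominated by the sum of that series. *)
Lemma L2_fast_cauchy (f : nat -> T -> R) (K : R) : (forall n, L2 mu D (f n)) ->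
  (forall n, \int[mu]_(x in D) ((f n.+1 x - f n x) ^+ 2) <= K * 8^-1 ^+ n) ->
  exists F, L2 mu D F /\ exists K', forall n,
    \int[mu]_(x in D) ((F x - f n x) ^+ 2) <= K' * 4^-1 ^+ n.
Proof.
move=> Lf hf; have K0 : 0 <= K.
  have := hf 0%N; rewrite expr0 mulr1; apply: le_trans.
  by apply: Rintegral_ge0 => x _; exact: sqr_ge0.
pose g n (x : T) : \bar R := (4 ^+ n * (f n.+1 x - f n x) ^+ 2)%:E.
have Ldf n : L2 mu D (fun x => f n.+1 x - f n x) := L2B mD (Lf n.+1) (Lf n).
have ig n : intble mu D (fun x => 4 ^+ n * (f n.+1 x - f n x) ^+ 2).
  by apply: intbleZ => //; exact: (L2_sq (Ldf n)).
have g0 n x : (0 <= g n x)%E by rewrite lee_fin mulr_ge0 ?sqr_ge0// exprn_ge0.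
have mg n : measurable_fun D (g n) by exact/measurable_EFinP/(intbleP (ig n)).
pose G x := (\sum_(0 <= n <oo) g n x)%E.
have mG : measurable_fun D G.
  have := @ge0_emeasurable_sum _ _ R D g xpredT (fun k x _ _ => g0 k x) (fun k _ => mg k).
  exact.
have G0 x : (0 <= G x)%E by apply: nneseries_ge0.
have IG : (\int[mu]_(x in D) G x <= (2 * K)%:E)%E.
  rewrite integral_nneseries//.
  apply: le_trans (epsilon_trick0 xpredT (_ : 0 <= 2 * K)); last by rewrite mulr_ge0.
  apply: lee_nneseries => [n _ _|n _]; first exact: integral_ge0.
  rewrite (_ : integral _ _ _ = (4 ^+ n * \int[mu]_(x in D) ((f n.+1 x - f n x) ^+ 2))%:E).
    rewrite lee_fin natrX; apply: le_trans (ler_wpM2l _ (hf n)) _; first by rewrite exprn_ge0.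
    rewrite mulrCA -exprMn (_ : 4 * 8^-1 = 2^-1 :> R); last by field.
    by rewrite exprS invfM mulrCA mulrA mulKf// exprVn mulrC.
  rewrite -RintegralZl//; last exact: (L2_sq (Ldf n)).
  by rewrite /Rintegral fineK//; apply: integrable_fin_num => //; exact: ig.
have iG : mu.-integrable D G.
  apply/integrableP; split => //.
  under eq_integral => x _ do rewrite gee0_abs//.
  by apply: le_lt_trans IG _; rewrite ltry.
pose Gd := D `&` [set x | (G x < +oo)%E].
have mGd : measurable Gd by exact: emeasurable_fun_infty_o.
have GdD : Gd `<=` D by move=> x [].
have aeGd : {ae mu, forall x, D x -> Gd x}.
  by apply: filterS (integrable_ae mD iG) => x h Dx; split => //=; rewrite ltey_eq h.
pose H x := fine (G x).
have HE x : Gd x -> G x = (H x)%:E.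
  by move=> [_ Gx]; rewrite /H fineK// ge0_fin_numE.
have H0 x : 0 <= H x by rewrite /H fine_ge0.
have step n x : Gd x -> (f n.+1 x - f n x) ^+ 2 <= H x * 4^-1 ^+ n.
  move=> Gx; have : (g n x <= G x)%E.
    apply: le_trans (nneseries_lim_ge n.+1 _); last by move=> *; exact: g0.
    rewrite big_nat_recr//= leeDr// sume_ge0// => i _; exact: g0.
  rewrite HE// lee_fin => h.
  by rewrite exprVn ler_pdivlMr ?exprn_gt0// mulrC.
have fast x : Gd x -> cvgn (f ^~ x) /\
    forall n, (limn (f ^~ x) - f n x) ^+ 2 <= 4 * H x * 4^-1 ^+ n.
  move=> Gx; have E n : 4^-1 ^+ n = (2^-1 ^+ n) ^+ 2 :> R.
    by rewrite -exprM mulnC exprM; congr (_ ^+ _); field.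
  have [n|c l] := @fast_cauchy_real R (f ^~ x) (Num.sqrt (H x)) (sqrtr_ge0 _).
    rewrite -(@ler_pXn2r _ 2)// ?nnegrE ?mulr_ge0 ?sqrtr_ge0 ?exprn_ge0//.
    rewrite real_normK ?num_real// exprMn sqr_sqrtr// -E; exact: step.
  split => // n; have := l n.
  rewrite -(@ler_pXn2r _ 2)// ?nnegrE ?mulr_ge0 ?sqrtr_ge0 ?exprn_ge0//.
  by rewrite real_normK ?num_real// !exprMn sqr_sqrtr// -E; congr (_ <= _); ring.
pose F x := limn (fun n => (f n \_ Gd) x).
have FE x : Gd x -> F x = limn (f ^~ x).
  move=> Gx; rewrite /F; congr (lim (_ @ \oo)); apply/funext => n.
  by rewrite patchE mem_set.
have mF : measurable_fun D F.
  apply: (@measurable_fun_cvg _ _ R D (fun n => f n \_ Gd)).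
    move=> n; apply: measurable_funTS; apply/(measurable_restrictT _ mGd).
    exact: (measurable_funS mD GdD (L2_meas (Lf n))).
  move=> x Dx; have [Gx|nGx] := pselect (Gd x).
    have [c _] := fast _ Gx; rewrite FE//.
    rewrite (_ : (fun n => (f n \_ Gd) x) = f ^~ x); first exact: c.
    by apply/funext => n; rewrite patchE mem_set.
  have e : (fun n => (f n \_ Gd) x) = fun=> 0.
    by apply/funext => n; rewrite patchE memNset.
  by rewrite /F e lim_cst//; exact: cvg_cst.
have iH : intble mu D H.
  apply/integrableP; split; first by apply/measurable_EFinP; exact: measurableT_comp.
  have /integrableP[_] := iG; congr (_ < _)%E; apply: ae_eq_integral => //.
  - by apply: measurableT_comp => //.
  - by apply: measurableT_comp => //; apply/measurable_EFinP; exact: measurableT_comp.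
  by apply: filterS aeGd => x h Dx; rewrite /comp HE//; exact: h.
have bound n : {ae mu, forall x, D x -> (F x - f n x) ^+ 2 <= 4 * 4^-1 ^+ n * H x}.
  apply: filterS aeGd => x h Dx; rewrite FE; last exact: h.
  by have [_ /(_ n)] := fast _ (h Dx); rewrite mulrAC.
have LFf n : L2 mu D (fun x => F x - f n x).
  apply: (L2_le_ae mD _ (intbleZ mD _ iH) (bound n)).
  by apply: measurable_funB => //; exact: (L2_meas (Lf n)).
exists F; split.
  by apply: eq_L2 (L2D mD (LFf 0%N) (Lf 0%N)) => // x _; rewrite subrK.
exists (4 * \int[mu]_(x in D) H x) => n.
have -> : 4 * \int[mu]_(x in D) H x * 4^-1 ^+ n = \int[mu]_(x in D) (4 * 4^-1 ^+ n * H x).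
  by rewrite RintegralZl// mulrAC.
exact: (le_Rintegral_ae mD (L2_sq (LFf n)) (intbleZ mD _ iH) (bound n)).
Qed.

End L2_complete.

Section riesz.
Variables (R : realType) (E : Type).
Local Notation fn := (E -> R).
Variables (V : fn -> Prop) (ip : fn -> fn -> R) (ell : fn -> R) (b : R).
Hypotheses (V0 : V (fun=> 0))
  (Vlin : forall c u w, V u -> V w -> V (fun p => c * u p + w p))
  (ip_sym : forall u w, ip u w = ip w u)
  (ip_lin : forall c u w h, V u -> V w -> V h ->
     ip (fun p => c * u p + w p) h = c * ip u h + ip w h)
  (ip_ge0 : forall u, 0 <= ip u u)
  (ell_lin : forall c u w, V u -> V w -> ell (fun p => c * u p + w p) = c * ell u + ell w)
  (ell_bd : forall h, V h -> ell h ^+ 2 <= b * ip h h)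
  (complete : forall x : nat -> fn, (forall n, V (x n)) ->
     (exists K, forall n, ip (fun p => -1 * x n p + x n.+1 p) (fun p => -1 * x n p + x n.+1 p) <= K * 8^-1 ^+ n) ->
     exists2 g, V g & exists K, forall n,
       ip (fun p => -1 * x n p + g p) (fun p => -1 * x n p + g p) <= K * 4^-1 ^+ n).

Lemma ip_linr c u w h : V u -> V w -> V h ->
  ip h (fun p => c * u p + w p) = c * ip h u + ip h w.
Proof. by move=> *; rewrite ip_sym ip_lin// ![ip h _]ip_sym. Qed.

Lemma ip_quad t u h : V u -> V h ->
  ip (fun p => t * h p + u p) (fun p => t * h p + u p) = ip u u + 2 * t * ip u h + t ^+ 2 * ip h h.
Proof.
move=> Vu Vh; have Vt := Vlin t Vh Vu.
by rewrite ip_lin// !ip_linr// (ip_sym h u); ring.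
Qed.

Lemma ip_cs u h : V u -> V h -> ip u h ^+ 2 <= ip u u * ip h h.
Proof.
by move=> Vu Vh; apply: discriminant_le => t; rewrite -ip_quad//.
Qed.

(** The functional [ip u u - 2 ell u] is bounded below; by the parallelogram
    identity a fast minimizing sequence is a fast Cauchy sequence, and its
    limit represents [ell]. *)
Lemma riesz_representation : exists2 g, V g & forall h, V h -> ell h = ip g h.
Proof.
pose J u := ip u u - 2 * ell u.
have b0 : forall h, V h -> 0 <= b * ip h h.
  by move=> h Vh; apply: le_trans (ell_bd Vh); exact: sqr_ge0.
have Jquad t u h : V u -> V h ->
    J (fun p => t * h p + u p) = J u + 2 * t * (ip u h - ell h) + t ^+ 2 * ip h h.
  by move=> Vu Vh; rewrite /J ip_quad// ell_lin//; ring.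
have Jge u : V u -> - `|b| <= J u.
  move=> Vu; rewrite /J; have h1 := ell_bd Vu; have h2 := ip_ge0 u.
  have h3 : b * ip u u <= `|b| * ip u u by rewrite ler_wpM2r// ler_norm.
  have h4 := normr_ge0 b.
  have h5 : (2 * ell u) ^+ 2 <= (ip u u + `|b|) ^+ 2.
    by have := sqr_ge0 (ip u u - `|b|); nra.
  have h6 : 2 * ell u <= ip u u + `|b|.
    have e0 : 0 <= ip u u + `|b| by rewrite addr_ge0.
    rewrite leNgt; apply/negP => h7.
    have : 0 < (2 * ell u - (ip u u + `|b|)) * (2 * ell u + (ip u u + `|b|)).
      by apply: mulr_gt0; lra.
    by lra.
  lra.
pose S := [set J u | u in V].
have hS : has_inf S.
  split; first by exists (J (fun=> 0)); exists (fun=> 0).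
  by exists (- `|b|) => _ [u Vu <-]; exact: Jge.
have infle u : V u -> inf S <= J u.
  by move=> Vu; apply: ge_inf; [case: hS|exists u].
have e8 n : 0 < 8^-1 ^+ n :> R by rewrite exprn_gt0// invr_gt0.
have approx n : exists u, V u /\ J u <= inf S + 8^-1 ^+ n.
  have [_ [u Vu <-] h] := inf_adherent (e8 n) hS.
  by exists u; split => //; exact: ltW.
have [x hx] := choice approx.
have Vx n : V (x n) by have [] := hx n.
(* the midpoint of [x n] and [x n.+1] does not go below the infimum, so the two
   points are close to each other *)
have [|g Vg [K hK]] := complete Vx.
  exists 4 => n; have Vd := Vlin (-1) (Vx n) (Vx n.+1).
  set dx := (fun p => -1 * x n p + x n.+1 p) in Vd *.
  have h1 := infle _ (Vlin (2^-1) Vd (Vx n)).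
  rewrite (Jquad _ _ _ (Vx n) Vd) in h1.
  have h2 := Jquad 1 (x n) dx (Vx n) Vd.
  rewrite (_ : (fun p => 1 * dx p + x n p) = x n.+1) in h2; last first.
    by apply/funext => p; rewrite /dx mul1r mulN1r addrC addrA subrr add0r.
  have [_ h3] := hx n; have [_ h4] := hx n.+1.
  have h5 : 8^-1 ^+ n.+1 <= 8^-1 ^+ n :> R.
    by rewrite exprS ler_piMl ?exprn_ge0 ?invr_ge0// invf_le1// ler1n.
  move: h1 h2 h3 h4 h5; move: (ip dx dx) (ip (x n) dx) (ell dx) (8^-1 ^+ n) (8^-1 ^+ n.+1).
  move=> A B C e e'; rewrite !expr2; lra.
exists g => // h Vh.
have key n : (ip g h - ell h) ^+ 2 <= (2 * `|K| + 2) * ip h h * 4^-1 ^+ n.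
  have Vd := Vlin (-1) (Vx n) Vg; have h1 := hK n.
  set dx := (fun p => -1 * x n p + g p) in Vd h1 *.
  have h2 : (ip (x n) h - ell h) ^+ 2 <= 8^-1 ^+ n * ip h h.
    apply: discriminant_le => t.
    have := infle _ (Vlin t Vh (Vx n)); rewrite (Jquad _ _ _ (Vx n) Vh).
    by have [_] := hx n; lra.
  have h3 := ip_cs Vd Vh.
  have h4 : ip dx h = ip g h - ip (x n) h by rewrite ip_lin//; ring.
  have h5 : 8^-1 ^+ n <= 4^-1 ^+ n :> R.
    by rewrite lerXn2r ?nnegrE ?invr_ge0// lef_pV2 ?posrE// ler_nat.
  have h6 := ip_ge0 h.
  have h7 : K * 4^-1 ^+ n <= `|K| * 4^-1 ^+ n.
    by rewrite ler_wpM2r ?ler_norm// exprn_ge0// invr_ge0.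
  have h8 : ip dx h ^+ 2 <= `|K| * 4^-1 ^+ n * ip h h.
    by apply: le_trans h3 _; rewrite ler_wpM2r//; exact: le_trans h7.
  have h9 : 8^-1 ^+ n * ip h h <= 4^-1 ^+ n * ip h h by rewrite ler_wpM2r.
  rewrite h4 in h8; move: h2 h8 h9.
  move: (ip g h) (ip (x n) h) (ell h) (ip h h) (8^-1 ^+ n) (4^-1 ^+ n) => A B C I e e' q1 q2 q3.
  have := sqr_ge0 ((A - B) - (B - C)); nra.
apply/esym/eqP; rewrite -subr_eq0 -sqrf_eq0 eq_le sqr_ge0 andbT.
set L := (2 * `|K| + 2) * ip h h in key.
have c4 : (fun n => L * 4^-1 ^+ n) @ \oo --> (L * 0 : R).
  apply: cvgM; first exact: cvg_cst.
  by apply: cvg_expr; rewrite ger0_norm ?invr_ge0// invf_lt1// ltr1n.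
rewrite mulr0 in c4; rewrite -(cvg_lim (@Rhausdorff R) c4).
apply: limr_ge; first by apply/cvg_ex; eexists; exact: c4.
by exists 0%N => // n _; exact: key.
Qed.

End riesz.

(** * Expansion of the functional *)

Section functional.
Variable R : realType.
Local Notation mR := (measurableTypeR R).
Variable a : R.
Hypothesis a0 : 0 < a.
Let X : set mR := `]0, a[%classic.
Let Y : set mR := `]0, 2 * a[%classic.
Let mX : measurable X. Proof. exact: measurable_itv. Qed.
Let mY : measurable Y. Proof. exact: measurable_itv. Qed.
Let mXY : measurable (X `*` Y). Proof. exact: measurableX. Qed.
Let T0 : 0 < 2 * a. Proof. by rewrite mulr_gt0. Qed.
Let mO := @measurable_Omega R a.
Implicit Types (u v w q h : R * R -> R).
Local Notation D i j q := (wder (Omega a) i j q).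
Local Notation N q := (hnorm (Omega a) 4 q).
Local Notation L2O := (L2 (leb2 R) (Omega a)).
Local Notation sq u := (\int[leb2 R]_(z in Omega a) (u z ^+ 2)).

(** A function of [x] times a function with bounded slices: integrate in [t] first. *)
Lemma slice_mul (G : R -> R) (w : R * R -> R) (B S : R) : L2 (leb1 R) X G ->
  {ae leb1 R, forall x, X x -> G x ^+ 2 <= B} -> L2O w ->
  {ae leb1 R, forall x, X x -> \int[leb1 R]_(t in Y) (w (x, t) ^+ 2) <= S} ->
  L2O (fun z => G z.1 * w z) /\ sq (fun z => G z.1 * w z) <= S * \int[leb1 R]_(x in X) (G x ^+ 2).
Proof.
move=> LG GB Lw wS; have Lw' := Lw; rewrite OmegaE in Lw' *.
have mG : measurable_fun (X `*` Y) (fun z : mR * mR => G z.1).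
  have h : (fst : mR * mR -> mR) @` (X `*` Y) `<=` X by move=> _ [[x y] [Xx _] <-].
  apply: (measurable_comp mX h (L2_meas LG)).
  by apply: measurable_funTS; exact: measurable_fst.
have LGw : L2 (leb2 R) (X `*` Y) (fun z => G z.1 * w z).
  apply: (L2_le_ae mXY _ (intbleZ mXY B (L2_sq Lw'))).
    by apply: measurable_funM => //; exact: (L2_meas Lw').
  apply: filterS (ae_fst (@lebesgue_measure R) GB) => -[x t] /= h [Xx _].
  by rewrite exprMn ler_wpM2r ?sqr_ge0//; exact: h.
split => //; have iS := intble_sections1 mX mY (L2_sq Lw').
rewrite (Rfubini1 mX mY (L2_sq LGw)) -(RintegralZl _ mX (L2_sq LG)).
apply: (le_Rintegral_ae mX).
- exact: (intble_Rintegral1 mX mY (L2_sq LGw)).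
- exact: (intbleZ mX _ (L2_sq LG)).
apply: filterS2 iS wS => x h1 h2 Xx.
rewrite (_ : Rintegral _ _ _ = G x ^+ 2 * \int[leb1 R]_(t in Y) (w (x, t) ^+ 2)).
  by rewrite mulrC ler_wpM2r ?sqr_ge0// h2.
rewrite -(RintegralZl _ mY (h1 Xx)).
by apply: eq_Rintegral => t _; rewrite exprMn.
Qed.

Definition g0 q : R -> R := tr_t0 a (Dx a q).

Lemma g0_L2 q : H4 a q -> L2 (leb1 R) X (g0 q).
Proof. by move=> hq; have [h _ _ _] := ttraces_L2 a0 (@H4_Wt _ _ a0 q 1 0 hq isT). Qed.

Lemma g0_sq q : H4 a q -> \int[leb1 R]_(x in X) (g0 q x ^+ 2) <= 2 * Ktr (2 * a) * N q ^+ 2.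
Proof.
move=> hq; have [_ _ h _] := ttraces_L2 a0 (@H4_Wt _ _ a0 q 1 0 hq isT).
apply: le_trans h _.
have := @D_le _ a q 1 0 isT; have := @D_le _ a q 1 1 isT; have := Ktr_gt0 T0.
move: (Ktr _) (sq (D 1 0 q)) (sq (D 1 1 q)) => k A B; nra.
Qed.

Lemma g0_lin c u w : H4 a u -> H4 a w ->
  {ae leb1 R, forall x, X x -> g0 (fun p => c * u p + w p) x = c * g0 u x + g0 w x}.
Proof.
move=> hu hw; have hc := H4_lin c hu hw.
have [h _] := ttraces_lin a0 (@H4_Wt _ _ a0 u 1 0 hu isT) (@H4_Wt _ _ a0 w 1 0 hw isT)
  (@H4_Wt _ _ a0 _ 1 0 hc isT) (@D_lin _ _ c u w 1 0 hu hw isT) (@D_lin _ _ c u w 1 1 hu hw isT).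
exact: h.
Qed.

Definition P2 h : R * R -> R := fun z => Dxx a h z - 2 * Dxt a h z.

Lemma P2_L2 h : H4 a h -> L2O (P2 h).
Proof.
by move=> hh; exact: (L2B mO (@H4_L2 _ _ h 2 0 hh isT) (L2Z mO 2 (@H4_L2 _ _ h 1 1 hh isT))).
Qed.

Lemma P2_lin c u w : H4 a u -> H4 a w ->
  ae_eq (leb2 R) (Omega a) (P2 (fun p => c * u p + w p)) (fun z => c * P2 u z + P2 w z).
Proof.
move=> hu hw.
apply: filterS2 (@D_lin _ _ c u w 2 0 hu hw isT) (@D_lin _ _ c u w 1 1 hu hw isT) => z e1 e2 Oz.
rewrite /P2 /Dxx /Dxt (e1 Oz) (e2 Oz).
by move: (D 2 0 u z) (D 2 0 w z) (D 1 1 u z) (D 1 1 w z) => A B C E; ring.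
Qed.

Lemma P2_sq h : H4 a h -> sq (P2 h) <= 10 * N h ^+ 2.
Proof.
have ar (A B C m : R) : B <= m -> A <= m -> C <= 2 * A + 2 * (4 * B) -> C <= 10 * m.
  by lra.
move=> hh; have L20 := @H4_L2 _ _ h 2 0 hh isT; have L11 := @H4_L2 _ _ h 1 1 hh isT.
have := Rintegral_sqD_le mO L20 (L2Z mO (-2) L11).
rewrite (_ : sq (fun z => -2 * D 1 1 h z) = 4 * sq (D 1 1 h)); last first.
  by rewrite -(RintegralZl _ mO (L2_sq L11)); apply: eq_Rintegral => z _; ring.
move/(ar _ _ _ _ (@D_le _ a h 1 1 isT) (@D_le _ a h 2 0 isT)).
rewrite (_ : sq (P2 h) = \int[leb2 R]_(x in Omega a) (D 2 0 h x + -2 * D 1 1 h x) ^+ 2); last first.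
  apply: eq_Rintegral => z _; rewrite /P2 /Dxx /Dxt.
  by move: (D 2 0 h z) (D 1 1 h z) => A B; ring.
exact.
Qed.

(** The nonlinear term of [M q] is [4 gm q q]. As [gm] is bilinear, [M (q + h)] is a
    polynomial of degree two in [h]. *)
Definition gm q w : R * R -> R := fun z => g0 q z.1 * w z.

Lemma gm_L2 q w : H4 a q -> H4 a w -> L2O (gm q w).
Proof.
move=> hq hw.
by have [] := slice_mul (g0_L2 hq) (trace_sup_bound a0 hq) (H4_L2q hw) (slice_bound_q a0 hw).
Qed.

Definition KG : R := 2 * KB a * Ktr (2 * a).

Lemma KB_gt0 : 0 < KB a.
Proof. by rewrite /KB mulr_gt0// Ktr_gt0. Qed.

Lemma KG_gt0 : 0 < KG.
Proof. by rewrite /KG !mulr_gt0// ?KB_gt0// Ktr_gt0. Qed.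

(** Square integrability of the trace in [x] and the uniform bound of the slices in
    [t] make [gm] a bounded bilinear map. *)
Lemma gm_sq q w : H4 a q -> H4 a w -> sq (gm q w) <= KG * N q ^+ 2 * N w ^+ 2.
Proof.
have ar (k n m t A B : R) : 0 <= k -> A <= k * n * B -> 0 <= n -> B <= 2 * t * m ->
    A <= 2 * k * t * m * n.
  by move=> k0 AB n0 Bm; have := ler_wpM2l (mulr_ge0 k0 n0) Bm; lra.
move=> hq hw.
have [_ h] := slice_mul (g0_L2 hq) (trace_sup_bound a0 hq) (H4_L2q hw) (slice_bound_q a0 hw).
exact: ar (ltW KB_gt0) h (sqr_ge0 _) (g0_sq hq).
Qed.

Lemma gm_linl c u w v : H4 a u -> H4 a w ->
  ae_eq (leb2 R) (Omega a) (gm (fun p => c * u p + w p) v) (fun z => c * gm u v z + gm w v z).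
Proof.
move=> hu hw; apply: filterS (ae_fst (@lebesgue_measure R) (g0_lin c hu hw)) => -[x t] /= e Oz.
have Xx : X x by move: Oz; rewrite OmegaE => -[].
rewrite /gm /= (e Xx); move: (g0 u x) (g0 w x) (v (x, t)) => A B C; ring.
Qed.

Lemma ME q : M a q = fun z => P2 q z + 4 * gm q q z.
Proof. by apply/funext => z; rewrite /M /P2 /gm /g0 mulrA. Qed.

Lemma M_L2 q : H4 a q -> L2O (M a q).
Proof. by move=> hq; rewrite ME; exact: (L2D mO (P2_L2 hq) (L2Z mO 4 (gm_L2 hq hq))). Qed.

(** The linear part in [h] of [M (q + h)]. *)
Definition ML q h : R * R -> R := fun z => P2 h z + 4 * gm q h z + 4 * gm h q z.

Lemma ML_L2 q h : H4 a q -> H4 a h -> L2O (ML q h).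
Proof.
move=> hq hh; apply: (L2D mO _ (L2Z mO 4 (gm_L2 hh hq))).
exact: (L2D mO (P2_L2 hh) (L2Z mO 4 (gm_L2 hq hh))).
Qed.

Lemma ML_lin q c u w : H4 a u -> H4 a w ->
  ae_eq (leb2 R) (Omega a) (ML q (fun p => c * u p + w p)) (fun z => c * ML q u z + ML q w z).
Proof.
move=> hu hw; apply: filterS2 (P2_lin c hu hw) (gm_linl c q hu hw) => z e1 e2 Oz.
rewrite /ML (e1 Oz) (e2 Oz) /gm.
by move: (P2 u z) (P2 w z) (g0 q z.1) (g0 u z.1) (g0 w z.1) (u z) (w z) (q z) => *; ring.
Qed.

Lemma M_add q h : H4 a q -> H4 a h ->
  ae_eq (leb2 R) (Omega a) (M a (q \+ h)) (fun z => M a q z + ML q h z + 4 * gm h h z).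
Proof.
move=> hq hh; have -> : q \+ h = (fun p => 1 * h p + q p).
  by apply/funext => p; rewrite /= mul1r addrC.
apply: filterS2 (P2_lin 1 hh hq) (gm_linl 1 (fun p => 1 * h p + q p) hh hq) => z e1 e2 Oz.
rewrite !ME (e1 Oz) (e2 Oz) /ML /gm.
by move: (P2 h z) (P2 q z) (g0 q z.1) (g0 h z.1) (h z) (q z) => *; ring.
Qed.

Definition KL (n : R) : R := 20 + 128 * KG * n ^+ 2.

Lemma ML_sq q h : H4 a q -> H4 a h -> sq (ML q h) <= KL (N q) * N h ^+ 2.
Proof.
have ar (k n m A B C E F : R) : E <= 2 * C + 2 * F -> F <= 2 * (16 * A) + 2 * (16 * B) ->
    A <= k * n * m -> B <= k * m * n -> C <= 10 * m -> E <= (20 + 128 * k * n) * m.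
  by move=> *; lra.
move=> hq hh; have L1 := P2_L2 hh; have L2' := gm_L2 hq hh; have L3 := gm_L2 hh hq.
have L23 := L2D mO (L2Z mO 4 L2') (L2Z mO 4 L3).
have h1 := Rintegral_sqD_le mO L1 L23.
have h2 := Rintegral_sqD_le mO (L2Z mO 4 L2') (L2Z mO 4 L3).
have sc w : L2O w -> sq (fun z => 4 * w z) = 16 * sq w.
  move=> Lw; rewrite -(RintegralZl _ mO (L2_sq Lw)); apply: eq_Rintegral => z _; ring.
rewrite (sc _ L2') (sc _ L3) in h2.
have h3 := gm_sq hq hh; have h4 := gm_sq hh hq; have h5 := P2_sq hh.
rewrite (_ : sq (ML q h) = \int[leb2 R]_(x in Omega a) (P2 h x + (4 * gm q h x + 4 * gm h q x)) ^+ 2); last first.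
  by apply: eq_Rintegral => z _; rewrite /ML addrA.
exact: ar h1 h2 h3 h4 h5.
Qed.

Lemma hnormD c u w : H4 a u -> H4 a w ->
  N (fun p => c * u p + w p) ^+ 2 =
  N w ^+ 2 + 2 * c * hinner (Omega a) 4 w u + c ^+ 2 * N u ^+ 2.
Proof.
have ar (nz nu nw zz A C uz wz zu zw wu uw : R) : nz = zz -> nu = A -> nw = C ->
    zz = c * uz + wz -> uz = zu -> wz = zw -> zu = c * A + wu -> zw = c * uw + C ->
    uw = wu -> nz = nw + 2 * c * wu + c ^+ 2 * nu.
  by move=> -> -> -> -> -> -> -> -> ->; ring.
move=> hu hw; have hc := H4_lin c hu hw.
exact: ar (hnorm_sq a _) (hnorm_sq a u) (hnorm_sq a w) (hinner_lin c hu hw hc)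
  (hinner_sym a u _) (hinner_sym a w _) (hinner_lin c hu hw hu) (hinner_lin c hu hw hw)
  (hinner_sym a u w).
Qed.

Lemma hinner_cs u w : H4 a u -> H4 a w ->
  hinner (Omega a) 4 u w ^+ 2 <= N u ^+ 2 * N w ^+ 2.
Proof.
move=> hu hw; apply: discriminant_le => t; rewrite -(hnormD t hw hu); exact: sqr_ge0.
Qed.

Section weight.
Variables (alpha lambda : R).
Hypotheses (al0 : 0 < alpha) (la0 : 0 < lambda).
Local Notation psi := (psi alpha lambda).

Lemma psi_gt0 z : 0 < psi z.
Proof. exact: expR_gt0. Qed.

Lemma psi_le1 z : Omega a z -> psi z <= 1.
Proof.
move=> [/andP[x0 _] /andP[t0 _]]; rewrite /Defs.psi -expR0 ler_expR.
have h : 0 <= z.1 + alpha * z.2 by rewrite addr_ge0 ?ltW// mulr_gt0.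
by rewrite !mulNr oppr_le0 -mulrA mulr_ge0// mulr_ge0// ltW.
Qed.

Lemma psi_norm z : Omega a z -> `|psi z| <= 1.
Proof. by move=> Oz; rewrite gtr0_norm ?psi_gt0// psi_le1. Qed.

Lemma measurable_psi (E : set (mR * mR)) : measurable_fun E (psi : mR * mR -> R).
Proof.
apply: measurable_funTS; apply: (measurableT_comp (@measurable_expR R)).
apply: measurable_funM => //; apply: measurable_funD; first exact: measurable_fst.
by apply: measurable_funM => //; exact: measurable_snd.
Qed.

Lemma L2psi u : L2O u -> L2O (fun z => u z * psi z).
Proof. by move=> Lu; exact: (L2Mb mO (@measurable_psi (Omega a)) (@psi_norm) Lu). Qed.

Lemma intble_psi (f : R * R -> R) : intble (leb2 R) (Omega a) f ->
  intble (leb2 R) (Omega a) (fun z => f z * psi z).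
Proof. by move=> Lf; exact: (intbleMb mO (@measurable_psi (Omega a)) (@psi_norm) Lf). Qed.

Lemma sqpsi_le u : L2O u -> \int[leb2 R]_(z in Omega a) (u z ^+ 2 * psi z) <= sq u.
Proof.
move=> Lu; apply: le_Rintegral => //.
- exact: (intble_psi (L2_sq Lu)).
- exact: (L2_sq Lu).
by move=> z Oz; rewrite ler_piMr ?sqr_ge0// psi_le1.
Qed.

(** The part of [K (q + h) - K q] that is linear in [h]; what remains is [remK]. *)
Definition dK gamma q h : R :=
  2 * \int[leb2 R]_(z in Omega a) (M a q z * ML q h z * psi z)
  + 2 * gamma * hinner (Omega a) 4 q h.

Definition remK gamma q h : R :=
  \int[leb2 R]_(z in Omega a) ((ML q h z + 4 * gm h h z) ^+ 2 * psi z)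
  + 8 * \int[leb2 R]_(z in Omega a) (M a q z * gm h h z * psi z)
  + gamma * N h ^+ 2.

Lemma K_expand gamma q h : H4 a q -> H4 a h ->
  K a alpha lambda gamma (q \+ h) =
  K a alpha lambda gamma q + dK gamma q h + remK gamma q h.
Proof.
have ar (T A B C E g N2 n i m : R) : T = A + 2 * B + C + 8 * E ->
    N2 = n + 2 * 1 * i + 1 ^+ 2 * m ->
    T + g * N2 = A + g * n + (2 * B + 2 * g * i) + (C + 8 * E + g * m).
  by move=> -> ->; ring.
move=> hq hh; have LM := M_L2 hq; have LL := ML_L2 hq hh; have Lg := gm_L2 hh hh.
have e0 : q \+ h = (fun p => 1 * h p + q p).
  by apply/funext => p; rewrite /= mul1r addrC.
have hqh : H4 a (q \+ h) by rewrite e0; exact: (H4_lin 1 hh hq).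
have LMh := M_L2 hqh.
have LS := L2D mO LL (L2Z mO 4 Lg).
have i1 := intble_psi (L2_sq LM).
have i2 := intble_psi (L2M mO LM LL).
have i3 := intble_psi (L2_sq LS).
have i4 := intble_psi (L2M mO LM Lg).
have HN := etrans (congr1 (fun u => N u ^+ 2) e0) (hnormD 1 hh hq).
apply: ar HN.
have j1 := intbleD mO i1 (intbleZ mO 2 i2).
have j2 := intbleD mO j1 i3.
have j3 := intbleD mO j2 (intbleZ mO 8 i4).
rewrite -(RintegralZl 2 mO i2) -(RintegralZl 8 mO i4).
rewrite -(RintegralD mO i1 (intbleZ mO 2 i2)) -(RintegralD mO j1 i3).
rewrite -(RintegralD mO j2 (intbleZ mO 8 i4)).
apply: (Rintegral_ae_eq mO (intbleP (intble_psi (L2_sq LMh))) (intbleP j3)).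
apply: filterS (M_add hq hh) => z e Oz; rewrite (e Oz).
by move: (M a q z) (ML q h z) (gm h h z) (psi z) => A B C E; ring.
Qed.

Lemma dK_lin gamma q c u w : H4 a q -> H4 a u -> H4 a w ->
  dK gamma q (fun p => c * u p + w p) = c * dK gamma q u + dK gamma q w.
Proof.
have ar (I A B g k l i j : R) : I = c * A + B -> k = l -> l = c * i + j ->
  2 * I + 2 * g * k = c * (2 * A + 2 * g * i) + (2 * B + 2 * g * j).
  by move=> -> -> ->; ring.
move=> hq hu hw; have LM := M_L2 hq.
have LU := ML_L2 hq hu; have LW := ML_L2 hq hw; have hc := H4_lin c hu hw.
have LC := ML_L2 hq hc.
have i1 := intble_psi (L2M mO LM LU); have i2 := intble_psi (L2M mO LM LW).
have l1 := hinner_lin c hu hw hq; rewrite (hinner_sym a u q) (hinner_sym a w q) in l1.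
apply: ar (hinner_sym a q _) l1.
rewrite -(RintegralZl c mO i1) -(RintegralD mO (intbleZ mO c i1) i2).
apply: (Rintegral_ae_eq mO (intbleP (intble_psi (L2M mO LM LC)))).
  exact: (intbleP (intbleD mO (intbleZ mO c i1) i2)).
apply: filterS (ML_lin q c hu hw) => z e Oz; rewrite (e Oz).
by move: (M a q z) (ML q u z) (ML q w z) (psi z) => A B C E; ring.
Qed.

Lemma psi_cs u w : L2O u -> L2O w ->
  (\int[leb2 R]_(z in Omega a) (u z * w z * psi z)) ^+ 2 <= sq u * sq w.
Proof.
move=> Lu Lw; have Lwp := L2psi Lw.
rewrite (_ : \int[leb2 R]_(z in Omega a) (u z * w z * psi z) =
  \int[leb2 R]_(z in Omega a) (u z * (w z * psi z))); last first.
  by apply: eq_Rintegral => z _; rewrite mulrA.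
apply: le_trans (Rcauchy_schwarz mO Lu Lwp) _; apply: ler_wpM2l; first exact: sq_ge0.
apply: (le_Rintegral mO (L2_sq Lwp) (L2_sq Lw)) => z Oz; rewrite exprMn ler_piMr ?sqr_ge0//.
by rewrite -[leLHS]real_normK ?num_real// exprn_ile1 ?psi_norm.
Qed.

Lemma dK_bounded gamma q : H4 a q -> exists b, forall h, H4 a h ->
  dK gamma q h ^+ 2 <= b * N h ^+ 2.
Proof.
have ar (g A B C E k n m : R) : A ^+ 2 <= C * E -> C * E <= C * (k * m) ->
    g ^+ 2 * B ^+ 2 <= g ^+ 2 * (n * m) ->
    (2 * A + 2 * g * B) ^+ 2 <= 2 * (4 * (C * k) + 4 * g ^+ 2 * n) * m.
  by move=> *; have := sqr_ge0 (2 * A - 2 * g * B); lra.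
move=> hq; exists (2 * (4 * (sq (M a q) * KL (N q)) + 4 * gamma ^+ 2 * N q ^+ 2)) => h hh.
have h1 := psi_cs (M_L2 hq) (ML_L2 hq hh).
have h2 := hinner_cs hq hh.
have h3 := ler_wpM2l (sq_ge0 a (M a q)) (ML_sq hq hh).
have h4 := ler_wpM2l (sqr_ge0 gamma) h2.
exact: ar h1 h3 h4.
Qed.

Lemma ler_sqrt_sq (x c y : R) : 0 <= y -> x ^+ 2 <= c * y ^+ 2 -> `|x| <= Num.sqrt c * y.
Proof.
move=> y0 h; have [c0|c0] := leP 0 c.
  rewrite -(@ler_pXn2r _ 2)// ?nnegrE ?mulr_ge0 ?sqrtr_ge0//.
  by rewrite real_normK ?num_real// exprMn sqr_sqrtr.
have : x ^+ 2 <= 0.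
  by apply: le_trans h _; rewrite nmulr_rle0// sqr_ge0.
rewrite le_eqVlt ltNge sqr_ge0 orbF sqrf_eq0 => /eqP ->.
by rewrite normr0 mulr_ge0 ?sqrtr_ge0.
Qed.

(** The remainder contains the powers 2, 3 and 4 of [h]. *)
Lemma remK_bounded gamma q : H4 a q -> exists C, forall h, H4 a h -> N h <= 1 ->
  `|remK gamma q h| <= C * N h ^+ 2.
Proof.
have ar (A B n I1 I2 I3 k l t g r m : R) : 0 <= I2 -> 0 <= n -> n <= 1 -> 0 <= k ->
    I2 <= I1 -> I1 <= 2 * A + 2 * r -> r = 16 * B -> A <= l * n ->
    B <= k * n * n -> `|I3| <= t * n ->
    `|I2 + 8 * I3 + g * n| <= (2 * l + 32 * k + 8 * t + `|g|) * n.
  move=> I20 n0 n1 k0 h1 h2 hr h3 h4 h5.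
  have h6 : k * n * n <= k * n by rewrite ler_piMr// mulr_ge0.
  have h7 := ler_normD (I2 + 8 * I3) (g * n); rewrite [`|g * n|]normrM (ger0_norm n0) in h7.
  have h8 := ler_normD I2 (8 * I3); rewrite (ger0_norm I20) normrM (ger0_norm (ler0n R 8)) in h8.
  lra.
have ar2 (A B k n : R) : 0 <= A -> B <= k * n ^+ 2 * n ^+ 2 -> A * B <= A * k * (n ^+ 2) ^+ 2.
  by move=> A0 h; apply: le_trans (ler_wpM2l A0 h) _; rewrite expr2 !mulrA.
move=> hq; exists (2 * KL (N q) + 32 * KG + 8 * Num.sqrt (sq (M a q) * KG) + `|gamma|) => h hh Nh.
have LL := ML_L2 hq hh; have Lg := gm_L2 hh hh; have L4 := L2Z mO 4 Lg.
have h5 := gm_sq hh hh.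
have p1 : 0 <= \int[leb2 R]_(z in Omega a) ((ML q h z + 4 * gm h h z) ^+ 2 * psi z).
  by apply: Rintegral_ge0 => z _; apply: mulr_ge0; [exact: sqr_ge0|exact: ltW (psi_gt0 z)].
have p2 : N h ^+ 2 <= 1 by apply: exprn_ile1 => //; exact: hnorm_ge0.
have p3 : sq (fun z => 4 * gm h h z) = 16 * sq (gm h h).
  rewrite -(RintegralZl 16 mO (L2_sq Lg)); apply: eq_Rintegral => z _; rewrite exprMn.
  by congr (_ * _); rewrite -natrX.
have p4 : `|\int[leb2 R]_(z in Omega a) (M a q z * gm h h z * psi z)|
    <= Num.sqrt (sq (M a q) * KG) * N h ^+ 2.
  apply: ler_sqrt_sq; first exact: sqr_ge0.
  exact: le_trans (psi_cs (M_L2 hq) Lg) (ar2 _ _ _ _ (sq_ge0 a _) h5).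
exact: ar p1 (sqr_ge0 _) p2 (ltW KG_gt0) (sqpsi_le (L2D mO LL L4))
  (Rintegral_sqD_le mO LL L4) p3 (ML_sq hq hh) h5 p4.
Qed.

End weight.

End functional.

(** * Completeness of the space of increments *)

Section geometric.
Variable R : realType.

Lemma geometric_small (C e : R) : 0 < e -> exists n, C * 4^-1 ^+ n < e.
Proof.
move=> e0; have c : (fun n => C * 4^-1 ^+ n) @ \oo --> (C * 0 : R).
  apply: cvgM; first exact: cvg_cst.
  by apply: cvg_expr; rewrite ger0_norm ?invr_ge0// invf_lt1// ltr1n.
rewrite mulr0 in c.
have [n _ /(_ n (leqnn n)) h] := cvgr_lt _ c _ e0.
by exists n.
Qed.

Lemma sqr_le_geometric (x C : R) : (forall n, x ^+ 2 <= C * 4^-1 ^+ n) -> x = 0.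
Proof.
move=> h; apply/eqP; rewrite -sqrf_eq0 eq_le sqr_ge0 andbT leNgt; apply/negP => x0.
by have [n] := geometric_small C x0; rewrite ltNge h.
Qed.

End geometric.

Section hilbert.
Variable R : realType.
Local Notation mR := (measurableTypeR R).
Variable a : R.
Hypothesis a0 : 0 < a.
Let X : set mR := `]0, a[%classic.
Let Y : set mR := `]0, 2 * a[%classic.
Let mY : measurable Y. Proof. exact: measurable_itv. Qed.
Let mO := @measurable_Omega R a.
Implicit Types (u v w q h : R * R -> R).
Local Notation N q := (hnorm (Omega a) 4 q).
Local Notation L2O := (L2 (leb2 R) (Omega a)).
Local Notation sq u := (\int[leb2 R]_(z in Omega a) (u z ^+ 2)).

(** Both sides of the definition of a weak derivative are continuous for convergence
    in L^2, by Cauchy-Schwarz. *)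
Lemma is_wder_lim i j (u v : nat -> R * R -> R) u0 v0 (C C' : R) :
  (forall n, L2O (u n)) -> (forall n, is_wder (Omega a) i j (u n) (v n)) -> L2O u0 -> L2O v0 ->
  (forall n, sq (fun z => u0 z - u n z) <= C * 4^-1 ^+ n) ->
  (forall n, sq (fun z => v0 z - v n z) <= C' * 4^-1 ^+ n) ->
  is_wder (Omega a) i j u0 v0.
Proof.
have ar (I J I' J' e A B P Q c c' t : R) : e ^+ 2 = 1 -> I' = e * J' ->
    (I - I') ^+ 2 <= A * P -> (J - J') ^+ 2 <= B * Q -> 0 <= P -> 0 <= Q ->
    A <= c * t -> B <= c' * t ->
    (I - e * J) ^+ 2 <= (2 * (c * P) + 2 * (c' * Q)) * t.
  move=> e1 -> h1 h2 P0 Q0 h3 h4.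
  have h5 := ler_wpM2r P0 h3; have h6 := ler_wpM2r Q0 h4.
  have -> : I - e * J = (I - e * J') - e * (J - J') by ring.
  have h7 := sqr_ge0 ((I - e * J') + e * (J - J')).
  have h8 : (e * (J - J')) ^+ 2 = (J - J') ^+ 2 by rewrite exprMn e1 mul1r.
  move: h7 h8 h1 h2; move: (I - e * J') (e * (J - J')) (J - J') => x y z; nra.
move=> Lu hw Lu0 Lv0 hu hv; split => // phi tphi.
set Dphi := iter i _ _.
have LD : L2O Dphi := L2_continuous a (@test2_continuous R (Omega a) i j phi tphi).
have Lp : L2O phi := L2_continuous a (@test2_continuous R (Omega a) 0 0 phi tphi).
have sgn : ((-1) ^+ (i + j)) ^+ 2 = 1 :> R by rewrite -exprM mulnC exprM sqrrN expr1n expr1n.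
have diff f (f0 g : R * R -> R) : L2O f -> L2O f0 -> L2O g ->
    \int[leb2 R]_(z in Omega a) ((f0 z - f z) * g z) =
    \int[leb2 R]_(z in Omega a) (f0 z * g z) - \int[leb2 R]_(z in Omega a) (f z * g z).
  move=> Lf Lf0 Lg; rewrite -(RintegralB mO (L2M mO Lf0 Lg) (L2M mO Lf Lg)).
  by apply: eq_Rintegral => z _; rewrite mulrBl.
apply/subr0_eq/(@sqr_le_geometric _ _ (2 * (C * sq Dphi) + 2 * (C' * sq phi))) => n.
have [Lvn wn] := hw n.
have h1 := Rcauchy_schwarz mO (L2B mO Lu0 (Lu n)) LD.
have h2 := Rcauchy_schwarz mO (L2B mO Lv0 Lvn) Lp.
rewrite (diff _ _ _ (Lu n) Lu0 LD) in h1; rewrite (diff _ _ _ Lvn Lv0 Lp) in h2.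
exact: ar sgn (wn _ tphi) h1 h2 (sq_ge0 a _) (sq_ge0 a _) (hu n) (hv n).
Qed.

Lemma subfE u w : u \- w = (fun p => -1 * w p + u p).
Proof. by apply/funext => p; rewrite /= mulN1r addrC. Qed.

Lemma H4B u w : H4 a u -> H4 a w -> H4 a (u \- w).
Proof. by move=> hu hw; rewrite subfE; exact: (H4_lin (-1) hw hu). Qed.

Lemma H4_0 : H4 a (fun=> 0).
Proof.
split; first exact: L20.
move=> i j _; exists (fun=> 0); split; first exact: L20.
move=> phi _; rewrite [X in X = _](_ : _ = \int[leb2 R]_(p in Omega a) 0); last first.
  by apply: eq_Rintegral => z _; rewrite mul0r.
rewrite [X in _ = _ * X](_ : _ = \int[leb2 R]_(p in Omega a) 0); last first.
  by apply: eq_Rintegral => z _; rewrite mul0r.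
by rewrite Rintegral_cst// mul0r mulr0.
Qed.

(** The three boundary operators of [H04], with the two properties that make
    the conditions linear and closed. *)
Definition continuous_trace (tr : (R * R -> R) -> R -> R) :=
  (forall c u w, H4 a u -> H4 a w ->
     ae_eq (leb1 R) Y (tr (fun p => c * u p + w p)) (fun t => c * tr u t + tr w t)) /\
  exists2 k : R, 0 <= k & forall u, H4 a u -> L2 (leb1 R) Y (tr u) /\
     \int[leb1 R]_(t in Y) (tr u t ^+ 2) <= k * N u ^+ 2.

Lemma ctrace_x0 : continuous_trace (tr_x0 a).
Proof.
have ar (k A B n : R) : 0 <= k -> A <= n -> B <= n -> k * (A + B) <= 2 * k * n by nra.
split => [c u w hu hw|].
  have hc := H4_lin c hu hw.
  have [h _] := xtraces_lin a0 (H4_Wxq hu) (H4_Wxq hw) (H4_Wxq hc)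
    (aeW _ (fun z => fun=> erefl)) (@D_lin _ _ c u w 1 0 hu hw isT).
  exact: h.
have k0 := ltW (Ktr_gt0 a0); exists (2 * Ktr a) => [|u hu]; first by rewrite mulr_ge0.
have [h _ h1 _] := xtraces_L2 a0 (H4_Wxq hu); split => //; apply: le_trans h1 _.
exact: ar k0 (q_le hu) (@D_le _ a u 1 0 isT).
Qed.

Lemma ctrace_Dx : continuous_trace (fun u => tr_x0 a (Dx a u)) /\
  continuous_trace (fun u => tr_xa a (Dx a u)).
Proof.
have ar (k A B n : R) : 0 <= k -> A <= n -> B <= n -> k * (A + B) <= 2 * k * n by nra.
have k0 := ltW (Ktr_gt0 a0).
have lin c u w : H4 a u -> H4 a w -> _ :=
  fun hu hw => xtraces_lin a0 (@H4_Wx _ a u 1 0 hu isT) (@H4_Wx _ a w 1 0 hw isT)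
    (@H4_Wx _ a _ 1 0 (H4_lin c hu hw) isT)
    (@D_lin _ _ c u w 1 0 hu hw isT) (@D_lin _ _ c u w 2 0 hu hw isT).
split; (split => [c u w hu hw|]; first by have [h1 h2] := lin c u w hu hw);
  (exists (2 * Ktr a) => [|u hu]; first by rewrite mulr_ge0);
  have [h h' h1 h2] := xtraces_L2 a0 (@H4_Wx _ a u 1 0 hu isT).
- split; [exact: h|apply: le_trans h1 _].
  exact: ar k0 (@D_le _ a u 1 0 isT) (@D_le _ a u 2 0 isT).
- split; [exact: h'|apply: le_trans h2 _].
  exact: ar k0 (@D_le _ a u 1 0 isT) (@D_le _ a u 2 0 isT).
Qed.

(** The mean square distance of [tr q] to [s] is that of [tr q] to [tr p], hence at
    most a multiple of the squared norm of [q - p]. *)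
Lemma trace_closed tr (s : R -> R) q : continuous_trace tr -> H4 a q ->
  (forall eps : R, 0 < eps -> exists p, [/\ H4 a p, ae_eq (leb1 R) Y (tr p) s & N (q \- p) < eps]) ->
  ae_eq (leb1 R) Y (tr q) s.
Proof.
have ar (k I n e : R) : 0 <= k -> 0 <= n -> n < e -> 0 < e -> I <= k * n ^+ 2 -> I <= k * e ^+ 2.
  move=> k0 n0 ne e0 h; apply: le_trans h _; apply: ler_wpM2l => //.
  by rewrite lerXn2r ?nnegrE// ltW.
move=> [lin [k k0 bd]] hq hcl; have [p1 [hp1 e1 _]] := hcl 1 ltr01.
have [Lq _] := bd _ hq; have [Lp _] := bd _ hp1; have Ld := L2B mY Lq Lp.
suff h : ae_eq (leb1 R) Y (fun t => (tr q t - tr p1 t) ^+ 2) (fun=> 0).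
  apply: filterS2 h e1 => t h1 h2 Yt; rewrite -(h2 Yt); apply/subr0_eq/eqP.
  by rewrite -sqrf_eq0 (h1 Yt).
apply: (Rintegral_eq0_ae mY (L2_sq Ld)) => [t _|]; first exact: sqr_ge0.
rewrite leNgt; apply/negP; set I := Rintegral _ _ _ => I0.
pose e := Num.sqrt (I / (2 * (k + 1))).
have q0 : 0 < I / (2 * (k + 1)) by rewrite divr_gt0// mulr_gt0// ltr_wpDl.
have e0 : 0 < e by rewrite sqrtr_gt0.
have [p [hp ep np]] := hcl _ e0.
have hqp := H4B hq hp; have [Lqp b] := bd _ hqp.
have eI : I = \int[leb1 R]_(t in Y) (tr (q \- p) t ^+ 2).
  apply: (Rintegral_ae_eq mY (intbleP (L2_sq Ld)) (intbleP (L2_sq Lqp))).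
  have l := lin (-1) p q hp hq; rewrite -subfE in l.
  apply: filterS3 l e1 ep => t l1 l2 l3 Yt; rewrite (l1 Yt) (l2 Yt) (l3 Yt) mulN1r addrC.
  by [].
rewrite -eI in b; have := ar _ _ _ _ k0 (hnorm_ge0 a _) np e0 b.
rewrite /e (sqr_sqrtr (ltW q0)).
have er : I / (2 * (k + 1)) * (2 * (k + 1)) = I by rewrite divfK// gt_eqF// mulr_gt0// ltr_wpDl.
move: I {Lqp b eI e e0 np I0} q0 er => I; move: (I / _) => r r0 <-; nra.
Qed.

Lemma H04_lin c u w : H04 a u -> H04 a w -> H04 a (fun p => c * u p + w p).
Proof.
move=> [hu u1 u2 u3] [hw w1 w2 w3].
have [l1 _] := ctrace_x0; have [[l2 _] [l3 _]] := ctrace_Dx.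
split; first exact: H4_lin.
- by apply: filterS3 (l1 c _ _ hu hw) u1 w1 => t e1 e2 e3 Yt;
    rewrite (e1 Yt) (e2 Yt) (e3 Yt) mulr0 addr0.
- by apply: filterS3 (l2 c _ _ hu hw) u2 w2 => t e1 e2 e3 Yt;
    rewrite (e1 Yt) (e2 Yt) (e3 Yt) mulr0 addr0.
- by apply: filterS3 (l3 c _ _ hu hw) u3 w3 => t e1 e2 e3 Yt;
    rewrite (e1 Yt) (e2 Yt) (e3 Yt) mulr0 addr0.
Qed.

Lemma H04_0 : H04 a (fun=> 0).
Proof.
have [l1 _] := ctrace_x0; have [[l2 _] [l3 _]] := ctrace_Dx.
have e : (fun=> 0) = (fun p : R * R => -1 * (fun=> 0) p + (fun=> 0) p) :> (R * R -> R).
  by apply/funext => p; rewrite mulr0 addr0.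
split; first exact: H4_0.
- rewrite e; apply: filterS (l1 (-1) _ _ H4_0 H4_0) => t h Yt.
  by rewrite (h Yt) mulN1r addNr.
- rewrite e; apply: filterS (l2 (-1) _ _ H4_0 H4_0) => t h Yt.
  by rewrite (h Yt) mulN1r addNr.
- rewrite e; apply: filterS (l3 (-1) _ _ H4_0 H4_0) => t h Yt.
  by rewrite (h Yt) mulN1r addNr.
Qed.

End hilbert.

(** * The derivative of the functional *)

Section derivative.
Variable R : realType.
Local Notation mR := (measurableTypeR R).
Variable a : R.
Hypothesis a0 : 0 < a.
Let Y : set mR := `]0, 2 * a[%classic.
Let mO := @measurable_Omega R a.
Let oO := @open_Omega R a.
Let i1O := @intble1_Omega R a.
Implicit Types (u v w q h : R * R -> R).
Local Notation D i j q := (wder (Omega a) i j q).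
Local Notation N q := (hnorm (Omega a) 4 q).
Local Notation L2O := (L2 (leb2 R) (Omega a)).
Local Notation sq u := (\int[leb2 R]_(z in Omega a) (u z ^+ 2)).
Local Notation ip := (hinner (Omega a) 4).

(** All weak derivatives of a fast Cauchy sequence converge in L^2, and their
    limits are the weak derivatives of the limit. *)
Lemma H4_complete (x : nat -> R * R -> R) (C : R) : (forall n, H4 a (x n)) ->
  (forall n, ip (fun p => -1 * x n p + x n.+1 p) (fun p => -1 * x n p + x n.+1 p)
             <= C * 8^-1 ^+ n) ->
  exists2 g, H4 a g & exists C', forall n,
    ip (fun p => -1 * x n p + g p) (fun p => -1 * x n p + g p) <= C' * 4^-1 ^+ n.
Proof.
move=> hx hC.
have lim (ij : nat * nat) : exists vC : (R * R -> R) * R, (ij.1 + ij.2 <= 4)%N ->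
    L2O vC.1 /\ forall n, sq (fun z => vC.1 z - D ij.1 ij.2 (x n) z) <= vC.2 * 4^-1 ^+ n.
  case: ij => i j /=; case: (boolP (i + j <= 4)%N) => ij; last by exists (fun=> 0, 0).
  have [||F [LF [C' hC']]] := @L2_fast_cauchy _ _ _ (leb2 R) (Omega a) mO
      (fun n => D i j (x n)) C.
  - by move=> n; exact: H4_L2.
  - move=> n; apply: le_trans (hC n); rewrite -hnorm_sq.
    apply: le_trans (@D_le _ a _ i j ij); rewrite le_eqVlt; apply/orP; left; apply/eqP.
    have hd := H4_lin (-1) (hx n) (hx n.+1).
    apply: (Rintegral_ae_eq mO).
    + exact: (intbleP (L2_sq (L2B mO (H4_L2 (hx n.+1) ij) (H4_L2 (hx n) ij)))).
    + exact: (intbleP (L2_sq (H4_L2 hd ij))).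
    apply: filterS (D_lin (-1) (hx n) (hx n.+1) ij) => z e Oz.
    by rewrite (e Oz) mulN1r addrC.
  by exists (F, C').
have [vC hv] := choice lim.
pose v i j := (vC (i, j)).1; pose c i j := (vC (i, j)).2.
have Lv i j : (i + j <= 4)%N -> L2O (v i j) by move=> ij; have [] := hv (i, j) ij.
have cv i j n : (i + j <= 4)%N -> sq (fun z => v i j z - D i j (x n) z) <= c i j * 4^-1 ^+ n.
  by move=> ij; have [_ h] := hv (i, j) ij; exact: h.
have L0 := Lv 0 0 isT.
have wv i j : (i + j <= 4)%N -> is_wder (Omega a) i j (v 0 0) (v i j).
  move=> ij; apply: (is_wder_lim (fun n => H4_L2q (hx n)) (fun n => H4_wder (hx n) ij) L0 (Lv _ _ ij) _
    (fun n => cv i j n ij)) => n.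
  apply: le_trans (cv 0 0 n isT); rewrite le_eqVlt; apply/orP; left; apply/eqP.
  have Ln := H4_L2q (hx n).
  apply: (Rintegral_ae_eq mO (intbleP (L2_sq (L2B mO L0 Ln)))).
    exact: (intbleP (L2_sq (L2B mO L0 (@H4_L2 _ _ _ 0 0 (hx n) isT)))).
  by apply: filterS (D00 Ln) => z e Oz; rewrite (e Oz).
have hg : H4 a (v 0 0) by split => // i j ij; exists (v i j); exact: wv.
exists (v 0 0) => //.
exists (\sum_(i < 5) \sum_(j < 5 | (i + j <= 4)%N) c i j) => n.
rewrite /hinner mulr_suml; apply: ler_sum => i _; rewrite mulr_suml; apply: ler_sum => j ij.
apply: le_trans (cv i j n ij); rewrite le_eqVlt; apply/orP; left; apply/eqP.
have Ld := H4_L2 (H4_lin (-1) (hx n) hg) ij.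
apply: (Rintegral_ae_eq mO (intbleP (L2M mO Ld Ld))).
  exact: (intbleP (L2_sq (L2B mO (Lv _ _ ij) (H4_L2 (hx n) ij)))).
apply: filterS2 (D_lin (-1) (hx n) hg ij) (wder_ae oO i1O (wv _ _ ij)) => z e1 e2 Oz.
by rewrite (e1 Oz) (e2 Oz) -expr2 mulN1r addrC.
Qed.

Lemma H04_complete (x : nat -> R * R -> R) (C : R) : (forall n, H04 a (x n)) ->
  (forall n, ip (fun p => -1 * x n p + x n.+1 p) (fun p => -1 * x n p + x n.+1 p)
             <= C * 8^-1 ^+ n) ->
  exists2 g, H04 a g & exists C', forall n,
    ip (fun p => -1 * x n p + g p) (fun p => -1 * x n p + g p) <= C' * 4^-1 ^+ n.
Proof.
have ar (n e i : R) : 0 <= n -> 0 < e -> n ^+ 2 = i -> i < e ^+ 2 -> n < e.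
  by move=> n0 e0 <-; rewrite ltr_pXn2r// nnegrE// ltW.
move=> hx hC; have hx4 n : H4 a (x n) by have [] := hx n.
have [g hg [C' hC']] := H4_complete hx4 hC.
exists g; last by exists C'.
have near0 (tr : (R * R -> R) -> R -> R) : (forall n, ae_eq (leb1 R) Y (tr (x n)) (fun=> 0)) -> forall eps : R, 0 < eps ->
    exists p, [/\ H4 a p, ae_eq (leb1 R) Y (tr p) (fun=> 0) & N (g \- p) < eps].
  move=> tr0 eps eps0; have [n hn] := geometric_small C' (exprn_gt0 2 eps0).
  exists (x n); split => //.
  apply: (ar _ _ _ (hnorm_ge0 a _) eps0 (hnorm_sq a _)).
  by rewrite subfE; exact: le_lt_trans (hC' n) hn.
have [c2 c3] := ctrace_Dx a0.
split => //.
- have hn n : ae_eq (leb1 R) Y (tr_x0 a (x n)) (fun=> 0) by have [_ h1 _ _] := hx n; exact: h1.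
  exact: (trace_closed (ctrace_x0 a0) hg (near0 (tr_x0 a) hn)).
- have hn n : ae_eq (leb1 R) Y (tr_x0 a (Dx a (x n))) (fun=> 0)
    by have [_ _ h2 _] := hx n; exact: h2.
  exact: (trace_closed c2 hg (near0 (fun u => tr_x0 a (Dx a u)) hn)).
- have hn n : ae_eq (leb1 R) Y (tr_xa a (Dx a (x n))) (fun=> 0)
    by have [_ _ _ h3] := hx n; exact: h3.
  exact: (trace_closed c3 hg (near0 (fun u => tr_xa a (Dx a u)) hn)).
Qed.

Section functional_derivative.
Variables (alpha lambda gamma : R).
Hypotheses (al0 : 0 < alpha) (la0 : 0 < lambda).
Local Notation dK := (dK a alpha lambda gamma).
Local Notation J := (K a alpha lambda gamma).

Lemma dK_riesz q : H4 a q -> exists2 g, H04 a g & forall h, H04 a h -> dK q h = ip g h.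
Proof.
move=> hq; have [b hb] := dK_bounded a0 al0 la0 gamma hq.
have h4 h : H04 a h -> H4 a h by case.
apply: (@riesz_representation R _ (H04 a) ip (dK q) b).
- exact: H04_0.
- by move=> c u w; exact: H04_lin.
- exact: hinner_sym.
- by move=> c u w h /h4 hu /h4 hw /h4 hh; exact: hinner_lin.
- exact: hinner_ge0.
- by move=> c u w /h4 hu /h4 hw; exact: dK_lin.
- by move=> h /h4 hh; rewrite -hnorm_sq; exact: hb.
- by move=> x hx [C hC]; exact: (H04_complete hx hC).
Qed.

(** The functional [dK] is linear and bounded, and the remainder is of second order. *)
Lemma dK_frechet q (ell : (R * R -> R) -> R) : H4 a q ->
  (forall h, H04 a h -> ell h = dK q h) -> frechet_derivative a J q ell.
Proof.
have ar (A B C x n e : R) : 0 <= n -> 0 < e -> n < Num.min 1 (e / (`|C| + 1)) ->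
    A = B + x + (A - B - x) -> `|A - B - x| <= C * n ^+ 2 -> `|A - B - x| <= e * n.
  move=> n0 e0; rewrite lt_min => /andP[_]; rewrite ltr_pdivlMr ?ltr_wpDl// => h _ h2.
  apply: le_trans h2 _; rewrite expr2 mulrA ler_wpM2r//.
  by have := ler_norm C; nra.
have ar2 (A B x r : R) : A = B + x + r -> A - B - x = r by lra.
have ar3 (c A B C A' B' C' : R) : A = A' -> B = B' -> C = C' ->
  A' = c * B' + C' -> A = c * B + C by move=> -> -> ->.
move=> hq ellE; have h4 h : H04 a h -> H4 a h by case.
split.
- move=> c u w hu hw; exact: ar3 (ellE _ (H04_lin a0 c hu hw)) (ellE _ hu) (ellE _ hw)
    (dK_lin a0 al0 la0 gamma c hq (h4 _ hu) (h4 _ hw)).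
- have [b hb] := dK_bounded a0 al0 la0 gamma hq.
  exists (Num.sqrt b) => h hh; rewrite (ellE _ hh); apply: ler_sqrt_sq; first exact: hnorm_ge0.
  exact: hb (h4 _ hh).
move=> eps eps0; have [C hC] := remK_bounded a0 al0 la0 gamma hq.
exists (Num.min 1 (eps / (`|C| + 1))).
  by rewrite lt_min ltr01 divr_gt0// ltr_wpDl.
move=> h hh hN; rewrite (ellE _ hh); have h4h := h4 _ hh.
have E := ar2 _ _ _ _ (K_expand a0 al0 la0 gamma hq h4h).
apply: (ar _ _ C _ _ _ (hnorm_ge0 a h) eps0 hN); first by rewrite E; exact: K_expand.
rewrite E; apply: hC => //; move: hN; rewrite lt_min => /andP[hN _]; exact: ltW.
Qed.

(** Scaling an increment shows that a linear functional which is o(h) vanishes. *)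
Lemma frechet_uniq q (ell : (R * R -> R) -> R) h : H4 a q -> H04 a h ->
  frechet_derivative a J q ell -> ell h = dK q h.
Proof.
have ar (A B x y m t e : R) : 0 < t -> `|A - B - t * x| <= e * (t * m) ->
    `|A - B - t * y| <= e * (t * m) -> `|x - y| <= 2 * e * m.
  move=> t0 h1 h2; have h3 := ler_normB (A - B - t * y) (A - B - t * x).
  rewrite (_ : _ - _ - (A - B - t * x) = t * (x - y)) in h3; last by ring.
  rewrite normrM (gtr0_norm t0) in h3.
  by rewrite -(ler_pM2l t0); lra.
have fin (x m e : R) : 0 <= m -> 0 < x -> e = x / (4 * (m + 1)) -> x <= 2 * e * m -> False.
  move=> m0 x0 -> l1; have : x * (4 * (m + 1)) <= 2 * x * m.
    rewrite -ler_pdivlMr ?mulr_gt0 ?ltr_wpDl//; apply: le_trans l1 _.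
    by rewrite le_eqVlt; apply/orP; left; apply/eqP; ring.
  nra.
have scl (f : (R * R -> R) -> R) t : (forall (c : R) u w, H04 a u -> H04 a w ->
    f (fun p => c * u p + w p) = c * f u + f w) -> H04 a h ->
    f (fun p => t * h p + 0) = t * f h.
  move=> lin hh; have : f (fun=> -1 * 0 + 0) = -1 * f (fun=> 0) + f (fun=> 0).
    exact: (lin (-1) _ _ (H04_0 a0) (H04_0 a0)).
  rewrite mulr0 addr0 mulN1r addNr => z.
  by have := lin t _ _ hh (H04_0 a0); rewrite z addr0.
move=> hq hh [lin1 _ F1]; have [lin2 _ F2] := @dK_frechet q (dK q) hq (fun _ _ => erefl).
have Nt t : 0 < t -> N (fun p => t * h p + 0) = t * N h.
  have ar0 (n m i A : R) : 0 <= n -> 0 <= m -> 0 < t -> A = 0 -> i ^+ 2 <= A * m ^+ 2 ->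
      n ^+ 2 = A + 2 * t * i + t ^+ 2 * m ^+ 2 -> n = t * m.
    move=> n0 m0 t0 ->; rewrite mul0r => i0 h1; have i00 : i = 0.
      by apply/eqP; rewrite -sqrf_eq0 eq_le i0 sqr_ge0.
    apply/eqP; rewrite -(@eqrXn2 _ 2)// ?mulr_ge0//; last exact: ltW.
    by rewrite h1 i00 exprMn; apply/eqP; ring.
  move=> t0; have [h4h _ _ _] := hh; have h0 := H4_0 a.
  have n0 : N (fun=> 0) ^+ 2 = 0.
    have : ip (fun=> -1 * 0 + 0) (fun=> 0) = -1 * ip (fun=> 0) (fun=> 0) + ip (fun=> 0) (fun=> 0).
      exact: (hinner_lin (-1) h0 h0 h0).
    by rewrite mulr0 addr0 mulN1r addNr hnorm_sq.
  exact: ar0 (hnorm_ge0 a _) (hnorm_ge0 a _) t0 n0 (hinner_cs h0 h4h) (hnormD t h4h h0).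
have Ht t : H04 a (fun p => t * h p + 0) := H04_lin a0 t hh (H04_0 a0).
apply/subr0_eq/eqP; rewrite -normr_eq0 eq_le normr_ge0 andbT leNgt; apply/negP => d0.
set x := ell h - dK q h in d0 *.
pose m := N h; have m0 : 0 <= m := hnorm_ge0 a h.
pose e := `|x| / (4 * (m + 1)).
have e0 : 0 < e by rewrite divr_gt0// mulr_gt0// ltr_wpDl.
have [d1 d10 G1] := F1 _ e0; have [d2 d20 G2] := F2 _ e0.
pose t := Num.min d1 d2 / (2 * (m + 1)).
have dm0 : 0 < Num.min d1 d2 by rewrite lt_min d10.
have t0 : 0 < t by rewrite divr_gt0// mulr_gt0// ltr_wpDl.
have tm : t * m < Num.min d1 d2.
  rewrite /t mulrAC ltr_pdivrMr ?mulr_gt0 ?ltr_wpDl//; nra.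
have n1 : N (fun p => t * h p + 0) < d1.
  by rewrite (Nt _ t0); apply: lt_le_trans tm _; rewrite ge_min lexx.
have n2 : N (fun p => t * h p + 0) < d2.
  by rewrite (Nt _ t0); apply: lt_le_trans tm _; rewrite ge_min lexx orbT.
have g1 := G1 _ (Ht t) n1; have g2 := G2 _ (Ht t) n2.
rewrite (scl _ _ lin1 hh) (Nt _ t0) in g1; rewrite (scl _ _ lin2 hh) (Nt _ t0) in g2.
exact: fin m0 d0 (erefl e) (ar _ _ _ _ _ _ _ t0 g1 g2).
Qed.

End functional_derivative.
End derivative.

(** * Lower bound of the quadratic remainder *)

Section lower_bound.
Variable R : realType.
Local Notation mR := (measurableTypeR R).
Variable a : R.
Hypothesis a0 : 0 < a.
Let X : set mR := `]0, a[%classic.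
Let Y : set mR := `]0, 2 * a[%classic.
Let mX : measurable X. Proof. exact: measurable_itv. Qed.
Let mY : measurable Y. Proof. exact: measurable_itv. Qed.
Let T0 : 0 < 2 * a. Proof. by rewrite mulr_gt0. Qed.
Let mO := @measurable_Omega R a.
Implicit Types (u v w q h : R * R -> R).
Local Notation N q := (hnorm (Omega a) 4 q).
Local Notation L2O := (L2 (leb2 R) (Omega a)).
Local Notation g0 := (g0 a).
Local Notation gm := (gm a).
Local Notation P2 := (P2 a).
Local Notation ML := (ML a).

Lemma H04_H02 h : H04 a h -> H02 a h.
Proof.
move=> [[Lh hh] h1 h2 _]; split => //; split => // i j ij; apply: hh.
exact: leq_trans ij _.
Qed.

Definition KM (d : R) : R := 3 * (KB a * d ^+ 2 * (5 + 16 * (KS a * d ^+ 2))).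

Lemma KS_ge0 : 0 <= KS a.
Proof. by rewrite /KS !mulr_ge0// ltW// Ktr_gt0. Qed.

(** [M q] is a sum of products of a bounded function of [x] and functions with
    bounded slices. *)
Lemma M_slice q d : H4 a q -> N q <= d ->
  {ae leb1 R, forall x, X x -> \int[leb1 R]_(t in Y) (M a q (x, t) ^+ 2) <= KM d}.
Proof.
have ar (n b s e A B C g I : R) : 0 <= n -> n <= e -> 0 <= b -> 0 <= s -> 0 <= C ->
    A <= b * n ^+ 2 -> B <= b * n ^+ 2 -> C <= b * n ^+ 2 -> g <= s * n ^+ 2 ->
    I <= 3 * (A + 4 * B + 16 * g * C) ->
    I <= 3 * (b * e ^+ 2 * (5 + 16 * (s * e ^+ 2))).
  move=> n0 ne b0 s0 C0 hA hB hC hg h.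
  have ne2 : n ^+ 2 <= e ^+ 2 by rewrite lerXn2r// nnegrE// (le_trans n0).
  have h1 : b * n ^+ 2 <= b * e ^+ 2 by rewrite ler_wpM2l.
  have h2 : s * n ^+ 2 <= s * e ^+ 2 by rewrite ler_wpM2l.
  have n20 : 0 <= s * n ^+ 2 by rewrite mulr_ge0 ?sqr_ge0.
  have h3 : g * C <= s * e ^+ 2 * (b * e ^+ 2).
    apply: (@le_trans _ _ (s * e ^+ 2 * C)); first by rewrite ler_wpM2r// (le_trans hg).
    by rewrite ler_wpM2l ?(le_trans hC)// mulr_ge0// sqr_ge0.
  lra.
have ar2 (A B g C : R) : (A - 2 * B + 4 * g * C) ^+ 2 <=
    3 * (A ^+ 2 + 4 * B ^+ 2 + 16 * g ^+ 2 * C ^+ 2).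
  have e1 := sqr_ge0 (A + 2 * B); have e2 := sqr_ge0 (A - 4 * g * C).
  have e3 := sqr_ge0 (2 * B + 4 * g * C); lra.
move=> hq Nd; have L20 := @H4_L2 _ _ q 2 0 hq isT; have L11 := @H4_L2 _ _ q 1 1 hq isT.
have Lq := H4_L2q hq; have LM := M_L2 a0 hq; rewrite OmegaE in L20 L11 Lq LM.
have s1 := intble_sections1 mX mY (L2_sq L20); have s2 := intble_sections1 mX mY (L2_sq L11).
have s3 := intble_sections1 mX mY (L2_sq Lq); have s4 := intble_sections1 mX mY (L2_sq LM).
have b1 := slice_bound a0 (i := 2) (j := 0) hq isT.
have b2 := slice_bound a0 (i := 1) (j := 1) hq isT.
have b3 := slice_bound_q a0 hq; have b4 := trace_sup_bound a0 hq.
apply: filterS3 (filterI s1 s2) (filterI s3 s4) (filterI (filterI b1 b2) (filterI b3 b4)).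
move=> x [i1 i2] [i3 i4] [[c1 c2] [c3 c4]] Xx.
apply: (ar _ _ _ _ _ _ _ _ _ (hnorm_ge0 a q) Nd (ltW (KB_gt0 a0)) KS_ge0 _
  (c1 Xx) (c2 Xx) (c3 Xx) (c4 Xx)).
  by apply: Rintegral_ge0 => t _; exact: sqr_ge0.
have j2 := intbleZ mY 4 (i2 Xx); have j3 := intbleZ mY (16 * g0 q x ^+ 2) (i3 Xx).
have j12 := intbleD mY (i1 Xx) j2; have j123 := intbleD mY j12 j3.
rewrite -(RintegralZl _ mY (i2 Xx)) -(RintegralZl _ mY (i3 Xx)).
rewrite -(RintegralD mY (i1 Xx) j2) -(RintegralD mY j12 j3) -(RintegralZl 3 mY j123).
apply: (le_Rintegral mY (i4 Xx) (intbleZ mY 3 j123)) => t _.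
exact: ar2.
Qed.

Section weight.
Variables (alpha lambda : R).
Hypotheses (al0 : 0 < alpha) (la0 : 0 < lambda).
Local Notation psi := (psi alpha lambda).

Lemma psi_le_x z : Omega a z -> psi z <= expR (- lambda * z.1) ^+ 2.
Proof.
move=> [_ /andP[t0 _]]; rewrite -expRM_natl /Defs.psi ler_expR mulrDr.
have : 0 <= lambda * (alpha * z.2) by rewrite !mulr_ge0// ltW.
lra.
Qed.

Lemma measurable_expx (E : set mR) : measurable_fun E (fun x : mR => expR (- lambda * x) : mR).
Proof.
apply: measurable_funTS; apply: (measurableT_comp (@measurable_expR R)).
by apply: measurable_funM.
Qed.

Lemma expx_le1 x : X x -> `|expR (- lambda * x)| <= 1.
Proof.
rewrite /X /= in_itv /= => /andP[x0 _]; rewrite gtr0_norm ?expR_gt0//.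
by rewrite -expR0 ler_expR mulNr oppr_le0 mulr_ge0// ltW.
Qed.

Lemma expx_sq x : expR (- lambda * x) ^+ 2 = expR (- 2 * lambda * x).
Proof. by rewrite -expRM_natl; congr expR; ring. Qed.

Lemma intble_expx (f : R -> R) : L2 (leb1 R) X f ->
  intble (leb1 R) X (fun x => f x ^+ 2 * expR (- 2 * lambda * x)).
Proof.
move=> Lf; have := L2_sq (L2Mb mX (@measurable_expx X) expx_le1 Lf).
by apply: (eq_intble mX) => x _; rewrite exprMn expx_sq.
Qed.

(** The weight is at most [exp(-2 lambda x)], so it may be attached to the trace before
    the integration in [t]. *)
Lemma weighted_slice h w S : H4 a h -> L2O w ->
  {ae leb1 R, forall x, X x -> \int[leb1 R]_(t in Y) (w (x, t) ^+ 2) <= S} ->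
  L2O (gm h w) /\
  \int[leb2 R]_(z in Omega a) (gm h w z ^+ 2 * psi z) <=
  S * \int[leb1 R]_(x in X) (g0 h x ^+ 2 * expR (- 2 * lambda * x)).
Proof.
move=> hh Lw wS; have Lg := g0_L2 a0 hh; have gB := trace_sup_bound a0 hh.
have [Lgw _] := slice_mul Lg gB Lw wS.
split; first exact: Lgw.
pose G x := g0 h x * expR (- lambda * x).
have LG : L2 (leb1 R) X G := L2Mb mX (@measurable_expx X) expx_le1 Lg.
have [|LGw b] := slice_mul (G := G) (B := KS a * N h ^+ 2) LG _ Lw wS.
  apply: filterS gB => x hx Xx; apply: le_trans (hx Xx); rewrite /G exprMn ler_piMr ?sqr_ge0//.
  by rewrite exprn_ile1 ?expR_ge0//; apply: le_trans (expx_le1 Xx); exact: ler_norm.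
have -> : \int[leb1 R]_(x in X) (g0 h x ^+ 2 * expR (- 2 * lambda * x)) =
    \int[leb1 R]_(x in X) (G x ^+ 2).
  by apply: eq_Rintegral => x _; rewrite /G exprMn expx_sq.
apply: le_trans b.
apply: (le_Rintegral mO (intble_psi al0 la0 (L2_sq Lgw)) (L2_sq LGw)) => z Oz.
rewrite /G /gm /=; have := psi_le_x Oz; move: (psi z) (expR _) (g0 h z.1) (w z) => p e g y pe.
rewrite [leRHS](_ : _ = (g * y) ^+ 2 * e ^+ 2); last by ring.
by rewrite ler_wpM2l// sqr_ge0.
Qed.

Lemma weighted_trace q h d : H4 a q -> N q <= d -> H4 a h ->
  \int[leb2 R]_(z in Omega a) (gm q h z ^+ 2 * psi z) <=
  KS a * d ^+ 2 * \int[leb2 R]_(z in Omega a) (h z ^+ 2 * psi z).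
Proof.
have ar (g n s e y p : R) : 0 <= n -> n <= e -> 0 <= s -> g ^+ 2 <= s * n ^+ 2 -> 0 < p ->
    (g * y) ^+ 2 * p <= s * e ^+ 2 * (y ^+ 2 * p).
  move=> n0 ne s0 h1 p0; rewrite (_ : (g * y) ^+ 2 * p = g ^+ 2 * (y ^+ 2 * p)); last by ring.
  apply: ler_wpM2r; first by rewrite mulr_ge0 ?sqr_ge0// ltW.
  by apply: le_trans h1 _; rewrite ler_wpM2l// lerXn2r// nnegrE// (le_trans n0).
move=> hq Nd hh; have i1 := intble_psi al0 la0 (L2_sq (H4_L2q hh)).
have Lg := gm_L2 a0 hq hh.
rewrite -(RintegralZl _ mO i1).
apply: (le_Rintegral_ae mO (intble_psi al0 la0 (L2_sq Lg)) (intbleZ mO _ i1)).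
apply: filterS (ae_fst (@lebesgue_measure R) (trace_sup_bound a0 hq)) => -[x t] /= b Oz.
have Xx : X x by move: Oz; rewrite OmegaE => -[].
exact: ar (hnorm_ge0 a q) Nd KS_ge0 (b Xx) (psi_gt0 _ _ _).
Qed.

(** The quadratic remainder of the functional is bounded below by the Carleman
    estimate applied to the increment: the terms that perturb the principal part
    are, after integration in [t] alone, of the order of the Carleman terms
    without their powers of [lambda]. *)
Lemma remK_lower (C l0 gamma d : R) q h : 0 < C -> carleman_estimate a alpha C l0 ->
  l0 <= lambda -> 1 <= lambda ->
  32 * (KS a * d ^+ 2) + 4 <= C / 4 * lambda ->
  32 * (KB a * d ^+ 2) + 4 * KM d <= C / 4 * lambda ->
  2 * C * Ktr (2 * a) * lambda ^+ 3 * expR (- lambda * alpha * (2 * a)) <= 1 ->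
  2 * expR (- lambda * alpha * (2 * a)) <= gamma ->
  H4 a q -> N q <= d -> H4 a (q \+ h) -> N (q \+ h) <= d -> H04 a h ->
  C / 4 * (\int[leb2 R]_(z in Omega a) ((Dx a h z ^+ 2 + Dt a h z ^+ 2) * psi z)
         + \int[leb2 R]_(z in Omega a) (h z ^+ 2 * psi z)
         + \int[leb1 R]_(x in X) (g0 h x ^+ 2 * expR (- 2 * lambda * x))
         + \int[leb1 R]_(x in X) (tr_t0 a h x ^+ 2 * expR (- 2 * lambda * x)))
    + gamma / 2 * N h ^+ 2 <= remK a alpha lambda gamma q h.
Proof.
have arT (p t x y m : R) : p = t - 4 * (x + y) -> 0 < m ->
    p ^+ 2 * m <= 2 * (t ^+ 2 * m) + 64 * (x ^+ 2 * m) + 64 * (y ^+ 2 * m).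
  move=> -> m0; have e1 := sqr_ge0 (t + 4 * (x + y)); have e2 := sqr_ge0 (x - y).
  have h1 : (t - 4 * (x + y)) ^+ 2 <= 2 * t ^+ 2 + 64 * x ^+ 2 + 64 * y ^+ 2 by lra.
  have := ler_wpM2r (ltW m0) h1; lra.
have arM (A g y m : R) : 0 < m -> - (A * (g * y) * m) <= 2^-1 * ((g * A) ^+ 2 * m) + 2^-1 * (y ^+ 2 * m).
  move=> m0; have e1 := sqr_ge0 (g * A + y).
  have h1 : - (A * (g * y)) <= 2^-1 * (g * A) ^+ 2 + 2^-1 * y ^+ 2 by lra.
  have := ler_wpM2r (ltW m0) h1; lra.
have arT2 (k G A B n : R) : 0 <= k -> G <= k * (A + B) -> A <= n -> B <= n -> G <= 2 * k * n.
  by move=> k0 h1 h2 h3; apply: le_trans h1 _; nra.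
have arB (k m e E I : R) : 0 <= k -> 0 <= m -> m <= e -> 0 <= E -> I <= k * m ^+ 2 * E ->
    I <= k * e ^+ 2 * E.
  move=> k0 m0 me E0 h1; apply: le_trans h1 _; rewrite ler_wpM2r// ler_wpM2l//.
  by rewrite lerXn2r// nnegrE// (le_trans m0).
have arE (L e e2 kt c g n G1 G2 : R) : 0 < c -> 1 <= L -> 0 < e -> e2 = e ^+ 2 -> 0 <= kt -> 0 <= n ->
    2 * c * kt * L ^+ 3 * e <= 1 -> 2 * e <= g ->
    G1 <= 2 * kt * n -> G2 <= 2 * kt * n -> c * e2 * (L * G1 + L ^+ 3 * G2) <= g * n.
  move=> C0 L1 e0 -> kt0 n0 h1 h2 h3 h4.
  have L0 : 0 < L by exact: lt_le_trans L1.
  have L3 : L <= L ^+ 3 by rewrite exprS ler_peMr ?exprn_ege1// ltW.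
  have kn : 0 <= 2 * kt * n by rewrite !mulr_ge0.
  have m1 : L * G1 + L ^+ 3 * G2 <= L ^+ 3 * (2 * (2 * kt * n)).
    have n1 := ler_wpM2l (ltW L0) h3; have n2 := ler_wpM2l (exprn_ge0 3 (ltW L0)) h4.
    have n3 := ler_wpM2r kn L3; lra.
  have ce : 0 <= c * e ^+ 2 by rewrite mulr_ge0 ?sqr_ge0// ltW.
  have m2 := ler_wpM2l ce m1.
  have m3 := ler_wpM2r n0 h2.
  have m4 := ler_wpM2r (mulr_ge0 (ltW e0) n0) h1; lra.
have arF (c L A1 B1 E F Q T Iq Ih Im IhM I3 I4 I5 ee ks kb km g n : R) :
    0 < c -> 1 <= L -> 0 <= A1 -> 0 <= B1 -> 0 <= E -> 0 <= F ->
    32 * ks + 4 <= c / 4 * L -> 32 * kb + 4 * km <= c / 4 * L ->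
    Q <= 2 * T + 64 * Iq + 64 * Ih -> - Im <= 2^-1 * IhM + 2^-1 * B1 ->
    Iq <= ks * B1 -> Ih <= kb * E -> IhM <= km * E ->
    Q >= c * I3 + c * I4 - c * ee * I5 -> c * ee * I5 <= g * n ->
    I3 = L * A1 + L ^+ 3 * B1 -> I4 = L * E + L ^+ 3 * F ->
    c / 4 * (A1 + B1 + E + F) + g / 2 * n <= T + 8 * Im + g * n.
  move=> C0 L1 A0 B0 E0 F0 h1 h2 h3 h4 h5 h6 h7 h8 h9 e1 e2; rewrite e1 e2 in h8.
  have L0 : 0 < L by exact: lt_le_trans L1.
  have L3 : L <= L ^+ 3 by rewrite exprS ler_peMr ?exprn_ege1// ltW.
  have m1 := ler_wpM2r B0 h1; have m2 := ler_wpM2r E0 h2.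
  have cB : 0 <= c * B1 by rewrite mulr_ge0// ltW.
  have cF : 0 <= c * F by rewrite mulr_ge0// ltW.
  have cA : 0 <= c * A1 by rewrite mulr_ge0// ltW.
  have cE : 0 <= c * E by rewrite mulr_ge0// ltW.
  have n1 := ler_wpM2r cB L3; have n2 := ler_wpM2r cF L3.
  have p1 := ler_wpM2r cA L1; have p2 := ler_wpM2r cB L1.
  have p3 := ler_wpM2r cE L1; have p4 := ler_wpM2r cF L1; lra.
move=> C0 carl l0L L1 c1 c2 c3 c4 hq Nq hqh Nqh hh.
have h4 : H4 a h by case: hh.
have Lp := P2_L2 h4; have Lqh := gm_L2 a0 hq h4; have Lhh := gm_L2 a0 h4 h4.
have LML := ML_L2 a0 hq h4; have LT := L2D mO LML (L2Z mO 4 Lhh).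
have [Lhq2 bq2] := weighted_slice h4 (H4_L2q hqh) (slice_bound_q a0 hqh).
have [LhM bM] := weighted_slice h4 (M_L2 a0 hq) (M_slice hq Nq).
have bq := weighted_trace hq Nq h4.
have LM := M_L2 a0 hq; have Lh := H4_L2q h4.
have ipsi f := @intble_psi R a alpha lambda al0 la0 f.
have it := ipsi _ (L2_sq LT); have iqh := ipsi _ (L2_sq Lqh).
have ihq2 := ipsi _ (L2_sq Lhq2); have ip2 := ipsi _ (L2_sq Lp).
have ihM := ipsi _ (L2_sq LhM); have ih := ipsi _ (L2_sq Lh).
have iMg := ipsi _ (L2M mO LM Lhh).
have H1 : \int[leb2 R]_(z in Omega a) (P2 h z ^+ 2 * psi z) <=
    2 * \int[leb2 R]_(z in Omega a) ((ML q h z + 4 * gm h h z) ^+ 2 * psi z)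
    + 64 * \int[leb2 R]_(z in Omega a) (gm q h z ^+ 2 * psi z)
    + 64 * \int[leb2 R]_(z in Omega a) (gm h (q \+ h) z ^+ 2 * psi z).
  have j1 := intbleZ mO 2 it; have j2 := intbleZ mO 64 iqh; have j3 := intbleZ mO 64 ihq2.
  have j12 := intbleD mO j1 j2.
  rewrite -(RintegralZl 2 mO it) -(RintegralZl 64 mO iqh) -(RintegralZl 64 mO ihq2).
  rewrite -(RintegralD mO j1 j2) -(RintegralD mO j12 j3).
  apply: (le_Rintegral mO ip2 (intbleD mO j12 j3)) => z _.
  apply: arT; last exact: psi_gt0.
  rewrite /ML /gm /=; move: (P2 h z) (g0 q z.1) (g0 h z.1) (h z) (q z) => *; ring.
have H2 : - (\int[leb2 R]_(z in Omega a) (M a q z * gm h h z * psi z)) <=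
    2^-1 * \int[leb2 R]_(z in Omega a) (gm h (M a q) z ^+ 2 * psi z)
    + 2^-1 * \int[leb2 R]_(z in Omega a) (h z ^+ 2 * psi z).
  have j1 := intbleZ mO 2^-1 ihM; have j2 := intbleZ mO 2^-1 ih.
  rewrite -(RintegralZl 2^-1 mO ihM) -(RintegralZl 2^-1 mO ih) -(RintegralD mO j1 j2).
  rewrite -mulN1r -(RintegralZl (-1) mO iMg).
  apply: (le_Rintegral mO (intbleZ mO (-1) iMg) (intbleD mO j1 j2)) => z _.
  by rewrite mulN1r; apply: arM; exact: psi_gt0.
have H3 := carl h lambda (H04_H02 hh) l0L.
have W1 := H4_Wtq a0 h4; have W2 := @H4_Wt _ _ a0 h 1 0 h4 isT.
have [Lt0 LtT _ bT] := ttraces_L2 a0 W1; have [Lx0 LxT _ bxT] := ttraces_L2 a0 W2.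
have L10 := @H4_L2 _ _ h 1 0 h4 isT; have L01 := @H4_L2 _ _ h 0 1 h4 isT.
have iD := ipsi _ (intbleD mO (L2_sq L10) (L2_sq L01)).
have E1 : \int[leb2 R]_(z in Omega a) ((lambda * (Dx a h z ^+ 2 + Dt a h z ^+ 2)
      + lambda ^+ 3 * h z ^+ 2) * psi z) =
    lambda * \int[leb2 R]_(z in Omega a) ((Dx a h z ^+ 2 + Dt a h z ^+ 2) * psi z)
    + lambda ^+ 3 * \int[leb2 R]_(z in Omega a) (h z ^+ 2 * psi z).
  rewrite -(RintegralZl lambda mO iD) -(RintegralZl (lambda ^+ 3) mO ih).
  rewrite -(RintegralD mO (intbleZ mO lambda iD) (intbleZ mO (lambda ^+ 3) ih)).
  by apply: eq_Rintegral => z _; rewrite mulrDl !mulrA.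
have k1 := intble_expx Lx0; have k2 := intble_expx Lt0.
have E2 : \int[leb1 R]_(x in X) ((lambda * tr_t0 a (Dx a h) x ^+ 2 + lambda ^+ 3 * tr_t0 a h x ^+ 2)
      * expR (- 2 * lambda * x)) =
    lambda * \int[leb1 R]_(x in X) (g0 h x ^+ 2 * expR (- 2 * lambda * x))
    + lambda ^+ 3 * \int[leb1 R]_(x in X) (tr_t0 a h x ^+ 2 * expR (- 2 * lambda * x)).
  rewrite -(RintegralZl lambda mX k1) -(RintegralZl (lambda ^+ 3) mX k2).
  rewrite -(RintegralD mX (intbleZ mX lambda k1) (intbleZ mX (lambda ^+ 3) k2)).
  by apply: eq_Rintegral => z _; rewrite mulrDl !mulrA.
have E3 : \int[leb1 R]_(x in X) (lambda * tr_tT a (Dx a h) x ^+ 2 + lambda ^+ 3 * tr_tT a h x ^+ 2) =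
    lambda * \int[leb1 R]_(x in X) (tr_tT a (Dx a h) x ^+ 2)
    + lambda ^+ 3 * \int[leb1 R]_(x in X) (tr_tT a h x ^+ 2).
  rewrite -(RintegralZl lambda mX (L2_sq LxT)) -(RintegralZl (lambda ^+ 3) mX (L2_sq LtT)).
  by rewrite -(RintegralD mX (intbleZ mX lambda (L2_sq LxT)) (intbleZ mX (lambda ^+ 3) (L2_sq LtT))).
(* the terms on [t = 2a] are absorbed by the regularization *)
have n0 : 0 <= N h ^+ 2 by exact: sqr_ge0.
have kt0 := ltW (Ktr_gt0 T0).
have G1 := arT2 _ _ _ _ _ kt0 bxT (@D_le _ a h 1 0 isT) (@D_le _ a h 1 1 isT).
have G2 := arT2 _ _ _ _ _ kt0 bT (q_le h4) (@D_le _ a h 0 1 isT).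
have ee : expR (- 2 * lambda * alpha * (2 * a)) = expR (- lambda * alpha * (2 * a)) ^+ 2.
  by rewrite -expRM_natl; congr expR; ring.
have E0 : 0 <= \int[leb1 R]_(x in X) (g0 h x ^+ 2 * expR (- 2 * lambda * x)).
  by apply: Rintegral_ge0 => x _; apply: mulr_ge0; [exact: sqr_ge0|exact: expR_ge0].
have H5 := arE _ _ _ _ _ _ _ _ _ C0 L1 (expR_gt0 _) ee kt0 n0 c3 c4 G1 G2.
rewrite -E3 in H5.
apply: (arF _ _ _ _ _ _ _ _ _ _ _ _ _ _ _ _ _ _ _ _ _ C0 L1 _ _ E0 _ c1 c2 H1 H2 bq
  (arB _ _ _ _ _ (ltW (KB_gt0 a0)) (hnorm_ge0 a _) Nqh E0 bq2) bM H3 H5 E1 E2).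
- apply: Rintegral_ge0 => z _; apply: mulr_ge0; last exact: expR_ge0.
  by apply: addr_ge0; exact: sqr_ge0.
- by apply: Rintegral_ge0 => z _; apply: mulr_ge0; [exact: sqr_ge0|exact: expR_ge0].
- by apply: Rintegral_ge0 => z _; apply: mulr_ge0; [exact: sqr_ge0|exact: expR_ge0].
Qed.

End weight.
End lower_bound.

(** * Norms on the triangle and on its base *)

Lemma le_Rintegral_subset d (T : measurableType d) (R : realType)
    (mu : {measure set T -> \bar R}) (A B : set T) (f : T -> R) :
  measurable A -> measurable B -> A `<=` B -> intble mu B f ->
  (forall x, B x -> 0 <= f x) ->
  \int[mu]_(x in A) f x <= \int[mu]_(x in B) f x.
Proof.
move=> mA mB AB iB f0; have iA := integrableS mB mA AB iB.
rewrite /Rintegral fine_le//.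
- exact: integrable_fin_num.
- exact: integrable_fin_num.
apply: ge0_subset_integral => //; first exact/measurable_EFinP/(intbleP iB).
Qed.

Section restriction.
Variable R : realType.
Local Notation mR := (measurableTypeR R).
Variable a : R.
Hypothesis a0 : 0 < a.
Let X : set mR := `]0, a[%classic.
Let mX : measurable X. Proof. exact: measurable_itv. Qed.
Let mO := @measurable_Omega R a.
Let i1O := @intble1_Omega R a.
Implicit Types (u v w q h : R * R -> R).
Local Notation D i j q := (wder (Omega a) i j q).
Local Notation N q := (hnorm (Omega a) 4 q).
Local Notation L2O := (L2 (leb2 R) (Omega a)).
Variables (alpha mu : R).
Hypotheses (al : 0 < alpha < 1 / 2) (mu0 : 0 < mu < 2 * alpha * a).
Let r := 2 * alpha * a - mu.
Local Notation Rs := (Rset a alpha mu).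
Let I : set mR := `]0, r[%classic.
Let mI : measurable I. Proof. exact: measurable_itv. Qed.

Let al0 : 0 < alpha. Proof. by case/andP: al. Qed.

Let ra : r <= a.
Proof.
rewrite /r; have /andP[_ h] := al; have /andP[h1 _] := mu0.
have := a0; have h2 : alpha * a <= 1 / 2 * a by rewrite ler_pM2r// ltW.
lra.
Qed.

Let IX : I `<=` X.
Proof.
by move=> x; rewrite /I /X /= !in_itv/= => /andP[-> h] /=; exact: lt_le_trans ra.
Qed.

Lemma open_Rset : open Rs.
Proof.
have -> : Rs = (fst @^-1` [set x : R | 0 < x]) `&` (snd @^-1` [set x : R | 0 < x])
    `&` ((fun p : R * R => p.1 + alpha * p.2) @^-1` [set x : R | x < 2 * alpha * a - mu]).
  by apply/seteqP; split => -[x t] /=; [case|case => -[]].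
apply: openI; first apply: openI.
- by apply: open_comp; [move=> z _; exact: cvg_fst|exact: open_gt].
- by apply: open_comp; [move=> z _; exact: cvg_snd|exact: open_gt].
apply: open_comp; last exact: open_lt.
move=> z _; apply: cvgD; first exact: cvg_fst.
by apply: cvgM; [exact: cvg_cst|exact: cvg_snd].
Qed.

Lemma Rset_Omega : Rs `<=` Omega a.
Proof.
move=> [x t] [/= x0 t0 h]; have /andP[m0 _] := mu0; have := ra; rewrite /r => h1.
have at0 : 0 < alpha * t by rewrite mulr_gt0.
split => /=; first by rewrite x0/=; lra.
rewrite t0/= -(ltr_pM2l al0); lra.
Qed.
Let mRs : measurable (Rs : set (mR * mR)) := open_measurable2 open_Rset.
Let i1R : intble (leb2 R) Rs (fun=> 1) := integrableS mO mRs Rset_Omega i1O.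

(** On the triangle the weight is at least its value on the line
    [x + alpha t = 2 alpha a - mu], and weak derivatives restrict to the triangle. *)
Lemma hnorm_Rset h (lambda : R) : 0 < lambda -> H4 a h ->
  expR (- 2 * lambda * r) * hnorm Rs 1 h ^+ 2 <=
  \int[leb2 R]_(z in Omega a) ((Dx a h z ^+ 2 + Dt a h z ^+ 2) * psi alpha lambda z)
  + \int[leb2 R]_(z in Omega a) (h z ^+ 2 * psi alpha lambda z).
Proof.
have sum3 (F : nat -> nat -> R) :
    \sum_(i < 2) \sum_(j < 2 | (i + j <= 1)%N) F i j = F 0%N 0%N + F 0%N 1%N + F 1%N 0%N.
  under eq_bigr do rewrite big_mkcond.
  by rewrite !big_ord_recl !big_ord0 /= !addr0.
have ar (W n A B C x t y : R) : n = A + B + C -> W * A <= y -> W * B <= t -> W * C <= x ->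
    W * n <= x + t + y.
  by move=> -> h1 h2 h3; lra.
move=> l0 hh; pose W := expR (- 2 * lambda * r).
have Wpsi z : Rs z -> W <= psi alpha lambda z.
  move=> [_ _ hz]; rewrite ler_expR -!mulrA !mulNr lerN2 ler_pM2l//.
  by rewrite ler_pM2l// ltW.
have sub u v : L2O v -> ae_eq (leb2 R) Rs u v -> measurable_fun Rs u ->
    W * \int[leb2 R]_(z in Rs) (u z * u z) <= \int[leb2 R]_(z in Omega a) (v z ^+ 2 * psi alpha lambda z).
  move=> Lv uv mu'; have iv := intble_psi al0 l0 (L2_sq Lv).
  have iv2 := integrableS mO mRs Rset_Omega (L2_sq Lv).
  have iv3 := integrableS mO mRs Rset_Omega iv.
  have -> : \int[leb2 R]_(z in Rs) (u z * u z) = \int[leb2 R]_(z in Rs) (v z ^+ 2).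
    apply: (Rintegral_ae_eq mRs _ (intbleP iv2)); first exact: measurable_funM.
    by apply: filterS uv => z e Oz; rewrite (e Oz) expr2.
  rewrite -(RintegralZl W mRs iv2).
  apply: (@le_trans _ _ (\int[leb2 R]_(z in Rs) (v z ^+ 2 * psi alpha lambda z))).
    apply: (le_Rintegral mRs (intbleZ mRs W iv2) iv3) => z Rz.
    by rewrite mulrC ler_wpM2l ?sqr_ge0//; exact: Wpsi.
  apply: (le_Rintegral_subset mRs mO Rset_Omega iv) => z _.
  by rewrite mulr_ge0 ?sqr_ge0// ltW// psi_gt0.
have wR i j : (i + j <= 1)%N -> is_wder Rs i j h (D i j h).
  move=> ij; apply: (is_wder_restrict open_Rset Rset_Omega ij).
  by apply: H4_wder => //; exact: leq_trans ij _.
have term i j : (i + j <= 1)%N -> W * \int[leb2 R]_(z in Rs) (wder Rs i j h z * wder Rs i j h z)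
    <= \int[leb2 R]_(z in Omega a) (D i j h z ^+ 2 * psi alpha lambda z).
  move=> ij; have w := wR i j ij; apply: sub.
  - by apply: H4_L2 => //; exact: leq_trans ij _.
  - exact: (wder_ae open_Rset i1R w).
  - exact: (L2_meas (wderP w).1).
have L10 := @H4_L2 _ _ h 1 0 hh isT; have L01 := @H4_L2 _ _ h 0 1 hh isT.
have Lh := H4_L2q hh.
have i10 := intble_psi al0 l0 (L2_sq L10); have i01 := intble_psi al0 l0 (L2_sq L01).
have -> : \int[leb2 R]_(z in Omega a) ((Dx a h z ^+ 2 + Dt a h z ^+ 2) * psi alpha lambda z) =
    \int[leb2 R]_(z in Omega a) (D 1 0 h z ^+ 2 * psi alpha lambda z) +
    \int[leb2 R]_(z in Omega a) (D 0 1 h z ^+ 2 * psi alpha lambda z).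
  rewrite -(RintegralD mO i10 i01); apply: eq_Rintegral => z _; exact: mulrDl.
have <- : \int[leb2 R]_(z in Omega a) (D 0 0 h z ^+ 2 * psi alpha lambda z) =
    \int[leb2 R]_(z in Omega a) (h z ^+ 2 * psi alpha lambda z).
  have L00 := @H4_L2 _ _ h 0 0 hh isT.
  apply: (Rintegral_ae_eq mO (intbleP (intble_psi al0 l0 (L2_sq L00)))
    (intbleP (intble_psi al0 l0 (L2_sq Lh)))).
  by apply: filterS (D00 Lh) => z e Oz; rewrite (e Oz).
apply: ar (term 0 0 isT) (term 0 1 isT) (term 1 0 isT).
rewrite /hnorm sqr_sqrtr; last first.
  apply: sumr_ge0 => i _; apply: sumr_ge0 => j _; apply: Rintegral_ge0 => z _.
  by rewrite -expr2 sqr_ge0.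
exact: (sum3 (fun i j => \int[leb2 R]_(z in Rs) (wder Rs i j h z * wder Rs i j h z))).
Qed.

(** The trace on [t = 0] is linear, and the derivative of a trace is the trace of the
    derivative; on the interval the weight is at least its value at the end point. *)
Lemma h1norm1_trace q1 q2 (lambda : R) : 0 < lambda -> H4 a q1 -> H4 a q2 ->
  expR (- 2 * lambda * r) * h1norm1 I (fun x => tr_t0 a q2 x - tr_t0 a q1 x) ^+ 2 <=
  \int[leb1 R]_(x in X) (g0 a (q2 \- q1) x ^+ 2 * expR (- 2 * lambda * x))
  + \int[leb1 R]_(x in X) (tr_t0 a (q2 \- q1) x ^+ 2 * expR (- 2 * lambda * x)).
Proof.
have ar (W A B x y : R) : W * A <= x -> W * B <= y -> W * (A + B) <= y + x by lra.
have ar0 (x y z : R) : x = -1 * y + z -> z - y = x by move=> ->; rewrite mulN1r addrC.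
move=> l0 hq1 hq2; have hh := H4B hq2 hq1; set h := q2 \- q1 in hh *.
pose W := expR (- 2 * lambda * r).
have W1 := H4_Wtq a0 hh; have W2 := @H4_Wt _ _ a0 h 1 0 hh isT.
have [Lt _ _ _] := ttraces_L2 a0 W1; have [Lx _ _ _] := ttraces_L2 a0 W2.
have V1 := H4_Wtq a0 hq1; have V2 := H4_Wtq a0 hq2.
have [L1 _ _ _] := ttraces_L2 a0 V1; have [L2' _ _ _] := ttraces_L2 a0 V2.
set f := (fun x => _).
have Lf : L2 (leb1 R) X f := L2B mX L2' L1.
have fE : ae_eq (leb1 R) X f (tr_t0 a h).
  have e1 : ae_eq (leb2 R) (Omega a) h (fun p => -1 * q1 p + q2 p).
    by apply: aeW => z _; rewrite /h subfE.
  have e2 : ae_eq (leb2 R) (Omega a) (D 0 1 h) (fun p => -1 * D 0 1 q1 p + D 0 1 q2 p).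
    by rewrite /h subfE; exact: (@D_lin _ _ (-1) q1 q2 0 1 hq1 hq2 isT).
  have [l _] := ttraces_lin a0 V1 V2 W1 e1 e2.
  by apply: filterS l => x e Xx; exact: ar0 (e Xx).
have restr (u : R -> R) : L2 (leb1 R) X u -> L2 (leb1 R) I u.
  move=> Lu; apply/L2P; split; first exact: (measurable_funS mX IX (L2_meas Lu)).
  exact: (integrableS mX mI IX (L2_sq Lu)).
have aeI (u v : R -> R) : ae_eq (leb1 R) X u v -> ae_eq (leb1 R) I u v.
  by move=> uv; apply: filterS uv => x e Ix; exact/e/IX.
have wh : is_wder1 I (tr_t0 a h) (tr_t0 a (Dx a h)) := is_wder1_trace a0 hh ra.
have wf : is_wder1 I f (tr_t0 a (Dx a h)).
  have [Lg wg] := wh; split => // phi tphi; rewrite -(wg _ tphi).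
  have Lp := test1_L2 (test1_derive1 tphi).
  apply: (Rintegral_ae_eq mI (intbleP (L2M mI (restr _ Lf) Lp)) (intbleP (L2M mI (restr _ Lt) Lp))).
  by apply: filterS (aeI _ _ fE) => x e Ix; rewrite (e Ix).
have wf' : is_wder1 I f (wder1 I f).
  exact: (@xgetPex _ (fun=> 0) [set g | is_wder1 I f g] (ex_intro _ _ wf)).
have gE : ae_eq (leb1 R) I (wder1 I f) (tr_t0 a (Dx a h)).
  apply: (test_uniq1 wf'.1 wf.1) => phi tphi.
  by apply/oppr_inj; rewrite -(wf.2 _ tphi) -(wf'.2 _ tphi).
have sub (u v : R -> R) : L2 (leb1 R) X v -> L2 (leb1 R) I u -> ae_eq (leb1 R) I u v ->
    W * \int[leb1 R]_(x in I) (u x ^+ 2) <=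
    \int[leb1 R]_(x in X) (v x ^+ 2 * expR (- 2 * lambda * x)).
  move=> Lv Lu uv; have Lv' := restr _ Lv; have iv := intble_expx l0 Lv.
  have iv3 := integrableS mX mI IX iv.
  rewrite (Rintegral_ae_eq mI (intbleP (L2_sq Lu)) (intbleP (L2_sq Lv'))); last first.
    by apply: filterS uv => x e Ix; rewrite (e Ix).
  rewrite -(RintegralZl W mI (L2_sq Lv')).
  apply: (@le_trans _ _ (\int[leb1 R]_(x in I) (v x ^+ 2 * expR (- 2 * lambda * x)))).
    apply: (le_Rintegral mI (intbleZ mI W (L2_sq Lv')) iv3) => x.
    rewrite /I /= in_itv /= => /andP[_ xr]; rewrite mulrC ler_wpM2l ?sqr_ge0//.
    by rewrite ler_expR -!mulrA !mulNr lerN2 ler_pM2l// ler_pM2l// ltW.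
  apply: (le_Rintegral_subset mI mX IX iv) => x _.
  by rewrite mulr_ge0 ?sqr_ge0// expR_ge0.
have t1 := sub _ _ Lt (restr _ Lf) (aeI _ _ fE).
have t2 := sub _ _ Lx wf'.1 gE.
rewrite /h1norm1 sqr_sqrtr; first exact: ar t1 t2.
by apply: addr_ge0; apply: Rintegral_ge0 => x _; exact: sqr_ge0.
Qed.

End restriction.

(** * The closed convex set *)

Section closed_set.
Variable R : realType.
Local Notation mR := (measurableTypeR R).
Variable a : R.
Hypothesis a0 : 0 < a.
Let Y : set mR := `]0, 2 * a[%classic.
Let mO := @measurable_Omega R a.
Implicit Types (u v w q h : R * R -> R).
Local Notation N q := (hnorm (Omega a) 4 q).
Local Notation sq u := (\int[leb2 R]_(z in Omega a) (u z ^+ 2)).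

(** The closure of [P] is contained in this set, which, unlike [P], has no
    strict inequality, and whose convexity is elementary. *)
Definition Pbar (d : R) (s0 s1 : R -> R) q : Prop :=
  [/\ H4 a q, ae_eq (leb1 R) Y (tr_x0 a q) s0,
      ae_eq (leb1 R) Y (tr_x0 a (Dx a q)) s1,
      ae_eq (leb1 R) Y (tr_xa a (Dx a q)) (fun=> 0) & N q <= d].

Lemma hnorm_triangle q p : H4 a q -> H4 a p -> N q <= N p + N (q \- p).
Proof.
have ar (x y z i : R) : 0 <= x -> 0 <= y -> 0 <= z -> i ^+ 2 <= y ^+ 2 * z ^+ 2 ->
    x ^+ 2 = y ^+ 2 + 2 * 1 * i + 1 ^+ 2 * z ^+ 2 -> x <= y + z.
  move=> x0 y0 z0 h1 h2; have yz : 0 <= y * z by exact: mulr_ge0.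
  have h3 : i <= y * z.
    by apply: le_trans (ler_norm _) _; rewrite -ler_sqr ?nnegrE// real_normK ?num_real// exprMn.
  rewrite -ler_sqr ?nnegrE ?addr_ge0// h2; lra.
move=> hq hp; have hqp := H4B hq hp; have E := hnormD 1 hqp hp.
rewrite (_ : (fun z => _) = q) in E; last by apply/funext => z; rewrite /= mul1r subrK.
exact: ar (hnorm_ge0 a _) (hnorm_ge0 a _) (hnorm_ge0 a _) (hinner_cs hp hqp) E.
Qed.

Lemma closureP_Pbar d s0 s1 q : closureP a d s0 s1 q -> Pbar d s0 s1 q.
Proof.
have ar (x y z e : R) : x <= y + z -> y < e -> z < x - e -> False by lra.
move=> [hq hc]; have [c2 c3] := ctrace_Dx a0.
have near (tr : (R * R -> R) -> R -> R) s :
    (forall p, P a d s0 s1 p -> ae_eq (leb1 R) Y (tr p) s) -> forall eps : R, 0 < eps ->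
    exists p, [/\ H4 a p, ae_eq (leb1 R) Y (tr p) s & N (q \- p) < eps].
  move=> trs eps e0; have [p Pp np] := hc eps e0; exists p; split; last exact: np.
    by have [h _ _ _ _] := Pp; exact: h.
  exact: trs.
split; first exact: hq.
- apply: (trace_closed (ctrace_x0 a0) hq (near (tr_x0 a) s0 _)) => p [_ h _ _ _]; exact: h.
- apply: (trace_closed c2 hq (near (fun u => tr_x0 a (Dx a u)) s1 _)) => p [_ _ h _ _]; exact: h.
- apply: (trace_closed c3 hq (near (fun u => tr_xa a (Dx a u)) (fun=> 0) _)) => p [_ _ _ h _].
  exact: h.
rewrite leNgt; apply/negP => dq; have e0 : 0 < N q - d by rewrite subr_gt0.
have [p [hp _ _ _ np] nqp] := hc _ e0.
exact: ar (hnorm_triangle hq hp) np nqp.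
Qed.

Lemma Pbar_H04 d s0 s1 q1 q2 : Pbar d s0 s1 q1 -> Pbar d s0 s1 q2 -> H04 a (q2 \- q1).
Proof.
move=> [h1 x1 y1 z1 _] [h2 x2 y2 z2 _].
have [l1 _] := ctrace_x0 a0; have [[l2 _] [l3 _]] := ctrace_Dx a0.
have ar (x y z s : R) : x = -1 * y + z -> y = s -> z = s -> x = 0.
  by move=> -> -> ->; rewrite mulN1r addNr.
rewrite subfE; split; first exact: H4_lin.
- by apply: filterS3 (l1 (-1) _ _ h1 h2) x1 x2 => t e1 e2 e3 Yt; exact: ar (e1 Yt) (e2 Yt) (e3 Yt).
- by apply: filterS3 (l2 (-1) _ _ h1 h2) y1 y2 => t e1 e2 e3 Yt; exact: ar (e1 Yt) (e2 Yt) (e3 Yt).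
- by apply: filterS3 (l3 (-1) _ _ h1 h2) z1 z2 => t e1 e2 e3 Yt; exact: ar (e1 Yt) (e2 Yt) (e3 Yt).
Qed.

(** Along the segment from [q2] to [q1] the squared norm is a quadratic polynomial with
    nonnegative leading coefficient. *)
Lemma Pbar_convex d s0 s1 q1 q2 theta : 0 < d -> 0 < theta < 1 ->
  Pbar d s0 s1 q1 -> Pbar d s0 s1 q2 ->
  Pbar d s0 s1 (fun p => theta * q1 p + (1 - theta) * q2 p).
Proof.
have ar (t x y e i m n : R) : 0 < e -> 0 < t < 1 -> 0 <= x -> 0 <= y -> 0 <= n -> x <= e -> y <= e ->
    x ^+ 2 = y ^+ 2 + 2 * 1 * i + 1 ^+ 2 * m ^+ 2 ->
    n ^+ 2 = y ^+ 2 + 2 * t * i + t ^+ 2 * m ^+ 2 -> n <= e.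
  move=> e0 /andP[t0 t1] x0 y0 n0 xe ye h1 h2.
  have x2 : x ^+ 2 <= e ^+ 2 by rewrite ler_sqr ?nnegrE// ltW.
  have y2 : y ^+ 2 <= e ^+ 2 by rewrite ler_sqr ?nnegrE// ltW.
  rewrite -ler_sqr ?nnegrE ?(ltW e0)//.
  have p1 := ler_wpM2l (ltW t0) x2.
  have t1' : 0 <= 1 - t by rewrite subr_ge0 ltW.
  have p2 := ler_wpM2l t1' y2.
  have p3 := mulr_ge0 (mulr_ge0 (ltW t0) t1') (sqr_ge0 m).
  have p4 : t * x ^+ 2 = t * (y ^+ 2 + 2 * 1 * i + 1 ^+ 2 * m ^+ 2) by rewrite h1.
  lra.
have ar2 (x y z s t : R) : x = t * y + z -> y = 0 -> z = s -> x = s.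
  by move=> -> -> ->; rewrite mulr0 add0r.
move=> d0 th P1 P2; have [hh x1 y1 z1] := Pbar_H04 P2 P1.
have [h2 x2 y2 z2 n2] := P2; have [h1 _ _ _ n1] := P1.
have -> : (fun p => theta * q1 p + (1 - theta) * q2 p) = (fun p => theta * (q1 \- q2) p + q2 p).
  by apply/funext => p /=; move: (q1 p) (q2 p) => A B; ring.
have [l1 _] := ctrace_x0 a0; have [[l2 _] [l3 _]] := ctrace_Dx a0.
split; first exact: H4_lin.
- by apply: filterS3 (l1 theta _ _ hh h2) x1 x2 => t e1 e2 e3 Yt; exact: ar2 (e1 Yt) (e2 Yt) (e3 Yt).
- by apply: filterS3 (l2 theta _ _ hh h2) y1 y2 => t e1 e2 e3 Yt; exact: ar2 (e1 Yt) (e2 Yt) (e3 Yt).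
- by apply: filterS3 (l3 theta _ _ hh h2) z1 z2 => t e1 e2 e3 Yt; exact: ar2 (e1 Yt) (e2 Yt) (e3 Yt).
have E := hnormD 1 hh h2.
rewrite (_ : (fun p => 1 * _ + _) = q1) in E; last by apply/funext => z; rewrite /= mul1r subrK.
exact: ar d0 th (hnorm_ge0 a _) (hnorm_ge0 a _) (hnorm_ge0 a _) n1 n2 E (hnormD theta hh h2).
Qed.

Lemma hnorm_gt0 u v h (c : R) : H4 a h -> c != 0 -> (forall z, h z = c * (u z - v z)) ->
  ~ ae_eq (leb2 R) (Omega a) u v -> 0 < N h ^+ 2.
Proof.
move=> hh c0 hE ne; rewrite lt_neqAle sqr_ge0 andbT; apply/negP => /eqP n0; apply: ne.
have h0 : sq h <= 0 by have := q_le hh; rewrite -n0.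
have z := Rintegral_eq0_ae mO (L2_sq (H4_L2q hh)) (fun z _ => sqr_ge0 (h z)) h0.
apply: filterS z => z e Oz; apply/subr0_eq/eqP; have /eqP := e Oz.
by rewrite sqrf_eq0 hE mulf_eq0 (negbTE c0).
Qed.

End closed_set.

(** [exp(L b) >= (L b / 4)^4], and [256 = 4^4]. *)
Lemma expR_decay (R : realType) (c b L : R) : 0 <= c -> 0 < b -> 0 < L ->
  256 * c / b ^+ 4 <= L -> c * L ^+ 3 * expR (- L * b) <= 1.
Proof.
move=> c0 b0 L0 h; rewrite mulNr expRN ler_pdivrMr ?expR_gt0// mul1r.
have -> : expR (L * b) = expR (L * b / 4) ^+ 4.
  by rewrite -expRM_natl; congr expR; field.
have Lb : 0 <= L * b / 4 by rewrite !mulr_ge0// ltW.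
apply: (@le_trans _ _ ((L * b / 4) ^+ 4)).
  rewrite ler_pdivrMr ?exprn_gt0// in h.
  have h1 := ler_wpM2r (exprn_ge0 3 (ltW L0)) h; rewrite !exprMn exprVn; lra.
rewrite lerXn2r ?nnegrE ?expR_ge0//; apply: le_trans (expR_ge1Dx _); lra.
Qed.

(** * Strict convexity *)

Section convexity.
Variable R : realType.
Variable a : R.
Hypothesis a0 : 0 < a.
Implicit Types (u v w q h : R * R -> R).
Local Notation N q := (hnorm (Omega a) 4 q).
Variables (alpha lambda gamma d : R) (s0 s1 : R -> R).
Hypotheses (al0 : 0 < alpha) (la0 : 0 < lambda) (d0 : 0 < d) (ga0 : 0 < gamma).
Local Notation J := (K a alpha lambda gamma).
Local Notation Pbar := (Pbar a d s0 s1).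

(** A quadratic lower bound of the Bregman remainder on a convex set gives
    strict convexity: expand at the intermediate point and average. *)
Lemma strictly_convex q1 q2 (theta : R) :
  (forall q h, Pbar q -> Pbar (q \+ h) -> H04 a h ->
     gamma / 2 * N h ^+ 2 <= remK a alpha lambda gamma q h) ->
  Pbar q1 -> Pbar q2 -> ~ ae_eq (leb2 R) (Omega a) q1 q2 -> 0 < theta < 1 ->
  J (fun p => theta * q1 p + (1 - theta) * q2 p) < theta * J q1 + (1 - theta) * J q2.
Proof.
have ar (t k k1 k2 l1 l2 r1 r2 n1 n2 g z : R) : 0 < t -> t < 1 -> 0 < g ->
    k1 = k + l1 + r1 -> k2 = k + l2 + r2 -> g / 2 * n1 <= r1 -> g / 2 * n2 <= r2 ->
    0 < n1 -> 0 <= n2 -> z = -1 * z + z -> z = t * l1 + ((1 - t) * l2 + z) ->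
    k < t * k1 + (1 - t) * k2.
  move=> t0 t1 g0 -> -> h1 h2 n10 n20 hz hl.
  have m1 := ler_wpM2l (ltW t0) h1.
  have t1' : 0 <= 1 - t by rewrite subr_ge0 ltW.
  have m2 := ler_wpM2l t1' h2.
  have m3 : 0 < t * (g / 2 * n1) by rewrite !mulr_gt0// invr_gt0.
  have m4 : 0 <= (1 - t) * (g / 2 * n2) by rewrite !mulr_ge0// ?invr_ge0// ltW.
  lra.
move=> lb P1 P2 ne th; have /andP[t0 t1] := th.
have Pq := Pbar_convex a0 d0 th P1 P2; set q := (fun p => _) in Pq *.
have hq : H4 a q by case: Pq.
pose h1 := q1 \- q; pose h2 := q2 \- q.
have H1 : H04 a h1 := Pbar_H04 a0 Pq P1; have H2 : H04 a h2 := Pbar_H04 a0 Pq P2.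
have e1 : q \+ h1 = q1 by apply/funext => z; rewrite /h1 /= addrC subrK.
have e2 : q \+ h2 = q2 by apply/funext => z; rewrite /h2 /= addrC subrK.
have h14 : H4 a h1 by case: H1.
have h24 : H4 a h2 by case: H2.
have K1 := K_expand a0 al0 la0 gamma hq h14; have K2 := K_expand a0 al0 la0 gamma hq h24.
have Q1 : Pbar (q \+ h1) by rewrite e1.
have Q2 : Pbar (q \+ h2) by rewrite e2.
have r1 := lb _ _ Pq Q1 H1; have r2 := lb _ _ Pq Q2 H2.
have n1 : 0 < N h1 ^+ 2.
  apply: (@hnorm_gt0 _ _ q1 q2 h1 (1 - theta) h14 _ _ ne).
    by rewrite subr_eq0 gt_eqF.
  by move=> z; rewrite /h1 /q /=; move: (q1 z) (q2 z) => A B; ring.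
have h0 := H4_0 a.
have z0 : dK a alpha lambda gamma q (fun=> 0) =
    -1 * dK a alpha lambda gamma q (fun=> 0) + dK a alpha lambda gamma q (fun=> 0).
  have := dK_lin a0 al0 la0 gamma (-1) hq h0 h0.
  by rewrite (_ : (fun p => -1 * (fun=> 0) p + _) = fun=> 0)//; apply/funext => z /=; rewrite mulr0 addr0.
have l0 : dK a alpha lambda gamma q (fun=> 0) = theta * dK a alpha lambda gamma q h1
    + ((1 - theta) * dK a alpha lambda gamma q h2 + dK a alpha lambda gamma q (fun=> 0)).
  have hw := H4_lin (1 - theta) h24 h0.
  apply: etrans (etrans (dK_lin a0 al0 la0 gamma theta hq h14 hw)
    (congr1 _ (dK_lin a0 al0 la0 gamma (1 - theta) hq h24 h0))).
  congr dK; apply/funext => z; rewrite /h1 /h2 /q /=.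
  by move: (q1 z) (q2 z) => A B; ring.
rewrite e1 in K1; rewrite e2 in K2.
exact: ar t0 t1 ga0 K1 K2 r1 r2 n1 (sqr_ge0 _) z0 l0.
Qed.

End convexity.

Theorem theorem2 (R : realType) (cbar a alpha d : R)
    (hcbar : 1 < cbar) (ha : Num.sqrt cbar <= a)
    (halpha : 0 < alpha < 1 / 2) (hd : 0 < d) :
  (forall (s0 s1 : R -> R) (lambda gamma : R) (q : R * R -> R),
     0 < lambda -> 0 < gamma -> closureP a d s0 s1 q ->
     exists g : R * R -> R, H04 a g /\
       frechet_derivative a (K a alpha lambda gamma) q
         (fun h => hinner (Omega a) 4 g h))
  /\
  (forall C lambda0 : R, 0 < C -> 1 <= lambda0 ->
     carleman_estimate a alpha C lambda0 ->
   exists lambda1 B : R, [/\ lambda0 <= lambda1, 0 < B &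
     forall (s0 s1 : R -> R) (mu lambda gamma : R),
       0 < mu < 2 * alpha * a -> lambda1 <= lambda ->
       2 * expR (- lambda * alpha * (2 * a)) <= gamma < 1 ->
       (forall (q1 q2 : R * R -> R) (theta : R),
          closureP a d s0 s1 q1 -> closureP a d s0 s1 q2 ->
          ~ ae_eq (leb2 R) (Omega a) q1 q2 -> 0 < theta < 1 ->
          K a alpha lambda gamma
            (fun p => theta * q1 p + (1 - theta) * q2 p)
          < theta * K a alpha lambda gamma q1
            + (1 - theta) * K a alpha lambda gamma q2)
       /\
       (forall (q1 q2 : R * R -> R) (K' : (R * R -> R) -> R),
          closureP a d s0 s1 q1 -> closureP a d s0 s1 q2 ->
          frechet_derivative a (K a alpha lambda gamma) q1 K' ->
          K a alpha lambda gamma q2 - K a alpha lambda gamma q1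
            - K' (q2 \- q1)
          >= B * expR (- 2 * lambda * (2 * alpha * a - mu))
               * hnorm (Rset a alpha mu) 1 (q2 \- q1) ^+ 2
           + B * expR (- 2 * lambda * (2 * alpha * a - mu))
               * h1norm1 `]0, 2 * alpha * a - mu[%classic
                   (fun x => tr_t0 a q2 x - tr_t0 a q1 x) ^+ 2
           + gamma / 2 * hnorm (Omega a) 4 (q2 \- q1) ^+ 2)]).
Proof.
have ar (k1 k2 l l' r c w h1 h2 n A B E F : R) : 0 <= c -> k2 = k1 + l + r -> l' = l ->
    c * (A + B + E + F) + n <= r -> w * h1 <= A + B -> w * h2 <= E + F ->
    k2 - k1 - l' >= c * w * h1 + c * w * h2 + n.
  move=> c0 -> -> h3 h4 h5; have m1 := ler_wpM2l c0 h4; have m2 := ler_wpM2l c0 h5; lra.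
have a0 : 0 < a by apply: lt_le_trans ha; rewrite sqrtr_gt0 (lt_trans ltr01).
have /andP[al0 al2] := halpha.
split.
  move=> s0 s1 lambda gamma q l0 _ /(closureP_Pbar a0)[hq _ _ _ _].
  have [g hg E] := dK_riesz a0 gamma al0 l0 hq.
  exists g; split; first exact: hg.
  by apply: (dK_frechet a0 al0 l0 hq) => h hh; exact: esym (E h hh).
move=> C l0 C0 l01 carl.
pose k1 := 32 * (KS a * d ^+ 2) + 4; pose k2 := 32 * (KB a * d ^+ 2) + 4 * KM a d.
pose c := 2 * C * Ktr (2 * a); pose b := alpha * (2 * a).
pose l1 := Num.max l0 (Num.max (k1 / (C / 4)) (Num.max (k2 / (C / 4)) (256 * c / b ^+ 4))).
exists l1, (C / 4); split; [by rewrite le_max lexx|by rewrite divr_gt0|].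
move=> s0 s1 mu lambda gamma hmu hl /andP[hg _].
move: hl; rewrite !ge_max => /and4P[hl0 hl1 hl2 hl3].
have L1 : 1 <= lambda by exact: le_trans hl0.
have L0 : 0 < lambda by exact: lt_le_trans L1.
have C4 : 0 < C / 4 by rewrite divr_gt0.
have c1 : k1 <= C / 4 * lambda by rewrite mulrC -ler_pdivrMr.
have c2 : k2 <= C / 4 * lambda by rewrite mulrC -ler_pdivrMr.
have c3 : 2 * C * Ktr (2 * a) * lambda ^+ 3 * expR (- lambda * alpha * (2 * a)) <= 1.
  have := @expR_decay R c b lambda _ _ L0 hl3; rewrite /c /b !mulrA; apply.
    by rewrite !mulr_ge0// ltW// Ktr_gt0 ?mulr_gt0.
  by rewrite !mulr_gt0.
have g0 : 0 < gamma by apply: lt_le_trans hg; rewrite mulr_gt0// expR_gt0.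
have low q h : Pbar a d s0 s1 q -> Pbar a d s0 s1 (q \+ h) -> H04 a h -> _ :=
  fun Pq Pqh hh => let: And5 hq _ _ _ nq := Pq in let: And5 hqh _ _ _ nqh := Pqh in
    remK_lower a0 al0 L0 C0 carl hl0 L1 c1 c2 c3 hg hq nq hqh nqh hh.
split.
  move=> q1 q2 theta /(closureP_Pbar a0) P1 /(closureP_Pbar a0) P2 ne th.
  apply: (strictly_convex a0 al0 L0 hd g0 _ P1 P2 ne th) => q h Pq Pqh hh.
  apply: le_trans (low q h Pq Pqh hh); rewrite lerDr; apply: mulr_ge0; first exact: ltW.
  by rewrite !addr_ge0//; apply: Rintegral_ge0 => z _; apply: mulr_ge0; rewrite ?expR_ge0 ?addr_ge0 ?sqr_ge0.
move=> q1 q2 K' /(closureP_Pbar a0) P1 /(closureP_Pbar a0) P2 fr.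
have hh := Pbar_H04 a0 P1 P2.
have hq1 : H4 a q1 by case: P1.
have hq2 : H4 a q2 by case: P2.
have h4 := H4B hq2 hq1.
have e : q1 \+ (q2 \- q1) = q2 by apply/funext => z; rewrite /= addrC subrK.
have Ke := K_expand a0 al0 L0 gamma hq1 h4; rewrite e in Ke.
have P2' : Pbar a d s0 s1 (q1 \+ (q2 \- q1)) by rewrite e.
exact: ar (ltW C4) Ke (frechet_uniq a0 al0 L0 hq1 hh fr) (low _ _ P1 P2' hh)
  (hnorm_Rset a0 halpha hmu L0 h4) (h1norm1_trace a0 halpha hmu L0 hq1 hq2).
Qed.
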